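(* Let $\sigma\in C([0,\infty);\mathbb{R}^{d\times r})$ and let $A$ be a $d\times d$ real matrix all of whose eigenvalues have negative real parts. For $\xi\in\mathbb{R}^d$ let $X(\cdot,\xi)$ be the unique continuous adapted process obeying \[ dX(t)=AX(t)\,dt+\sigma(t)\,dB(t),\quad t\ge 0;\quad X(0)=\xi. \] Suppose that there is $h>0$ such that the sequence $n\mapsto\int_{nh}^{(n+1)h}\|\sigma(s)\|_F^2\,ds$ is non-increasing. Then the following are equivalent: (A) $\lim_{n\to\infty}\int_{nh}^{(n+1)h}\|\sigma(s)\|_F^2\,ds\cdot\log n=0$; (B) $\lim_{t\to\infty}X(t,\xi)=0$ a.s. for each $\xi\in\mathbb{R}^d$; (C) There exists $\xi\in\mathbb{R}^d$ such that $\lim_{t\to\infty}X(t,\xi)=0$ with positive probability.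
   Context: $d,r$ are positive integers, $B$ is an $r$-dimensional standard Brownian motion, $\sigma$ is deterministic, and $\|\cdot\|_F$ is the Frobenius norm on $\mathbb{R}^{d\times r}$. *)

(* Defs.v *)
From HB Require Import structures.
From mathcomp Require Import all_boot all_order all_algebra.
From mathcomp Require Import complex.
From mathcomp Require Import all_classical all_reals all_analysis.

Set Implicit Arguments.
Unset Strict Implicit.
Unset Printing Implicit Defensive.

Import Order.TTheory GRing.Theory Num.Theory.
Import numFieldNormedType.Exports.

Local Open Scope classical_set_scope.
Local Open Scope ring_scope.

Definition frobenius_norm (R : realType) (m n : nat) (M : 'M[R]_(m, n)) : R :=
  Num.sqrt (\sum_i \sum_j M i j ^+ 2).

Definition complex_eigenvalue (R : realType) (d : nat) (A : 'M[R]_d)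
    (z : complex.complex R) : Prop :=
  eigenvalue (map_mx (complex.real_complex R) A) z.

(* Time is the half-line [0, +oo[ of R: processes and filtrations are indexed by
   R, and their values at negative times are irrelevant. *)

Definition filtration (disp : measure_display) (T : measurableType disp)
    (R : realType) (F : R -> set (set T)) : Prop :=
  [/\ forall t : R, 0 <= t -> sigma_algebra setT (F t),
      forall t : R, 0 <= t -> F t `<=` measurable &
      forall s t : R, 0 <= s -> s <= t -> F s `<=` F t].

Definition adapted (T : Type) (R : realType) (F : R -> set (set T)) (n : nat)
    (X : R -> T -> 'cV[R]_n) : Prop :=
  forall t : R, 0 <= t -> forall (i : 'I_n) (C : set R), measurable C ->
    F t [set w | C (X t w i 0)].

(* In the last clause, E and the events attached to the components of the
   increment may be the whole space, so the product rule over all of them is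
   the mutual independence of F s and of the r components of B t - B s. *)
Definition brownian_motion (disp : measure_display) (T : measurableType disp)
    (R : realType) (P : probability T R) (F : R -> set (set T)) (r : nat)
    (B : R -> T -> 'cV[R]_r) : Prop :=
  [/\ adapted F B,
      {ae P, forall w, B 0 w = 0},
      {ae P, forall w, {within `[0, +oo[, continuous (fun t => B t w)}},
      (forall s t : R, 0 <= s -> s < t -> forall (j : 'I_r) (C : set R),
         measurable C ->
         P [set w | C ((B t w - B s w) j 0)]
           = normal_prob 0 (Num.sqrt (t - s)) C) &
      (forall s t : R, 0 <= s -> s < t ->
         forall (E : set T) (C : 'I_r -> set R),
         F s E -> (forall j, measurable (C j)) ->
         P (E `&` [set w | forall j, C j ((B t w - B s w) j 0)])
           = (P E
              * \prod_(j < r) P [set w | C j ((B t w - B s w)%R j 0%R)])%E)].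

Record step_function (R : realType) (d r : nat) := StepFunction {
  steps : nat;
  node : nat -> R;
  coef : nat -> 'M[R]_(d, r)
}.

Definition nodes_in (R : realType) (d r : nat) (t : R)
    (phi : step_function R d r) : Prop :=
  [/\ 0 <= node phi 0,
      forall k, (k < steps phi)%N -> node phi k <= node phi k.+1 &
      node phi (steps phi) <= t].

Definition step_eval (R : realType) (d r : nat) (phi : step_function R d r)
    (s : R) : 'M[R]_(d, r) :=
  \sum_(k < steps phi) \1_(`]node phi k, node phi k.+1]) s *: coef phi k.

Definition step_integral (R : realType) (T : Type) (d r : nat)
    (B : R -> T -> 'cV[R]_r) (phi : step_function R d r) (w : T) : 'cV[R]_d :=
  \sum_(k < steps phi) coef phi k *m (B (node phi k.+1) w - B (node phi k) w).

(* [I] is (a version of) the Ito integral of the deterministic integrand [sigma]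
   over [0, t]: the integral is defined on deterministic step functions and
   extended to square-integrable integrands by L^2-continuity (Ito isometry). *)
Definition is_ito_integral (disp : measure_display) (T : measurableType disp)
    (R : realType) (P : probability T R) (d r : nat) (B : R -> T -> 'cV[R]_r)
    (sigma : R -> 'M[R]_(d, r)) (t : R) (I : T -> 'cV[R]_d) : Prop :=
  (forall i, measurable_fun setT (fun w => I w i 0)) /\
  exists phi : nat -> step_function R d r,
    [/\ forall n, nodes_in t (phi n),
        (\int[lebesgue_measure]_(s in `[0%R, t])
           (frobenius_norm (sigma s - step_eval (phi n) s)%R ^+ 2)%:E)%E
          @[n --> \oo] --> 0%E &
        ('E_P[(fun w =>
           frobenius_norm (I w - step_integral B (phi n) w) ^+ 2)%R])%E
          @[n --> \oo] --> 0%E].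

(* [X] is a continuous adapted solution of
     dX(t) = A X(t) dt + sigma(t) dB(t),  t >= 0;  X(0) = xi. *)
Definition is_solution (disp : measure_display) (T : measurableType disp)
    (R : realType) (P : probability T R) (F : R -> set (set T)) (d r : nat)
    (B : R -> T -> 'cV[R]_r) (A : 'M[R]_d) (sigma : R -> 'M[R]_(d, r))
    (xi : 'cV[R]_d) (X : R -> T -> 'cV[R]_d) : Prop :=
  [/\ adapted F X,
      forall w, {within `[0, +oo[, continuous (fun t => X t w)},
      {ae P, forall w, X 0 w = xi} &
      forall t : R, 0 <= t -> exists2 I : T -> 'cV[R]_d,
        is_ito_integral P B sigma t I &
        {ae P, forall w,
          X t w = X 0 w
            + \col_i \int[lebesgue_measure]_(s in `[0, t]) (A *m X s w) i 0
            + I w}].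

Definition block_intensity (R : realType) (d r : nat)
    (sigma : R -> 'M[R]_(d, r)) (h : R) (n : nat) : R :=
  \int[lebesgue_measure]_(s in `[n%:R * h, n.+1%:R * h])
    (frobenius_norm (sigma s) ^+ 2).

(* Main.v *)
Require Import Defs.
From HB Require Import structures.
From mathcomp Require Import all_boot all_order all_algebra.
From mathcomp Require Import complex.
From mathcomp Require Import all_classical all_reals all_analysis.
From mathcomp Require Import measurable_realfun.
From mathcomp Require Import ring lra.

Set Implicit Arguments.
Unset Strict Implicit.
Unset Printing Implicit Defensive.

Import Order.TTheory GRing.Theory Num.Theory.
Import numFieldNormedType.Exports.

Local Open Scope classical_set_scope.
Local Open Scope ring_scope.

(** The conditions are written cond_A, cond_B, cond_C as in the statement.  Let
    I(t) be the Ito integral of sigma over [0, t], let a_n be the intensity of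
    sigma over the n-th block [n h, (n + 1) h], and let
    J(t) = X(t) - X(0) - int_0^t A X be the noise read off a path of X.  J is
    continuous in t and equals I(t) almost surely at each fixed t, hence at all
    dyadic multiples of h outside a single null set ([noise_ito]).  All
    probabilistic estimates are therefore made for I at dyadic times, and the
    paths of J carry them to all times.

    cond_A implies cond_B.  At dyadic times I is a limit in probability of
    Gaussian sums over finer and finer grids ([ito_grid_in_probability]), and
    Doob's inequality for their exponential martingales ([wiener_sum_maximal])
    bounds the probability that I moves by more than e within block n by
    C exp (- lam e / 2 + lam^2 a_n / 2), for every lam >= 0 ([excursion_le]).
    For lam = (8 / e) ln n and a_n ln n -> 0 this is O(n^-2), so by
    Borel-Cantelli the oscillation of J over block n tends to 0 almost surely
    ([excursions_vanish]).  What remains concerns one path.  The solution K of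
    K' = J - K satisfies J - K -> 0, because K forgets its past exponentially
    fast while J hardly moves over a block ([ornstein_uhlenbeck_smoothing]).
    Then Y = X - (J - K) is differentiable and solves Y' = A Y + g with g -> 0,
    and since A is stable Y -> 0 ([hurwitz_vanish]), hence X -> 0.

    cond_C implies cond_A.  On a path with X -> 0 the increments
    J((k + 1) h) - J(k h) tend to 0, so for every x > 0 they are at most x from
    some k = N on.  If a_n ln n does not tend to 0, then a_n ln n >= eta > 0 for
    infinitely many n, and a_k >= eta / ln n for all k < n as the intensities do
    not increase.  For x small with respect to eta, the Gaussian lower tail
    ([wiener_sum_lower_tail]) gives the increment over block k < n, conditionally
    on the past, a probability of at least c n^(-1/2) to exceed x.  Hence the
    increments over the blocks N <= k < n are all at most x with probability at
    most (1 - c n^(-1/2))^(n - N), which tends to 0 along these n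
    ([small_increments_null]), and X -> 0 has probability 0.

    cond_B implies cond_C, because the event X -> 0 is measurable
    ([measurable_vanish]) and so has probability 1. *)

(** * Integrals of functions of a random variable *)
Section transfer.
Context d d' (T : measurableType d) (U : measurableType d') (R : realType).
Variables (mu : {measure set T -> \bar R}) (nu : {measure set U -> \bar R}).
Variables (Y : T -> U) (g : T -> R).
Hypotheses (mY : measurable_fun setT Y) (mg : measurable_fun setT g).
Hypothesis g0 : forall w, 0 <= g w.
Hypothesis dist_eq : forall C, measurable C ->
  (\int[mu]_(w in Y @^-1` C) (g w)%:E = nu C)%E.

Import HBNNSimple.

(** The hypothesis [dist_eq] says that nu is the image by Y of the measure with
    density g; it passes from indicators to simple functions and, by monotone
    convergence, to nonnegative functions.  The weight g lets the same lemma
    serve for laws with a density, for independence and for conditioning. *)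
Lemma ge0_integral_transfer (f : U -> R) : measurable_fun setT f ->
  (forall u, 0 <= f u) ->
  (\int[mu]_w (f (Y w) * g w)%:E = \int[nu]_u (f u)%:E)%E.
Proof.
move=> mf f0.
have mEf : measurable_fun setT (fun u => (f u)%:E) by exact/measurable_EFinP.
have Ef0 x : setT x -> (0 <= (f x)%:E)%E by rewrite lee_fin.
pose h := nnsfun_approx measurableT mEf.
have mhY n : measurable_fun setT (fun w => h n (Y w)).
  by apply: measurableT_comp => //; exact: measurable_funP.
transitivity (limn (fun n => \int[nu]_u (h n u)%:E))%E; last first.
  rewrite -monotone_convergence//.
  - by apply: eq_integral => u _; apply/cvg_lim => //; exact: cvg_nnsfun_approx.
  - by move=> n; exact/measurable_EFinP/measurable_funP.
  - by move=> n y _; rewrite lee_fin.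
  - by move=> y _ m n mn; rewrite lee_fin; exact/lefP/nd_nnsfun_approx.
transitivity (limn (fun n => \int[mu]_w (h n (Y w) * g w)%:E))%E.
  rewrite -monotone_convergence//.
  - apply: eq_integral => w _; apply/esym/cvg_lim => //.
    under eq_fun do rewrite EFinM; rewrite EFinM.
    by apply: cvgeZr; [by []|exact: (cvg_nnsfun_approx measurableT mEf Ef0)].
  - by move=> n; apply/measurable_EFinP; apply: measurable_funM.
  - by move=> n w _; rewrite lee_fin mulr_ge0.
  - move=> w _ m n mn; rewrite lee_fin ler_wpM2r//.
    exact/lefP/nd_nnsfun_approx.
congr (limn _); apply/funext => n.
have mYr r : measurable (Y @^-1` (h n @^-1` [set r])).
  by rewrite -[X in measurable X]setTI; apply: mY.
transitivity (\sum_(r \in range (h n))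
    \int[mu]_w (r * \1_(h n @^-1` [set r]) (Y w) * g w)%:E)%E.
  rewrite -ge0_integral_fsum//.
  - apply: eq_integral => w _; rewrite fsumEFin//; congr EFin.
    by rewrite {1}(fimfunE (h n) (Y w)) mulr_fsuml.
  - move=> r; apply/measurable_EFinP; apply: measurable_funM => //.
    apply: measurable_funM => //.
    exact: (@measurable_indic _ _ _ setT _ (mYr r)).
  - by move=> r w _; rewrite lee_fin mulr_ge0// -lee_fin nnfun_muleindic_ge0.
transitivity (\sum_(r \in range (h n)) (r%:E * nu (h n @^-1` [set r])))%E.
  apply: eq_fsbigr => r; rewrite inE => -[u _ <-].
  under eq_integral do rewrite -mulrA EFinM.
  rewrite ge0_integralZl//; first last.
  - by rewrite lee_fin.
  - by move=> w _; rewrite lee_fin mulr_ge0.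
  - apply/measurable_EFinP; apply: measurable_funM => //.
    exact: (@measurable_indic _ _ _ setT _ (mYr _)).
  congr (_ * _)%E; rewrite -dist_eq// [RHS]integral_mkcond.
  by apply: eq_integral => w _; rewrite EFinM muleC epatch_indic.
by rewrite -sintegralE integralT_nnsfun.
Qed.

End transfer.

(** Completing the square: exp (lam x) moves the mean of the Gaussian density
    from 0 to lam s^2. *)
Lemma normal_mgf (R : realType) (s lam : R) : s != 0 ->
  (\int[normal_prob 0 s]_x (expR (lam * x))%:E =
   (expR (lam ^+ 2 * s ^+ 2 / 2))%:E)%E.
Proof.
move=> s0.
have <- : (\int[lebesgue_measure]_x (expR (lam * x) * normal_pdf 0 s x)%:E =
  \int[normal_prob 0 s]_x (expR (lam * x))%:E)%E.
  apply: (@ge0_integral_transfer _ _ _ _ R lebesgue_measure _ idfun) => //.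
  - exact: measurable_id.
  - exact: measurable_normal_pdf.
  - exact: normal_pdf_ge0.
  - by apply: measurableT_comp => //; exact: measurable_funM.
under eq_integral => x _.
  have -> : expR (lam * x) * normal_pdf 0 s x =
     expR (lam ^+ 2 * s ^+ 2 / 2) * normal_pdf (lam * s ^+ 2) s x.
    rewrite !normal_pdfE// /normal_fun mulrCA [RHS]mulrCA.
    congr (_ * _); rewrite -!expRD; congr expR.
    by rewrite -[s ^+ 2 *+ 2]mulr_natr; field.
  rewrite EFinM; over.
rewrite ge0_integralZl//.
- by rewrite integral_normal_pdf mule1.
- by apply/measurable_EFinP; exact: measurable_normal_pdf.
- by move=> x _; rewrite lee_fin normal_pdf_ge0.
Qed.

(** The sigma-algebras of a filtration are families of sets rather than
    structures on the type of outcomes; this is measurability with respect to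
    one of them. *)
Definition sub_measurable (T : Type) (R : realType) (G : set (set T)) (Y : T -> R) :=
  forall C, measurable C -> G (Y @^-1` C).

Section sub_measurable_theory.
Context d (T : measurableType d) (R : realType) (G : set (set T)).
Hypothesis sG : sigma_algebra setT G.

Lemma sub_measurableP (Y : T -> R) :
  sub_measurable G Y <-> measurable_fun [set: g_sigma_algebraType G] Y.
Proof.
have GE : @measurable _ (g_sigma_algebraType G) = G.
  by rewrite -[RHS](sigma_algebra_id sG).
split=> mY.
- by move=> _ C mC; rewrite setTI GE; exact: mY.
- by move=> C mC; have := mY measurableT C mC; rewrite setTI GE.
Qed.

End sub_measurable_theory.

Section independent_product.
Context d (T : measurableType d) (R : realType) (P : probability T R) (r : nat).
Variables (N : probability (measurableTypeR R) R).
Variables (E : set T) (mE : measurable E) (D : 'I_r -> T -> R).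
Hypothesis mD : forall j, measurable_fun setT (D j).
Hypothesis indep : forall C : 'I_r -> set R, (forall j, measurable (C j)) ->
  P (E `&` [set w | forall j, C j (D j w)]) = (P E * \prod_(j < r) N (C j))%E.

(** Induction on the number k of coordinates that carry arbitrary functions: the
    coordinates from k on carry indicators.  When all of them do, this is the
    product rule; to free coordinate k, the transfer lemma is applied to the
    measure C |-> E[1_E 1_C(D k) (other factors)], which by induction is a
    multiple of N. *)
Lemma independent_product_integral (f : 'I_r -> R -> R) (m : 'I_r -> R) :
  (forall j, measurable_fun setT (f j)) -> (forall j x, 0 <= f j x) ->
  (forall j, (\int[N]_x (f j x)%:E = (m j)%:E)%E) ->
  (\int[P]_w (\1_E w * \prod_(j < r) f j (D j w))%:E =
   P E * (\prod_(j < r) m j)%:E)%E.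
Proof.
have mprod (Q : pred 'I_r) (g : 'I_r -> R -> R) :
    (forall j, measurable_fun setT (g j)) ->
    measurable_fun setT (fun w => \1_E w * \prod_(j < r | Q j) g j (D j w)).
  move=> mg; apply: measurable_funM; first exact: measurable_indic.
  under eq_fun do rewrite big_mkcond/=.
  apply: measurable_prod => j _; case: (Q j) => //.
  exact: measurableT_comp.
suff H k : (k <= r)%N -> forall (g : 'I_r -> R -> R) (m : 'I_r -> R),
    (forall j, measurable_fun setT (g j)) -> (forall j x, 0 <= g j x) ->
    (forall j, (\int[N]_x (g j x)%:E = (m j)%:E)%E) ->
    (forall j : 'I_r, (k <= j)%N -> exists2 C, measurable C & g j = \1_C) ->
  (\int[P]_w (\1_E w * \prod_(j < r) g j (D j w))%:E =
   P E * (\prod_(j < r) m j)%:E)%E.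
  move=> mf f0 fm; apply: (H r) => // j.
  by rewrite leqNgt ltn_ord.
elim: k => [_|k IH kr] {}f {}m mf f0 fm fi.
  have /choice [C mC] : forall j, exists C : set R, measurable C /\ f j = \1_C.
    by move=> j; have [//|C] := fi j; exists C.
  have NC j : N (C j) = (m j)%:E.
    have [? fjE] := mC j; rewrite -fm fjE integral_indic ?setIT//.
  rewrite (_ : (\prod_(j < r) m j)%:E = \prod_(j < r) N (C j))%E; last first.
    by rewrite -prodEFin; apply: eq_bigr => j _; rewrite NC.
  rewrite -indep; last by move=> j; case: (mC j).
  have mA : measurable (E `&` [set w | forall j, C j (D j w)]).
    apply: measurableI => //.
    rewrite (_ : [set w | _] = \bigcap_(j in [set: 'I_r]) (D j @^-1` C j)).
      apply: fin_bigcap_measurable => // j _.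
      rewrite -[X in measurable X]setTI; apply: mD => //.
      by case: (mC j).
    by apply/seteqP; split => w /= H j; [move=> _|]; exact: H.
  rewrite -[X in P X]setIT -integral_indic//.
  apply: eq_integral => w _; congr EFin; rewrite indicI; congr (_ * _).
  rewrite indicE; case: (boolP (w \in _)); rewrite ?inE ?notin_setE /= => H.
    by rewrite big1// => j _; case: (mC j) => _ ->; rewrite indicE mem_set//; exact: H.
  have [j nCj] : exists j, ~ C j (D j w) by apply/existsNP.
  by rewrite (bigD1 j)//=; case: (mC j) => _ ->; rewrite indicE memNset// mul0r.
pose j0 := Ordinal kr.
pose g w := \1_E w * \prod_(j < r | j != j0) f j (D j w).
have m0 j : 0 <= m j.
  by rewrite -lee_fin -fm integral_ge0// => x _; rewrite lee_fin.
have c0 : 0 <= fine (P E) * \prod_(j < r | j != j0) m j.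
  by rewrite mulr_ge0 ?fine_ge0// prodr_ge0.
pose c : {nonneg R} := NngNum c0.
have cE : c%:num%:E = (P E * (\prod_(j < r | j != j0) m j)%:E)%E.
  by rewrite /c/= EFinM fineK// fin_num_measure.
transitivity (\int[P]_w (f j0 (D j0 w) * g w)%:E)%E.
  by apply: eq_integral => w _; rewrite (bigD1 j0)//= mulrCA.
rewrite (@ge0_integral_transfer _ _ _ _ _ _ (mscale c N))//; last exact: mf.
- rewrite ge0_integral_mscale//; last by move=> x _; rewrite lee_fin.
    by rewrite fm cE -muleA -EFinM mulrC [in RHS](bigD1 j0).
  by apply/measurable_EFinP; exact: mf.
- exact: mD.
- exact: mprod.
- by move=> w; rewrite /g mulr_ge0// prodr_ge0.
move=> C mC.
transitivity (c%:num%:E * N C)%E; last by [].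
rewrite cE integral_mkcond.
pose f' j := if j == j0 then \1_C else f j.
pose m' j := if j == j0 then fine (N C) else m j.
transitivity (\int[P]_w (\1_E w * \prod_(j < r) f' j (D j w))%:E)%E.
  apply: eq_integral => w _; rewrite (bigD1 j0)//= mulrCA {1}/f' eqxx EFinM.
  rewrite epatch_indic muleC; congr (_ * _)%E; congr ((_ * _)%:E).
  by apply: eq_bigr => j /negbTE jj0; rewrite /f' jj0.
rewrite (IH (ltnW kr) f' m').
- rewrite (bigD1 j0)//= EFinM {1}/m' eqxx fineK ?fin_num_measure// muleCA muleC.
  congr (_ * _%:E * _)%E.
  by apply: eq_bigr => j /negbTE jj0; rewrite /m' jj0.
- by move=> j; rewrite /f'; case: eqP => // _; exact: measurable_indic.
- by move=> j x; rewrite /f'; case: eqP.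
- move=> j; rewrite /f' /m'; case: eqP => // _.
  by rewrite integral_indic// setIT fineK ?fin_num_measure.
- move=> j; rewrite leq_eqVlt => /predU1P[kj|kj].
    by exists C => //; rewrite /f' (_ : j == j0)//; apply/eqP/val_inj.
  have [B mB fjB] := fi j kj; exists B => //.
  by rewrite /f'; case: eqP => // jj0; move: kj; rewrite jj0 ltnn.
Qed.

End independent_product.

(** Keeps the pushforward opaque, so that only its values are ever compared. *)
Lemma pushforward_measure_ex d d' (T1 : measurableType d) (T2 : measurableType d')
    (R : realType) (m : {measure set T1 -> \bar R}) (f : T1 -> T2) :
  measurable_fun setT f ->
  exists nu : {measure set T2 -> \bar R}, forall C, nu C = m (f @^-1` C).
Proof. by move=> mf; unshelve eexists (pushforward m f). Qed.

(** A factor h that averages to m over every event of the form E, Y in C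
    averages to m against every function of Y restricted to E.  For h the
    exponential of a Brownian increment and E, Y in the past, this is
    conditioning on the past. *)
Lemma ge0_integral_factor d (T : measurableType d) (R : realType)
    (mu : {measure set T -> \bar R}) (E : set T) (mE : measurable E)
    (Y h : T -> R) (m : {nonneg R}) (f : R -> R) :
  measurable_fun setT Y -> measurable_fun setT h -> (forall w, 0 <= h w) ->
  measurable_fun setT f -> (forall x, 0 <= f x) ->
  (forall C, measurable C ->
    (\int[mu]_w (\1_(E `&` Y @^-1` C) w * h w)%:E =
     m%:num%:E * mu (E `&` Y @^-1` C))%E) ->
  (\int[mu]_w (f (Y w) * (\1_E w * h w))%:E =
   m%:num%:E * \int[mu]_w (f (Y w) * \1_E w)%:E)%E.
Proof.
move=> mY mh h0 mf f0 H.
have [nu nuE] : exists nu : {measure set R -> \bar R},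
    forall C, nu C = (m%:num%:E * mu (E `&` Y @^-1` C))%E.
  have [nu0 nu0E] := pushforward_measure_ex (mrestr mu mE) mY.
  by exists (mscale m nu0) => C; rewrite /= /mscale /= nu0E /mrestr setIC.
have mYC C : measurable C -> measurable (Y @^-1` C).
  by move=> mC; rewrite -[X in measurable X]setTI; exact: mY.
rewrite (@ge0_integral_transfer _ _ _ _ _ mu nu)//.
- rewrite -(@ge0_integral_transfer _ _ _ _ _ mu nu Y (fun w => m%:num * \1_E w))//.
  + under eq_integral do rewrite mulrCA EFinM.
    rewrite ge0_integralZl//.
    * apply/measurable_EFinP; apply: measurable_funM => //.
      exact: measurableT_comp.
    * by move=> w _; rewrite lee_fin mulr_ge0.
  + exact: measurable_funM.
  + move=> C mC; under eq_integral do rewrite EFinM.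
    rewrite ge0_integralZl//; first by rewrite nuE integral_indic//; exact: mYC.
    * exact: mYC.
    * apply/measurable_EFinP; exact/measurable_funTS.
- exact: measurable_funM.
- by move=> w; rewrite mulr_ge0.
move=> C mC; rewrite nuE -H// integral_mkcond; apply: eq_integral => w _.
by rewrite epatch_indic /= indicI /= -EFinM mulrAC.
Qed.

(** * Exponential moments of sums of Brownian increments *)
Section brownian_mgf.
Context disp (T : measurableType disp) (R : realType) (P : probability T R).
Variables (F : R -> set (set T)) (r : nat) (B : R -> T -> 'cV[R]_r).
Hypotheses (hF : filtration F) (hB : brownian_motion P F B).

Lemma filtration_measurable t E : 0 <= t -> F t E -> measurable E.
Proof. by case: hF => _ H _ t0; exact: H. Qed.

Lemma sub_measurable_measurable t (Y : T -> R) : 0 <= t -> sub_measurable (F t) Y ->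
  measurable_fun setT Y.
Proof.
by move=> t0 FY _ C mC; rewrite setTI; apply: (filtration_measurable t0); exact: FY.
Qed.

Lemma sub_measurable_le s t (Y : T -> R) : 0 <= s -> s <= t -> sub_measurable (F s) Y -> sub_measurable (F t) Y.
Proof. by move=> s0 st FY C mC; case: hF => _ _ H; apply: (H s t) => //; exact: FY. Qed.

Lemma sub_measurable_brownian t j : 0 <= t -> sub_measurable (F t) (fun w => B t w j 0).
Proof. by move=> t0 C mC; case: hB => H _ _ _ _; exact: H. Qed.

Lemma sub_measurable_increment s t (c : 'rV[R]_r) : 0 <= s -> s <= t ->
  sub_measurable (F t) (fun w => (c *m (B t w - B s w)) 0 0).
Proof.
move=> s0 st; have t0 := le_trans s0 st.
have sF : sigma_algebra setT (F t) by case: hF => + _ _; apply.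
apply/sub_measurableP => //; under eq_fun do rewrite mxE.
apply: measurable_sum => j; apply: measurable_funM => //.
under eq_fun do rewrite !mxE.
apply: measurable_funB; apply/sub_measurableP => //; first exact: sub_measurable_brownian.
by apply: (sub_measurable_le s0 st); exact: sub_measurable_brownian.
Qed.

Definition sqnorm (c : 'rV[R]_r) : R := \sum_j c 0 j ^+ 2.

Lemma brownian_mgf s t E (c : 'rV[R]_r) : 0 <= s -> s <= t -> F s E ->
  (\int[P]_w (\1_E w * expR ((c *m (B t w - B s w)) 0 0))%:E =
   P E * (expR (sqnorm c * (t - s) / 2))%:E)%E.
Proof.
move=> s0; rewrite le_eqVlt => /predU1P[<-|st] FE.
  have mE := filtration_measurable s0 FE.
  under eq_integral do rewrite subrr mulmx0 mxE expR0 mulr1.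
  by rewrite integral_indic// setIT subrr mulr0 mul0r expR0 mule1.
have mE := filtration_measurable s0 FE.
case: hB => _ _ _ hnorm hind.
pose N : probability (measurableTypeR R) R := normal_prob 0 (Num.sqrt (t - s)).
have ts0 : 0 < t - s by rewrite subr_gt0.
have sts0 : Num.sqrt (t - s) != 0 by rewrite lt0r_neq0// sqrtr_gt0.
have mD (j : 'I_r) : measurable_fun setT (fun w => (B t w - B s w) j 0).
  under eq_fun do rewrite !mxE.
  have t0 : 0 <= t := le_trans s0 (ltW st).
  apply: measurable_funB; [apply: (sub_measurable_measurable t0) | apply: (sub_measurable_measurable s0)];
  exact: sub_measurable_brownian.
transitivity (\int[P]_w (\1_E w * \prod_(j < r)
    expR (c 0 j * (B t w - B s w) j 0))%:E)%E.
  by apply: eq_integral => w _; rewrite mxE expR_sum.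
rewrite (@independent_product_integral _ _ _ P r N E mE _ mD _ (fun j x => expR (c 0 j * x)) (fun j => expR (c 0 j ^+ 2 * (t - s) / 2))) //.
- by rewrite -expR_sum /sqnorm !mulr_suml.
- move=> C mC; rewrite hind//; congr (_ * _)%E; apply: eq_bigr => j _.
  by rewrite hnorm.
- by move=> j; apply: measurableT_comp => //; exact: measurable_funM.
- by move=> j; rewrite normal_mgf// sqr_sqrtr// ltW.
Qed.

(** Conditionally on the past, an increment multiplies exponentials by the
    moment generating function of its Gaussian law. *)
Lemma brownian_weighted_mgf s t E (Y : T -> R) (c : 'rV[R]_r) :
  0 <= s -> s <= t -> F s E -> sub_measurable (F s) Y ->
  (\int[P]_w (\1_E w * expR (Y w + (c *m (B t w - B s w)) 0 0))%:E =
   (expR (sqnorm c * (t - s) / 2))%:E * \int[P]_w (\1_E w * expR (Y w))%:E)%E.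
Proof.
move=> s0 st FE FY; have t0 := le_trans s0 st.
have mE := filtration_measurable s0 FE.
have sF : sigma_algebra setT (F s) by case: hF => + _ _; apply.
have m0 : 0 <= expR (sqnorm c * (t - s) / 2) by exact: expR_ge0.
transitivity (\int[P]_w (expR (Y w) *
    (\1_E w * expR ((c *m (B t w - B s w)) 0 0)))%:E)%E.
  by apply: eq_integral => w _; rewrite expRD mulrCA.
rewrite (@ge0_integral_factor _ _ _ P E mE Y _ (NngNum m0) expR)//.
- by congr (_ * _)%E; apply: eq_integral => w _; rewrite mulrC.
- exact: (sub_measurable_measurable s0).
- by apply: measurableT_comp => //; apply: (sub_measurable_measurable t0); exact: sub_measurable_increment.
move=> C mC /=; rewrite muleC brownian_mgf//.
have -> : E `&` Y @^-1` C = \bigcap_(k in [set: bool]) (if k then E else Y @^-1` C).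
  by apply/seteqP; split=> w; [move=> [? ?] [] _|move=> H; split; [exact: (H true)|exact: (H false)]].
have -> : F s = @measurable _ (g_sigma_algebraType (F s)).
  by rewrite -[LHS](sigma_algebra_id sF).
apply: fin_bigcap_measurable => // -[] _; rewrite /measurable/=; apply: sub_sigma_algebra => //.
exact: FY.
Qed.

End brownian_mgf.

Section wiener_sums.
Context disp (T : measurableType disp) (R : realType) (P : probability T R).
Variables (F : R -> set (set T)) (r : nat) (B : R -> T -> 'cV[R]_r).
Hypotheses (hF : filtration F) (hB : brownian_motion P F B).
Variables (x : nat -> R) (c : nat -> 'rV[R]_r).
Hypotheses (x0 : 0 <= x 0) (ndx : nondecreasing_seq x).

(** The Wiener integral of the step function with value [c l] on
    ]x l, x l.+1], and below it its variance. *)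
Definition wiener_sum (p q : nat) (w : T) : R :=
  \sum_(p <= l < q) (c l *m (B (x l.+1) w - B (x l) w)) 0 0.

Definition wiener_var (p q : nat) : R :=
  \sum_(p <= l < q) sqnorm (c l) * (x l.+1 - x l).

Let x_ge0 n : 0 <= x n. Proof. exact: le_trans (ndx (leq0n n)). Qed.

Let x_le n : x n <= x n.+1. Proof. exact: ndx. Qed.

Lemma sqnorm_ge0 (a : 'rV[R]_r) : 0 <= sqnorm a.
Proof. by apply: sumr_ge0 => j _; exact: sqr_ge0. Qed.

Lemma wiener_var_ge0 p q : 0 <= wiener_var p q.
Proof. by apply: sumr_ge0 => l _; rewrite mulr_ge0 ?sqnorm_ge0// subr_ge0. Qed.

Lemma wiener_var_le p k q : (p <= k)%N -> (k <= q)%N ->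
  wiener_var p k <= wiener_var p q.
Proof.
move=> pk kq; rewrite /wiener_var [leRHS](big_cat_nat pk kq)/= lerDl.
exact: wiener_var_ge0.
Qed.

Lemma sub_measurable_wiener_sum p q : (p <= q)%N -> sub_measurable (F (x q)) (wiener_sum p q).
Proof.
have sF t : 0 <= t -> sigma_algebra setT (F t) by case: hF => + _ _; apply.
elim: q => [|q IH] pq.
  move: pq; rewrite leqn0 => /eqP ->; apply/sub_measurableP; first exact: sF.
  by rewrite /wiener_sum; under eq_fun do rewrite big_geq//; exact: measurable_cst.
move: pq; rewrite leq_eqVlt => /predU1P[->|].
  apply/sub_measurableP; first exact: sF.
  by rewrite /wiener_sum; under eq_fun do rewrite big_geq//; exact: measurable_cst.
rewrite ltnS => pq; apply/sub_measurableP; first exact: sF.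
rewrite /wiener_sum; under eq_fun do rewrite big_nat_recr//=.
apply: measurable_funD; apply/sub_measurableP; [exact: sF| |exact: sF|].
  by apply: (sub_measurable_le hF (x_ge0 q) (x_le q)); exact: IH.
exact: (sub_measurable_increment hF hB).
Qed.

Lemma measurable_wiener_sum p q : (p <= q)%N -> measurable_fun setT (wiener_sum p q).
Proof.
move=> pq; apply: (sub_measurable_measurable hF (x_ge0 q)); exact: sub_measurable_wiener_sum.
Qed.

Lemma wiener_sum_mgf (lam : R) p k q E : (p <= k)%N -> (k <= q)%N -> F (x k) E ->
  (\int[P]_w (\1_E w * expR (lam * wiener_sum p q w))%:E =
   (expR (lam ^+ 2 * wiener_var k q / 2))%:E *
   \int[P]_w (\1_E w * expR (lam * wiener_sum p k w))%:E)%E.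
Proof.
move=> pk; elim: q => [|q IH] kq FE.
  move: kq; rewrite leqn0 => /eqP ->.
  by rewrite /wiener_var big_geq// mulr0 mul0r expR0 mul1e.
move: kq; rewrite leq_eqVlt => /predU1P[->|].
  by rewrite /wiener_var big_geq// mulr0 mul0r expR0 mul1e.
rewrite ltnS => kq.
have FEq : F (x q) E by case: hF => _ _ H; apply: (H (x k)) => //; exact: ndx.
have pq := leq_trans pk kq.
transitivity (\int[P]_w (\1_E w * expR (lam * wiener_sum p q w +
   ((lam *: c q) *m (B (x q.+1) w - B (x q) w)) 0 0))%:E)%E.
  apply: eq_integral => w _; rewrite {1}/wiener_sum big_nat_recr//= mulrDr.
  by rewrite -scalemxAl [in RHS]mxE.
rewrite (brownian_weighted_mgf hF hB (lam *: c q) (x_ge0 q) (x_le q) FEq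
  (Y := fun w => lam * wiener_sum p q w)).
  rewrite IH// muleA; congr (_ * _)%E; rewrite -EFinM -expRD; congr (expR _)%:E.
  rewrite /wiener_var big_nat_recr//= -/(wiener_var k q).
  have -> : sqnorm (lam *: c q) = lam ^+ 2 * sqnorm (c q).
    by rewrite /sqnorm mulr_sumr; apply: eq_bigr => j _; rewrite mxE exprMn.
  by rewrite -!mulrDl -mulrA -mulrDr addrC.
have sF : sigma_algebra setT (F (x q)) by case: hF => + _ _; apply.
apply/sub_measurableP => //; apply: measurable_funM => //.
by apply/sub_measurableP => //; exact: sub_measurable_wiener_sum.
Qed.

End wiener_sums.

Lemma integral_cst_indic d (T : measurableType d) (R : realType)
    (mu : {measure set T -> \bar R}) (D : set T) (K : R) :
  measurable D -> 0 <= K -> (\int[mu]_w (K * \1_D w)%:E = K%:E * mu D)%E.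
Proof.
move=> mD K0; under eq_integral do rewrite EFinM.
rewrite ge0_integralZl//; first by rewrite integral_indic// setIT.
by apply/measurable_EFinP; exact: measurable_indic.
Qed.

(** * Upper and lower tails of sums of Brownian increments *)
Section wiener_tails.
Context disp (T : measurableType disp) (R : realType) (P : probability T R).
Variables (F : R -> set (set T)) (r : nat) (B : R -> T -> 'cV[R]_r).
Hypotheses (hF : filtration F) (hB : brownian_motion P F B).
Variables (x : nat -> R) (c : nat -> 'rV[R]_r).
Hypotheses (x0 : 0 <= x 0) (ndx : nondecreasing_seq x).

Local Notation S := (wiener_sum B x c).
Local Notation v := (wiener_var x c).

Let x_ge0 n : 0 <= x n. Proof. exact: le_trans (ndx (leq0n n)). Qed.

(** Doob's inequality for the martingale exp (lam S_k - lam^2 v_k / 2).  With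
    [U k] the event that S has passed eps by time k and
    K = exp (lam eps - lam^2 v_q / 2), the quantity
    K P(U k) + E[martingale at k, not U k] starts below 1 and does not increase:
    where S first passes eps, the martingale is at least K. *)
Lemma wiener_sum_maximal (lam eps : R) p q : (p <= q)%N -> 0 <= lam -> 0 <= eps ->
  (P [set w | exists2 k, (p <= k <= q)%N & (eps < S p k w)%R] <=
   (expR (- (lam * eps) + lam ^+ 2 * v p q / 2))%:E)%E.
Proof.
move=> pq lam0 eps0.
pose U k := [set w | exists2 j, (p <= j <= k)%N & (eps < S p j w)%R].
pose K := expR (lam * eps - lam ^+ 2 * v p q / 2).
have sF t : 0 <= t -> sigma_algebra setT (F t) by case: hF => + _ _; apply.
have US k : U k.+1 = U k `|` [set w | (p <= k.+1)%N /\ eps < S p k.+1 w].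
  apply/seteqP; split => w.
    move=> [j /andP[pj]]; rewrite leq_eqVlt => /predU1P[jk|jk] e.
      by right; split => //; rewrite -jk.
    by left; exists j => //; rewrite pj.
  move=> [[j /andP[pj jk] e]|[pk e]]; last by exists k.+1 => //; rewrite pk leqnn.
  by exists j => //; rewrite pj (leq_trans jk).
have FU k : (p <= k)%N -> F (x k) (U k).
  move=> pk.
  have GE : @measurable _ (g_sigma_algebraType (F (x k))) = F (x k).
    by rewrite -[RHS](sigma_algebra_id (sF _ (x_ge0 k))).
  rewrite (_ : U k = \bigcup_(j in [set j | (p <= j <= k)%N]) (S p j @^-1` `]eps, +oo[)).
    rewrite -GE; apply: bigcup_measurable => j /= /andP[pj jk]; rewrite GE.
    have : sub_measurable (F (x k)) (S p j).
      by apply: (sub_measurable_le hF (x_ge0 j) (ndx jk)); exact: (sub_measurable_wiener_sum hF hB).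
    by apply; exact: measurable_itv.
  apply/seteqP; split => w; first by move=> [j pj e]; exists j => //=; rewrite in_itv/= e.
  by move=> [j pj /=]; rewrite in_itv/= andbT => e; exists j.
have mU k : (p <= k)%N -> measurable (U k).
  by move=> pk; apply: (filtration_measurable hF (x_ge0 k)); exact: FU.
have mS k : (p <= k)%N -> measurable_fun setT (S p k).
  exact: (measurable_wiener_sum hF hB).
have mM (E : set T) k (a : R) : measurable E -> (p <= k)%N ->
    measurable_fun setT (fun w => (\1_E w * (expR (lam * S p k w) * a))%:E).
  move=> mE pk; apply/measurable_EFinP; apply: measurable_funM => //.
  apply: measurable_funM => //; apply: measurableT_comp => //.
  by apply: measurable_funM => //; exact: mS.
pose e k := expR (- (lam ^+ 2 * v p k / 2)).
have e0 k : 0 <= e k by exact: expR_ge0.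
have mart k n E : (p <= k)%N -> (k <= n)%N -> F (x k) E ->
    (\int[P]_w (\1_E w * (expR (lam * S p n w) * e n))%:E =
     \int[P]_w (\1_E w * (expR (lam * S p k w) * e k))%:E)%E.
  move=> pk kn FE.
  have mE := filtration_measurable hF (x_ge0 k) FE.
  have pull m : (p <= m)%N -> (\int[P]_w (\1_E w * (expR (lam * S p m w) * e m))%:E =
      (e m)%:E * \int[P]_w (\1_E w * expR (lam * S p m w))%:E)%E.
    move=> pm; rewrite -ge0_integralZl; [|exact: measurableT| | |].
    - by apply: eq_integral => w _; rewrite -EFinM mulrA mulrC.
    - have := mM E m 1 mE pm; under eq_fun do rewrite mulr1; exact.
    - by move=> w _; rewrite lee_fin mulr_ge0 ?expR_ge0.
    - by rewrite lee_fin.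
  rewrite pull; last exact: leq_trans kn.
  rewrite pull; last exact: pk.
  rewrite (wiener_sum_mgf hF hB c x0 ndx lam pk kn FE) muleA -EFinM -expRD.
  congr ((expR _)%:E * _)%E.
  by rewrite {1}/wiener_var (big_cat_nat pk kn)/= -/(v p k) -/(v k n); field.
have base : (K%:E * P (U p) +
    \int[P]_w (\1_(~` U p) w * (expR (lam * S p p w) * e p))%:E <= 1)%E.
  have Sp w : S p p w = 0 by rewrite /wiener_sum big_geq.
  have Up : U p = set0.
    rewrite -subset0 => w [j]; rewrite -eqn_leq => /eqP <-.
    by rewrite Sp ltNge eps0.
  rewrite Up measure0 mule0 add0e setC0 (eq_integral (cst 1%E)); last first.
    move=> w _; rewrite Sp /e /wiener_var big_geq// !mulr0 mul0r oppr0.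
    by rewrite expR0 indicT/= !mulr1.
  by rewrite integral_cst// mul1e; exact: probability_le1.
have key k : (p <= k)%N -> (k <= q)%N ->
    (K%:E * P (U k) + \int[P]_w (\1_(~` U k) w * (expR (lam * S p k w) * e k))%:E <= 1)%E.
  elim: k => [|k IH].
    by rewrite leqn0 => /eqP p0 _; rewrite -p0.
  rewrite leq_eqVlt => /predU1P[<- //|]; rewrite ltnS => pk kq.
  apply: le_trans (IH pk (ltnW kq)).
  have FUc : F (x k) (~` U k).
    by case: (sF _ (x_ge0 k)) => _ + _; rewrite -setTD; apply; exact: FU.
  rewrite -(mart k k.+1)//.
  have mUk := mU _ pk; have mUk1 := mU _ (leq_trans pk (leqnSn k)).
  have -> : P (U k.+1) = (P (U k) + P (U k.+1 `\` U k))%E.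
    rewrite -measureU//; last by rewrite setDE setICA setICr setI0.
      congr (P _); apply/seteqP; split=> w; last first.
        by move=> [Uw|[]//]; rewrite US; left.
      by move=> Uw; have [?|?] := pselect (U k w); [left|right].
    exact: measurableD.
  rewrite ge0_muleDr ?measure_ge0// -addeA leeD2l//.
  have mD : measurable (U k.+1 `\` U k) by exact: measurableD.
  have mC : measurable (~` U k.+1) by exact: measurableC.
  have -> : (K%:E * P (U k.+1 `\` U k) =
      \int[P]_w (K * \1_(U k.+1 `\` U k) w)%:E)%E.
    by rewrite integral_cst_indic// expR_ge0.
  rewrite -ge0_integralD//.
  - apply: ge0_le_integral => //.
    + by move=> w _; rewrite adde_ge0// lee_fin ?mulr_ge0 ?expR_ge0.
    + by apply: emeasurable_funD; [apply/measurable_EFinP; apply: measurable_funM|apply: mM => //; exact: leq_trans pk (leqnSn k)].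
    + by apply: mM; [exact: measurableC|exact: leq_trans pk (leqnSn k)].
    move=> w _; rewrite -EFinD lee_fin.
    have [Uw|Uw] := pselect (U k.+1 w); last first.
      rewrite [\1_(_ `\` _) w]indicE memNset//; last by move=> [].
      rewrite mulr0 add0r !indicE [w \in ~` U k.+1]mem_set// [w \in ~` U k]mem_set//.
      by move=> Ukw; apply: Uw; rewrite US; left.
    rewrite [\1_(~` U k.+1) w]indicE memNset//.
    rewrite mul0r addr0.
    have [Ukw|Ukw] := pselect (U k w).
      by rewrite !indicE memNset// ?memNset ?mulr0 ?mul0r//; move=> [].
    rewrite !indicE !mem_set// mulr1 mul1r /K /e -expRD ler_expR.
    have : eps < S p k.+1 w by move: Uw; rewrite US => -[//|[]].
    move=> /ltW eS; rewrite lerB//; last first.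
      rewrite ler_pM2r ?invr_gt0// ler_wpM2l ?sqr_ge0//.
      by apply: wiener_var_le => //; exact: leq_trans pk (leqnSn k).
    exact: ler_wpM2l.
  - by move=> w _; rewrite lee_fin mulr_ge0 ?expR_ge0.
  - by apply/measurable_EFinP; exact: measurable_funM.
  - by move=> w _; rewrite lee_fin !mulr_ge0 ?expR_ge0.
  - by apply: mM => //; exact: leq_trans pk (leqnSn k).
have : (K%:E * P (U q) <= 1)%E.
  apply: le_trans (key q pq (leqnn q)); rewrite leeDl// integral_ge0// => w _.
  by rewrite lee_fin !mulr_ge0 ?expR_ge0.
have PU : P (U q) = (fine (P (U q)))%:E by rewrite fineK// fin_num_measure//; exact: mU.
rewrite -/(U q) PU -EFinM !lee_fin.
by rewrite -ler_pdivlMl ?expR_gt0// mulr1 -expRN opprB addrC.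
Qed.

(** Second moment method, on an event E of the past.  Let z = exp (lam S), with
    mean m and second moment m^4 on E.  For lam = 4 (1 + u) / sqrt v, where
    u = y / sqrt v, one has z <= m / 2 as long as S < y, hence everywhere
    z <= m / 2 + K 1_(S >= y) + z^2 / K.  Taking K = 4 m^3 and integrating over E
    leaves P(E, S >= y) >= P(E) / (16 m^2), and m = exp (8 (1 + u)^2). *)
Lemma wiener_sum_lower_tail (y : R) p q E : (p <= q)%N -> F (x p) E ->
  0 < v p q -> 0 <= y ->
  (P E * (16^-1 * expR (- (32 + 32 * (y ^+ 2 / v p q))))%:E <=
   P (E `&` [set w | y <= S p q w]%R))%E.
Proof.
move=> pq FE v0 y0.
have mE := filtration_measurable hF (x_ge0 p) FE.
have mS := measurable_wiener_sum hF hB c x0 ndx pq.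
pose sv := Num.sqrt (v p q); have sv0 : 0 < sv by rewrite sqrtr_gt0.
have svE : sv ^+ 2 = v p q by rewrite sqr_sqrtr// ltW.
pose u := y / sv; have u0 : 0 <= u by rewrite divr_ge0// ltW.
pose lam := 4 * (1 + u) / sv.
pose m1 := expR (8 * (1 + u) ^+ 2).
have m10 : 0 < m1 by exact: expR_gt0.
have lamv : lam ^+ 2 * v p q / 2 = 8 * (1 + u) ^+ 2.
  by rewrite -svE /lam; field; rewrite gt_eqF.
pose G := [set w | y <= S p q w].
have mG : measurable G.
  rewrite (_ : G = S p q @^-1` `[y, +oo[).
    by rewrite -[X in measurable X]setTI; apply: mS => //; exact: measurable_itv.
  by apply/seteqP; split=> w /=; rewrite in_itv/= andbT.
have mgf a : (\int[P]_w (\1_E w * expR (a * S p q w))%:E =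
    P E * (expR (a ^+ 2 * v p q / 2))%:E)%E.
  rewrite (wiener_sum_mgf hF hB c x0 ndx a (leqnn p) pq FE) muleC; congr (_ * _)%E.
  rewrite (eq_integral (fun w => (1 * \1_E w)%:E)).
    by rewrite integral_cst_indic// mul1e.
  by move=> w _; rewrite /wiener_sum big_geq// mulr0 expR0 mulrC.
pose K := 4 * m1 ^+ 3; have K0 : 0 < K by rewrite mulr_gt0// exprn_gt0.
have ptw w : \1_E w * expR (lam * S p q w) <=
    (m1 / 2 * \1_E w + K * \1_(E `&` G) w) + K^-1 * (\1_E w * expR (2 * lam * S p q w)).
  rewrite indicI /= !indicE; case: (boolP (w \in E)) => wE; last by rewrite !(mulr0, mul0r, addr0).
  rewrite !(mul1r, mulr1); set z := expR (lam * _).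
  have z0 : 0 < z by exact: expR_gt0.
  have -> : expR (2 * lam * S p q w) = z ^+ 2 by rewrite -expRM_natl mulrA.
  have h2 : 0 <= K^-1 * z ^+ 2 by rewrite mulr_ge0 ?sqr_ge0// invr_ge0 ltW.
  have m12 : 0 <= m1 / 2 by rewrite divr_ge0// ltW.
  case: (boolP (w \in G)) => wG; rewrite ?mulr1 ?mulr0 ?addr0.
    have [zK|Kz] := leP z K; first by rewrite -addrA (le_trans zK)// addrCA lerDl addr_ge0.
    suff : z <= K^-1 * z ^+ 2 by move=> /le_trans; apply; rewrite lerDr addr_ge0// ltW.
    by rewrite mulrC ler_pdivlMr// expr2 ler_pM2l// ltW.
  suff : z <= m1 / 2 by move=> /le_trans; apply; rewrite lerDl.
  rewrite ler_pdivlMr//; apply: (@le_trans _ _ (z * expR 1)).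
    by rewrite ler_pM2l// (le_trans _ (expR_ge1Dx _)).
  rewrite /z -expRD ler_expR.
  have Sy : S p q w < y.
    by move: wG; rewrite notin_setE => nG; rewrite ltNge; apply/negP.
  have : lam * S p q w <= 4 * (1 + u) * u.
    have -> : 4 * (1 + u) * u = lam * y by rewrite /lam /u; ring.
    by rewrite ler_wpM2l ?(ltW Sy)// /lam divr_ge0 ?(ltW sv0)// mulr_ge0// addr_ge0.
  nra.
have mz a : measurable_fun setT (fun w => \1_E w * expR (a * S p q w)).
  apply: measurable_funM => //; apply: measurableT_comp => //.
  exact: measurable_funM.
have mEG : measurable (E `&` G) by exact: measurableI.
have m12 : 0 <= m1 / 2 by rewrite divr_ge0// ltW.
have K1 : 0 <= K^-1 by rewrite invr_ge0 ltW.
have : (\int[P]_w (\1_E w * expR (lam * S p q w))%:E <= \int[P]_w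
  ((m1 / 2 * \1_E w + K * \1_(E `&` G) w) + K^-1 * (\1_E w * expR (2 * lam * S p q w)))%:E)%E.
  apply: ge0_le_integral => //.
  - exact/measurable_EFinP.
  - apply/measurable_EFinP; apply: measurable_funD; last exact: measurable_funM.
    by apply: measurable_funD; exact: measurable_funM.
  - by move=> w _; rewrite lee_fin.
under [leRHS]eq_integral do rewrite EFinD EFinD.
rewrite ge0_integralD//; last 4 first.
- by move=> w _; rewrite adde_ge0 // lee_fin mulr_ge0// ltW.
- by apply: emeasurable_funD; apply/measurable_EFinP; exact: measurable_funM.
- by move=> w _; rewrite lee_fin mulr_ge0.
- by apply/measurable_EFinP; exact: measurable_funM.
rewrite ge0_integralD//; last 4 first.
- by move=> w _; rewrite lee_fin mulr_ge0.
- by apply/measurable_EFinP; exact: measurable_funM.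
- by move=> w _; rewrite lee_fin mulr_ge0// ltW.
- by apply/measurable_EFinP; exact: measurable_funM.
rewrite !integral_cst_indic//; last exact: ltW.
under eq_integral do rewrite EFinM.
under [X in (_ + X)%E]eq_integral do rewrite EFinM.
rewrite ge0_integralZl//; last exact/measurable_EFinP.
rewrite !mgf lamv -/m1.
have -> : expR ((2 * lam) ^+ 2 * v p q / 2) = m1 ^+ 4.
  by rewrite -expRM_natl; congr expR; rewrite exprMn -mulrA -mulrA (mulrA (lam ^+ 2)) lamv; ring.
move=> H; have : ((fine (P E))%:E * m1%:E <= (m1 / 2)%:E * (fine (P E))%:E +
    K%:E * (fine (P (E `&` G)))%:E + K^-1%:E * ((fine (P E))%:E * (m1 ^+ 4)%:E))%E.
  by rewrite !fineK// fin_num_measure.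
have <- : (fine (P E))%:E = P E by rewrite fineK// fin_num_measure.
have <- : (fine (P (E `&` G)))%:E = P (E `&` [set w | y <= S p q w]).
  by rewrite fineK// fin_num_measure.
rewrite -!EFinM -!EFinD !lee_fin {H}.
set a := fine (P E); set b := fine (P (E `&` G)) => H.
have a0 : 0 <= a by rewrite fine_ge0.
have Km : K^-1 * (a * m1 ^+ 4) = a * m1 / 4.
  by rewrite /K; field; rewrite gt_eqF.
have H2 : a * (16^-1 * m1 ^- 2) <= b.
  rewrite Km in H.
  rewrite mulrA ler_pdivrMr ?exprn_gt0// -(ler_pM2r m10).
  have -> : b * m1 ^+ 2 * m1 = K * b / 4 by rewrite /K; field.
  by move: H => /=; lra.
apply: le_trans H2; rewrite ler_wpM2l// ler_wpM2l// /m1 -expRM_natl -expRN ler_expR.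
have -> : y ^+ 2 / v p q = u ^+ 2 by rewrite /u -svE; field; rewrite gt_eqF.
have : 0 <= (u - 1) ^+ 2 by exact: sqr_ge0.
nra.
Qed.

End wiener_tails.

(** * Refinement of subdivisions *)
Section refinement.
Context (R : realType).
Variables (x : nat -> R) (M : nat).
Hypothesis ndx : nondecreasing_seq x.

(** Telescoping after the argument of f is clamped to [x p, x q]: the clamped
    function has the increments of f inside this interval and none outside.
    Repeated points of the subdivision do no harm, their increments being 0. *)
Lemma increment_refine (V : lmodType R) (f : R -> V) p q :
  (p <= q)%N -> (q <= M)%N ->
  f (x q) - f (x p) =
  \sum_(l < M) \1_(`]x p, x q]) (x l.+1) *: (f (x l.+1) - f (x l)).
Proof.
move=> pq qM; pose g y := f (Num.min (Num.max y (x p)) (x q)).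
transitivity (\sum_(l < M) (g (x l.+1) - g (x l))).
  rewrite -(big_mkord xpredT (fun l => g (x l.+1) - g (x l))) telescope_sumr//.
  have xp0 : x 0 <= x p by exact: ndx.
  have xqM : x q <= x M by exact: ndx.
  have xpq : x p <= x q by exact: ndx.
  rewrite /g (max_r xp0) (min_l xpq) max_l; last exact: le_trans xqM.
  by rewrite min_r.
apply: eq_bigr => l _; have xpq : x p <= x q by exact: ndx.
have [lp|pl] := leqP l.+1 p.
  have h1 : x l.+1 <= x p by exact: ndx.
  have h0 : x l <= x p by apply: ndx; exact: ltnW.
  rewrite /g !max_r// subrr indicE memNset ?scale0r//.
  by rewrite /= in_itv/= ltNge h1.
have [ql|lq] := leqP q l.
  have h0 : x q <= x l by exact: ndx.
  have h1 : x q <= x l.+1 by apply: ndx; exact: leqW.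
  have hp0 := le_trans xpq h0; have hp1 := le_trans xpq h1.
  rewrite /g !max_l// !min_r// subrr indicE.
  have [/set_mem|] := boolP (_ \in _); last by rewrite scale0r.
  rewrite /= in_itv/= => /andP[_ h2].
  have e1 : x l.+1 = x q by apply/eqP; rewrite eq_le h1 h2.
  have e0 : x l = x q.
    by apply/eqP; rewrite eq_le h0 andbT -e1; exact: ndx.
  by rewrite e1 e0 subrr scaler0.
rewrite ltnS in pl.
have h0 : x p <= x l by exact: ndx.
have h1 : x l.+1 <= x q by exact: ndx.
have h2 : x l <= x l.+1 by exact: ndx.
rewrite /g !max_l ?(le_trans h0)// !min_l ?(le_trans h2)//.
rewrite indicE; have [_|] := boolP (_ \in _); first by rewrite scale1r.
rewrite notin_setE /= in_itv/= => /negP; rewrite h1 andbT -leNgt => h3.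
have -> : x l.+1 = x l by apply/eqP; rewrite eq_le h2 (le_trans h3).
by rewrite subrr scaler0.
Qed.

Lemma indic_refine p q l s : x l < s -> s <= x l.+1 ->
  \1_(`]x p, x q]) s = \1_(`]x p, x q]) (x l.+1) :> R.
Proof.
move=> ls sl; rewrite !indicE; congr (_ %:R); congr nat_of_bool.
apply/idP/idP; rewrite !inE/= !in_itv/= => /andP[ps sq]; apply/andP; split.
- exact: lt_le_trans sl.
- apply: ndx; rewrite ltnNge; apply/negP => ql.
  by move: (lt_le_trans ls sq); rewrite ltNge ndx.
- apply: le_lt_trans ls; apply: ndx; rewrite leqNgt; apply/negP => lp.
  by move: ps; rewrite ltNge ndx.
- exact: le_trans sq.
Qed.

Lemma integral_piecewise (g gam : R -> R) p q : (p <= q)%N ->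
  measurable_fun setT g -> (forall s, 0 <= g s) ->
  (forall l s, (p <= l < q)%N -> x l < s -> s <= x l.+1 -> g s = g (x l.+1)) ->
  (\int[lebesgue_measure]_(s in `]x p, x q]) (g s)%:E =
   (\sum_(p <= l < q) g (x l.+1) * (x l.+1 - x l))%:E)%E.
Proof.
move=> + mg g0; elim: q => [|q IH].
  by rewrite leqn0 => /eqP -> _; rewrite set_itvoc0 integral_set0 big_geq.
rewrite leq_eqVlt => /predU1P[->|]; first by rewrite set_itvoc0 integral_set0 big_geq.
rewrite ltnS => pq gc.
have -> : `]x p, x q.+1]%classic = `]x p, x q] `|` `]x q, x q.+1].
  rewrite -itv_bndbnd_setU//; rewrite bnd_simp; exact: ndx.
rewrite ge0_integral_setU//=.
- rewrite IH; last by move=> l s /andP[pl lq]; apply: gc; rewrite pl ltnS (ltnW lq).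
    rewrite big_nat_recr//= EFinD; congr (_ + _)%E.
    rewrite (eq_integral (cst (g (x q.+1))%:E)).
      rewrite integral_cst//= lebesgue_measure_itv/= lte_fin.
      case: ltP => [_|]; first by rewrite -EFinB -EFinM.
      move=> h; have -> : x q.+1 = x q by apply/le_anti; rewrite h ndx.
      by rewrite subrr mulr0 mule0.
    move=> s /set_mem; rewrite /= in_itv/= => /andP[qs sq].
    by rewrite (gc q)// pq ltnS leqnn.
  exact: pq.
- by apply/measurable_EFinP; exact: measurable_funTS.
- by move=> s _; rewrite lee_fin.
- apply/disj_setPS => s /=; rewrite !in_itv/= => -[/andP[_ h1] /andP[h2 _]].
  by move: h2; rewrite ltNge h1.
Qed.

End refinement.

(** * Integrals of step functions *)
Section frobenius.
Context (R : realType).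

Lemma frobenius_sqE m n (M : 'M[R]_(m, n)) :
  frobenius_norm M ^+ 2 = \sum_i \sum_j M i j ^+ 2.
Proof.
by rewrite sqr_sqrtr// sumr_ge0// => i _; rewrite sumr_ge0// => j _; rewrite sqr_ge0.
Qed.

Lemma sqnorm_row_le m n (M : 'M[R]_(m, n)) i : sqnorm (row i M) <= frobenius_norm M ^+ 2.
Proof.
rewrite frobenius_sqE (bigD1 i)//= /sqnorm.
rewrite (eq_bigr (fun j => M i j ^+ 2)) => [|j _]; last by rewrite mxE.
rewrite lerDl sumr_ge0// => k _; rewrite sumr_ge0// => j _; exact: sqr_ge0.
Qed.

Lemma entry_sq_le m n (M : 'M[R]_(m, n)) i j : M i j ^+ 2 <= frobenius_norm M ^+ 2.
Proof.
apply: le_trans (sqnorm_row_le M i); rewrite /sqnorm (bigD1 j)//= mxE lerDl.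
by rewrite sumr_ge0// => k _; exact: sqr_ge0.
Qed.

Lemma frobenius_sqB_le m n (M N K : 'M[R]_(m, n)) :
  frobenius_norm (M - N) ^+ 2 <=
  2 * frobenius_norm (K - M) ^+ 2 + 2 * frobenius_norm (K - N) ^+ 2.
Proof.
rewrite !frobenius_sqE !mulr_sumr -big_split/=; apply: ler_sum => i _.
rewrite !mulr_sumr -big_split/=; apply: ler_sum => j _; rewrite !mxE.
have := sqr_ge0 ((K i j - M i j) + (K i j - N i j)); nra.
Qed.

Lemma frobenius_sqN m n (M : 'M[R]_(m, n)) :
  frobenius_norm (- M) ^+ 2 = frobenius_norm M ^+ 2.
Proof.
rewrite !frobenius_sqE; apply: eq_bigr => i _; apply: eq_bigr => j _.
by rewrite mxE sqrrN.
Qed.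

Lemma measurable_frobenius_sq dsp (T : measurableType dsp) (D : set T) m n
    (f : T -> 'M[R]_(m, n)) :
  (forall i j, measurable_fun D (fun s => f s i j)) ->
  measurable_fun D (fun s => frobenius_norm (f s) ^+ 2).
Proof.
move=> mf; under eq_fun do rewrite frobenius_sqE.
by apply: measurable_sum => i; apply: measurable_sum => j; exact: measurable_funX.
Qed.

Lemma measurable_step_eval d r (phi : step_function R d r) i j :
  measurable_fun setT (fun s => step_eval phi s i j).
Proof.
rewrite /step_eval; under eq_fun do rewrite summxE.
apply: measurable_sum => k; under eq_fun do rewrite mxE.
apply: measurable_funM => //; exact: measurable_indic.
Qed.

End frobenius.

Section step_integrals.
Context disp (T : measurableType disp) (R : realType) (P : probability T R).
Variables (F : R -> set (set T)) (d r : nat) (B : R -> T -> 'cV[R]_r).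
Hypotheses (hF : filtration F) (hB : brownian_motion P F B).

(** Rewriting over a subdivision that contains all the nodes: the step function
    takes one value on each ]x l, x l.+1], read off at the right end. *)
Lemma step_integral_refine (phi : step_function R d r) (x : nat -> R) M w :
  nondecreasing_seq x ->
  (forall k, (k < steps phi)%N -> node phi k <= node phi k.+1) ->
  (forall k, (k <= steps phi)%N -> exists2 p, (p <= M)%N & node phi k = x p) ->
  step_integral B phi w =
  \sum_(l < M) step_eval phi (x l.+1) *m (B (x l.+1) w - B (x l) w).
Proof.
move=> ndx mono nodesx.
transitivity (\sum_(k < steps phi) \sum_(l < M)
    (\1_(`]node phi k, node phi k.+1]) (x l.+1) *: coef phi k) *m
    (B (x l.+1) w - B (x l) w)).
  apply: eq_bigr => k _.
  have [p pM kp] := nodesx k (ltnW (ltn_ord k)).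
  have [q qM kq] := nodesx k.+1 (ltn_ord k).
  have [p' [p'M kp' p'q]] : exists p', [/\ (p' <= M)%N, node phi k = x p' & (p' <= q)%N].
    have [pq|qp] := leqP p q; first by exists p.
    exists q; split => //; apply/le_anti; rewrite -kq mono//=.
    by rewrite kp kq; apply: ndx; exact: ltnW.
  rewrite kp' kq (increment_refine ndx (fun y => B y w) p'q qM) mulmx_sumr.
  by apply: eq_bigr => l _; rewrite -scalemxAr scalemxAl.
rewrite exchange_big/=; apply: eq_bigr => l _.
by rewrite -mulmx_suml.
Qed.

Lemma step_integral_row (phi : step_function R d r) (x : nat -> R) M w i :
  nondecreasing_seq x ->
  (forall k, (k < steps phi)%N -> node phi k <= node phi k.+1) ->
  (forall k, (k <= steps phi)%N -> exists2 p, (p <= M)%N & node phi k = x p) ->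
  step_integral B phi w i 0 =
  wiener_sum B x (fun l => row i (step_eval phi (x l.+1))) 0 M w.
Proof.
move=> ndx mono nodesx; rewrite (step_integral_refine w ndx mono nodesx).
rewrite summxE /wiener_sum big_mkord; apply: eq_bigr => l _.
by rewrite -row_mul [RHS]mxE.
Qed.

Lemma step_eval_refine (phi : step_function R d r) (x : nat -> R) M l s :
  nondecreasing_seq x ->
  (forall k, (k <= steps phi)%N -> exists2 p, (p <= M)%N & node phi k = x p) ->
  x l < s -> s <= x l.+1 -> step_eval phi s = step_eval phi (x l.+1).
Proof.
move=> ndx nodesx ls sl; apply: eq_bigr => k _; congr (_ *: _).
have [p _ ->] := nodesx k (ltnW (ltn_ord k)).
have [q _ ->] := nodesx k.+1 (ltn_ord k).
exact: indic_refine.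
Qed.

End step_integrals.

Section step_tails.
Context disp (T : measurableType disp) (R : realType) (P : probability T R).
Variables (F : R -> set (set T)) (d r : nat) (B : R -> T -> 'cV[R]_r).
Hypotheses (hF : filtration F) (hB : brownian_motion P F B).

Lemma measurable_gt (X : T -> R) (a : R) : measurable_fun setT X ->
  measurable [set w | a < X w].
Proof.
move=> mX; rewrite (_ : [set w | _] = X @^-1` `]a, +oo[).
  by rewrite -[X in measurable X]setTI; apply: mX => //; exact: measurable_itv.
by apply/seteqP; split=> w /=; rewrite in_itv/= andbT.
Qed.

(** The two signs are treated by applying the one-sided bound to c and - c. *)
Lemma wiener_sum_max_abs (x : nat -> R) (c : nat -> 'rV[R]_r) (lam eps : R) p q :
  0 <= x 0 -> nondecreasing_seq x -> (p <= q)%N -> 0 <= lam -> 0 <= eps ->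
  (P [set w | exists2 k, (p <= k <= q)%N & (eps < `|wiener_sum B x c p k w|)%R] <=
   (2 * expR (- (lam * eps) + lam ^+ 2 * wiener_var x c p q / 2))%:E)%E.
Proof.
move=> x0 ndx pq lam0 eps0; pose c' k := - c k.
have S' k w : wiener_sum B x c' p k w = - wiener_sum B x c p k w.
  by rewrite /wiener_sum -sumrN; apply: eq_bigr => l _; rewrite mulNmx mxE.
have v' : wiener_var x c' p q = wiener_var x c p q.
  rewrite /wiener_var; apply: eq_bigr => l _; congr (_ * _); apply: eq_bigr => j _.
  by rewrite mxE sqrrN.
pose U c := [set w | exists2 k, (p <= k <= q)%N & eps < wiener_sum B x c p k w].
have mU c0 : measurable (U c0).
  rewrite (_ : U c0 = \bigcup_(j in [set j | (p <= j <= q)%N]) [set w | eps < wiener_sum B x c0 p j w]).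
    apply: bigcup_measurable => j /= /andP[pj _]; apply: measurable_gt.
    exact: (measurable_wiener_sum hF hB).
  by apply/seteqP; split=> w [j]; exists j.
apply: (@le_trans _ _ (P (U c `|` U c'))).
  apply: le_measure; rewrite ?inE; last 2 first.
  - exact: measurableU.
  - move=> w [k pk]; rewrite ltr_normr => /orP[h|h]; [left|right]; exists k => //.
    by rewrite S'.
  rewrite (_ : [set w | _] = \bigcup_(j in [set j | (p <= j <= q)%N]) [set w | eps < `|wiener_sum B x c p j w|]).
    apply: bigcup_measurable => j /= /andP[pj _]; apply: measurable_gt.
    by apply: measurableT_comp => //; exact: (measurable_wiener_sum hF hB).
  by apply/seteqP; split=> w [j]; exists j.
apply: le_trans (measureU2 _ (mU c) (mU c')) _.
rewrite mulr2n mulrDl mul1r EFinD leeD//.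
- exact: (wiener_sum_maximal hF hB).
- by rewrite -v'; exact: (wiener_sum_maximal hF hB).
Qed.

Lemma step_integral_measurable (phi : step_function R d r) t i :
  nodes_in t phi -> measurable_fun setT (fun w => step_integral B phi w i 0).
Proof.
move=> [n0 mono _]; rewrite /step_integral; under eq_fun do rewrite summxE.
have nge k : (k <= steps phi)%N -> 0 <= node phi k.
  elim: k => // k IH kn; apply: le_trans (IH (ltnW kn)) _; exact: mono.
apply: measurable_sum => k; under eq_fun do rewrite mxE.
apply: measurable_sum => j; apply: measurable_funM => //.
under eq_fun do rewrite !mxE.
apply: measurable_funB; [apply: (sub_measurable_measurable hF (nge k.+1 _))|
  apply: (sub_measurable_measurable hF (nge k _))]; try exact: ltnW;
  try exact: ltn_ord; apply: (sub_measurable_brownian hB); apply: nge => //; exact: ltnW.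
Qed.

(** Over the common refinement of both subdivisions the difference is a single
    Wiener sum, whose variance is at most the squared L^2 distance of the two
    step functions.  This tail estimate plays the part of the Ito isometry. *)
Lemma step_integral_tail (phi psi : step_function R d r) t i (lam eps V : R) :
  nodes_in t phi -> nodes_in t psi -> 0 <= lam -> 0 <= eps ->
  (\int[lebesgue_measure]_(s in `[0%R, t])
    (frobenius_norm (step_eval phi s - step_eval psi s)%R ^+ 2)%:E <= V%:E)%E ->
  (P [set w | (eps < `|step_integral B phi w i ord0 - step_integral B psi w i ord0|)%R]
   <= (2 * expR (- (lam * eps) + lam ^+ 2 * V / 2))%:E)%E.
Proof.
move=> [n0 nm nt] [m0 mm mt] lam0 eps0 HV.
pose nodes (p : step_function R d r) := [seq node p k | k <- iota 0 (steps p).+1].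
pose L := sort <=%R (nodes phi ++ nodes psi).
have sL : sorted <=%R L by apply: sort_sorted; exact: le_total.
have L0 : (0 < size L)%N by rewrite size_sort size_cat size_map size_iota.
(* The common refinement: all nodes in increasing order, constant from M on. *)
pose M := (size L).-1.
pose x l := nth 0 L (minn l M).
have ndx : nondecreasing_seq x.
  move=> a b ab; apply: (sorted_leq_nth le_trans le_refl) => //.
  - by rewrite inE (leq_ltn_trans (geq_minr _ _))// /M prednK.
  - by rewrite inE (leq_ltn_trans (geq_minr _ _))// /M prednK.
  - by rewrite leq_min geq_minr andbT (leq_trans (geq_minl _ _)).
have mono_t (p : step_function R d r) k : (forall k, (k < steps p)%N -> node p k <= node p k.+1) ->
    (k <= steps p)%N -> node p 0 <= node p k <= node p (steps p).
  move=> mono kp; apply/andP; split.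
    by elim: k kp => // k IH kp; apply: le_trans (IH (ltnW kp)) (mono _ kp).
  move: kp; move: {2}(steps p - k)%N (erefl (steps p - k)%N) => n.
  elim: n k => [|n IH] k nk kp.
    by have -> : k = steps p by apply/eqP; rewrite eqn_leq kp -subn_eq0 nk.
  have kp' : (k < steps p)%N by rewrite -subn_gt0 nk.
  by apply: le_trans (mono _ kp') (IH _ _ kp'); rewrite subnS nk.
have Lin z : z \in L -> 0 <= z <= t.
  rewrite mem_sort mem_cat => /orP[] /mapP[k]; rewrite mem_iota add0n ltnS /= => kn ->.
    by have /andP[h1 h2] := mono_t phi k nm kn; rewrite (le_trans n0)// (le_trans h2).
  by have /andP[h1 h2] := mono_t psi k mm kn; rewrite (le_trans m0)// (le_trans h2).
have xL l : x l \in L by apply: mem_nth; rewrite (leq_ltn_trans (geq_minr _ _))// /M prednK.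
have x0 : 0 <= x 0 by case/andP: (Lin _ (xL 0%N)).
have inx z : z \in L -> exists2 p, (p <= M)%N & z = x p.
  move=> zL; exists (index z L); first by rewrite /M -ltnS prednK// index_mem.
  rewrite /x; have -> : minn (index z L) M = index z L.
    by apply/minn_idPl; rewrite /M -ltnS prednK// index_mem.
  by rewrite nth_index.
have hphi k : (k <= steps phi)%N -> exists2 p, (p <= M)%N & node phi k = x p.
  move=> kn; apply: inx; rewrite mem_sort mem_cat; apply/orP; left.
  by apply: map_f; rewrite mem_iota.
have hpsi k : (k <= steps psi)%N -> exists2 p, (p <= M)%N & node psi k = x p.
  move=> kn; apply: inx; rewrite mem_sort mem_cat; apply/orP; right.
  by apply: map_f; rewrite mem_iota.
pose D s := step_eval phi s - step_eval psi s.
pose c l := row i (D (x l.+1)).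
have SE w : step_integral B phi w i ord0 - step_integral B psi w i ord0 =
    wiener_sum B x c 0 M w.
  rewrite (step_integral_row B w i ndx nm hphi) (step_integral_row B w i ndx mm hpsi).
  rewrite /wiener_sum -sumrB; apply: eq_bigr => l _.
  have -> : c l = row i (step_eval phi (x l.+1)) - row i (step_eval psi (x l.+1)).
    by apply/rowP => j; rewrite !mxE.
  by rewrite mulmxBl [RHS]mxE; congr (_ + _); rewrite [RHS]mxE.
have vV : wiener_var x c 0 M <= V.
  rewrite -lee_fin; apply: le_trans HV.
  have mD : measurable_fun setT (fun s => frobenius_norm (D s) ^+ 2).
    apply: measurable_frobenius_sq => a b; rewrite /D; under eq_fun do rewrite !mxE.
    by apply: measurable_funB; exact: measurable_step_eval.
  apply: (@le_trans _ _ (\int[lebesgue_measure]_(s in `]x 0%N, x M])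
     (frobenius_norm (D s) ^+ 2)%:E)%E).
    rewrite (integral_piecewise ndx (g := fun s => frobenius_norm (D s) ^+ 2))//.
    + rewrite lee_fin; apply: ler_sum => l _; rewrite ler_wpM2r ?subr_ge0 ?ndx//.
      exact: sqnorm_row_le.
    + by move=> s; exact: sqr_ge0.
    + move=> l s _ ls sl; rewrite /D.
      by rewrite (step_eval_refine ndx hphi ls sl) (step_eval_refine ndx hpsi ls sl).
  apply: ge0_subset_integral => //.
  - by apply/measurable_EFinP; exact: measurable_funTS.
  - by move=> s _; rewrite lee_fin sqr_ge0.
  - move=> s /=; rewrite !in_itv/= => /andP[h1 h2].
    rewrite (le_trans x0 (ltW h1)) (le_trans h2)//.
    by case/andP: (Lin _ (xL M)).
apply: (@le_trans _ _ (2 * expR (- (lam * eps) + lam ^+ 2 * wiener_var x c 0 M / 2))%:E).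
  apply: le_trans (wiener_sum_max_abs c x0 ndx (leq0n M) lam0 eps0).
  apply: le_measure; rewrite ?inE.
  - by under eq_set do rewrite SE; apply: measurable_gt;
      apply: measurableT_comp => //; exact: (measurable_wiener_sum hF hB).
  - rewrite (_ : [set w | _] = \bigcup_(j in [set j | (j <= M)%N]) [set w | eps < `|wiener_sum B x c 0 j w|]).
      apply: bigcup_measurable => j _; apply: measurable_gt.
      by apply: measurableT_comp => //; exact: (measurable_wiener_sum hF hB).
    by apply/seteqP; split=> w [j]; exists j.
  - by move=> w /=; rewrite SE => h; exists M => //; rewrite leqnn.
rewrite lee_fin ler_pM2l// ler_expR lerD2l ler_pM2r// ler_wpM2l//.
exact: sqr_ge0.
Qed.

End step_tails.

(** * Discretization of the integrand on dyadic grids *)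
Section halfline.
Context (R : realType).

(** Freezing a function at its value in 0 for negative arguments turns
    continuity on the half-line into continuity on the whole line. *)
Lemma halfline_extension_continuous (V : topologicalType) (f : R -> V) :
  {within `[0, +oo[, continuous f} -> continuous (fun s : R => f (Num.max s 0)).
Proof.
move=> /subspace_continuousP cf s.
have ms : `[0, +oo[%classic (Num.max s 0) by rewrite /= in_itv/= andbT le_max lexx orbT.
have cm : (fun s : R => Num.max s 0) @ s --> (Num.max s 0 : R).
  exact: (@continuous_max R R idfun (fun=> 0) s (@cvg_id _ _) (@cvg_cst _ _ _ _ _)).
move=> U HU; have H : nbhs s _ := cm _ (cf _ ms _ HU).
apply: (@filterS _ (nbhs s) _ _ _ _ H) => u /=; apply.
by rewrite /= in_itv/= andbT le_max lexx orbT.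
Qed.

Lemma continuous_bounded_on (f : R -> R) (t : R) : continuous f -> 0 <= t ->
  exists2 K, 0 <= K & forall s, 0 <= s <= t -> `|f s| <= K.
Proof.
move=> cf t0.
have cn : {within `[0, t], continuous (fun s => `|f s|)}.
  apply: continuous_subspaceT => s; apply: cvg_norm; exact: cf.
have [c _ hc] := EVT_max t0 cn.
by exists `|f c| => // s st; apply: hc; rewrite in_itv.
Qed.

Lemma bounded_dominated_cvg (f_ : nat -> R -> R) (f : R -> R) (a b K : R) :
  (forall n, measurable_fun setT (f_ n)) -> measurable_fun setT f ->
  (forall s, a < s <= b -> f_ n s @[n --> \oo] --> f s) ->
  (forall n s, a < s <= b -> `|f_ n s| <= K) ->
  ((\int[lebesgue_measure]_(s in `]a, b]) (f_ n s)%:E)%E @[n --> \oo] -->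
   (\int[lebesgue_measure]_(s in `]a, b]) (f s)%:E)%E).
Proof.
move=> mf_ mf cvgf bf.
have [] := @dominated_convergence _ _ R lebesgue_measure `]a, b]%classic
  (measurable_itv _) (fun n s => (f_ n s)%:E) (fun s => (f s)%:E) (cst K%:E).
- by move=> n; apply/measurable_EFinP; exact: measurable_funTS (mf_ n).
- by apply/measurable_EFinP; exact: measurable_funTS mf.
- apply: aeW => s /=; rewrite in_itv/= => abs.
  apply/cvg_EFin; first exact: nearW.
  exact: cvgf.
- apply: (@measurable_bounded_integrable _ _ R lebesgue_measure (cst K)) => //.
  + by rewrite /= lebesgue_measure_itv/=; case: ifP => // _; rewrite -EFinB ltry.
  + by exists `|K|; split; [exact: normr_real|move=> M /ltW KM s _].
- by apply: aeW => s n /=; rewrite in_itv/= => abs; rewrite lee_fin; exact: bf.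
by move=> _ _; exact.
Qed.

End halfline.

Lemma cvg_sumr (R : realType) (T : Type) (F : set_system T) (FF : Filter F)
    (I : Type) (s : seq I) (Q : pred I) (f : I -> T -> R) (a : I -> R) :
  (forall i, Q i -> f i x @[x --> F] --> a i) ->
  \sum_(i <- s | Q i) f i x @[x --> F] --> \sum_(i <- s | Q i) a i.
Proof. by move=> h; apply: cvg_big => //; exact: add_continuous. Qed.

Lemma cvg_sqr (R : realType) (T : Type) (F : set_system T) (FF : Filter F)
    (f : T -> R) (a : R) :
  f x @[x --> F] --> a -> f x ^+ 2 @[x --> F] --> a ^+ 2.
Proof. by move=> h; rewrite expr2; under eq_fun do rewrite expr2; exact: cvgM. Qed.

Section dyadic_grid.
Context (R : realType) (h : R).
Hypothesis h0 : 0 < h.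

Definition grid (j k : nat) : R := k%:R * (h / 2 ^+ j).

Lemma mesh_gt0 j : 0 < h / 2 ^+ j.
Proof. by rewrite divr_gt0// exprn_gt0. Qed.

Lemma grid_nd j : nondecreasing_seq (grid j).
Proof. by move=> a b ab; rewrite ler_pM2r ?mesh_gt0// ler_nat. Qed.

Lemma grid0 j : grid j 0 = 0. Proof. by rewrite /grid mul0r. Qed.

Lemma grid_ge0 j k : 0 <= grid j k.
Proof. by rewrite mulr_ge0// ltW// mesh_gt0. Qed.

Lemma gridS j k : grid j k.+1 = grid j k + h / 2 ^+ j.
Proof. by rewrite /grid -natr1 mulrDl mul1r. Qed.

Lemma grid_lt j k k' : (grid j k < grid j k') = (k < k')%N.
Proof. by rewrite ltr_pM2r ?mesh_gt0// ltr_nat. Qed.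

Lemma grid_le j k k' : (grid j k <= grid j k') = (k <= k')%N.
Proof. by rewrite ler_pM2r ?mesh_gt0// ler_nat. Qed.

Lemma grid_refine m a l : grid (m + a) (l * 2 ^ a) = grid m l.
Proof. by rewrite /grid natrM natrX exprD; field; rewrite !expf_neq0. Qed.

Lemma grid_locate j L s : 0 < s -> s <= grid j L ->
  exists2 k, (k < L)%N & grid j k < s <= grid j k.+1.
Proof.
move=> s0; elim: L => [|L IH].
  by rewrite grid0 leNgt s0.
move=> sL; have [/IH[k kL hk]|Ls] := leP s (grid j L); last by exists L => //; rewrite Ls.
by exists k => //; exact: leqW.
Qed.

Lemma mesh_cvg0 m : h / 2 ^+ (m + a) @[a --> \oo] --> (0 : R).
Proof.
have -> : (fun a => h / 2 ^+ (m + a)) = (fun a => (h / 2 ^+ m) * 2^-1 ^+ a).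
  by apply/funext => a; rewrite exprD invfM mulrA exprVn.
suff : (fun a => h / 2 ^+ m * 2^-1 ^+ a) @ \oo --> h / 2 ^+ m * 0 by rewrite mulr0.
apply: cvgM; first exact: cvg_cst.
by apply: cvg_expr; rewrite ger0_norm// invf_lt1// ltr1n.
Qed.

Context (d r : nat) (sigma : R -> 'M[R]_(d, r)).

Definition grid_step (j L : nat) : step_function R d r :=
  StepFunction L (grid j) (fun k => sigma (grid j k)).

Lemma grid_step_eval j L k s : (k < L)%N -> grid j k < s <= grid j k.+1 ->
  step_eval (grid_step j L) s = sigma (grid j k).
Proof.
move=> kL /andP[ks sk]; rewrite /step_eval (bigD1 (Ordinal kL))//=.
rewrite indicE mem_set /= ?in_itv/= ?ks// scale1r big1 ?addr0// => l lk.
rewrite indicE memNset ?scale0r//= in_itv/= => /andP[ls sl].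
move: lk; rewrite -val_eqE/= neq_ltn => /orP[lk|kl].
  by move: (lt_le_trans ks sl); rewrite grid_lt ltnS leqNgt lk.
by move: (lt_le_trans ls sk); rewrite grid_lt ltnS leqNgt kl.
Qed.

Hypothesis hsigma : {within `[0, +oo[, continuous sigma}.

Let sg (s : R) := sigma (Num.max s 0).

Let sg_cont i j : continuous (fun s : R => sg s i j).
Proof.
move=> s; apply: (@continuous_comp R _ R sg (fun M => M i j)).
  exact: (halfline_extension_continuous hsigma).
exact: coord_continuous.
Qed.

Let sgE s : 0 <= s -> sg s = sigma s.
Proof. by move=> s0; rewrite /sg max_l. Qed.

(** At s the step function takes the value of sigma at a grid point lying at
    most one mesh to the left of s. *)
Lemma grid_step_cvg m l s i j : 0 < s -> s <= grid m l ->
  step_eval (grid_step (m + a) (l * 2 ^ a)) s i j @[a --> \oo] --> sigma s i j.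
Proof.
move=> s0 sl.
have /choice[y hy] : forall a, exists y : R, [/\ 0 <= y, y < s, s <= y + h / 2 ^+ (m + a)
    & step_eval (grid_step (m + a) (l * 2 ^ a)) s = sigma y].
  move=> a; have [k kL hk] : exists2 k, (k < l * 2 ^ a)%N &
      grid (m + a) k < s <= grid (m + a) k.+1.
    by apply: grid_locate => //; rewrite grid_refine.
  exists (grid (m + a) k); split.
  - exact: grid_ge0.
  - by case/andP: hk.
  - by rewrite -gridS; case/andP: hk.
  - exact: grid_step_eval.
have ys : y a @[a --> \oo] --> s.
  apply: (@squeeze_cvgr _ _ _ _ (fun a => s - h / 2 ^+ (m + a)) (fun=> s)).
  - apply: nearW => a; have [_ h1 h2 _] := hy a.
    by rewrite lerBlDr h2 ltW.
  - rewrite -[X in _ --> X](subr0 s); apply: cvgB; [exact: cvg_cst|exact: mesh_cvg0].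
  - exact: cvg_cst.
have -> : (fun a => step_eval (grid_step (m + a) (l * 2 ^ a)) s i j) =
    (fun a => sg (y a) i j).
  by apply/funext => a; have [h1 _ _ ->] := hy a; rewrite sgE.
rewrite -(sgE (ltW s0)).
exact: (cvg_comp y (fun s => sg s i j) ys (@sg_cont i j s)).
Qed.

Lemma frobenius_halfline_continuous :
  continuous (fun s : R => frobenius_norm (sigma (Num.max s 0)) ^+ 2).
Proof.
under eq_fun do rewrite frobenius_sqE.
move=> s; apply: cvg_sumr => i _; apply: cvg_sumr => j _.
by apply: cvg_sqr; exact: sg_cont.
Qed.

Lemma grid_step_bound m l : exists K, forall a s, 0 < s <= grid m l ->
  frobenius_norm (sigma s) ^+ 2 <= K /\
  frobenius_norm (step_eval (grid_step (m + a) (l * 2 ^ a)) s) ^+ 2 <= K.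
Proof.
have [K K0 hK] := continuous_bounded_on frobenius_halfline_continuous (grid_ge0 m l).
exists K => a s /andP[s0 sl]; split.
  rewrite -sgE; last exact: ltW.
  by apply: le_trans (ler_norm _) (hK _ _); rewrite sl ltW.
have [k kL hk] : exists2 k, (k < l * 2 ^ a)%N &
      grid (m + a) k < s <= grid (m + a) k.+1.
  by apply: grid_locate => //; rewrite grid_refine.
rewrite (grid_step_eval kL hk) -sgE ?grid_ge0//.
apply: le_trans (ler_norm _) (hK _ _); rewrite grid_ge0/=.
by case/andP: hk => /ltW h1 _; exact: le_trans h1 sl.
Qed.

Lemma measurable_halfline i j : measurable_fun (`[0, +oo[%classic : set R) (fun s : R => sigma s i j).
Proof.
apply: (eq_measurable_fun (fun s : R => sg s i j)).
  by move=> s; rewrite inE/= in_itv/= andbT => /sgE ->.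
apply: measurable_funTS; exact: continuous_measurable_fun.
Qed.

Let msg i j : measurable_fun setT (fun s : R => sg s i j).
Proof. exact: continuous_measurable_fun. Qed.

Lemma grid_step_L2 m l :
  ((\int[lebesgue_measure]_(s in `[0%R, grid m l])
     (frobenius_norm (sigma s - step_eval (grid_step (m + a) (l * 2 ^ a)) s)%R ^+ 2)%:E)
     @[a --> \oo] --> 0)%E.
Proof.
have [K hK] := grid_step_bound m l.
pose f_ a s := frobenius_norm (sg s - step_eval (grid_step (m + a) (l * 2 ^ a)) s) ^+ 2.
have mf a : measurable_fun setT (f_ a).
  apply: measurable_frobenius_sq => i j; under eq_fun do rewrite !mxE.
  by apply: measurable_funB => //; exact: measurable_step_eval.
have := @bounded_dominated_cvg R f_ (fun=> 0) 0 (grid m l) (4 * K) mf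
  (measurable_cst _) _ _.
rewrite (_ : \int[lebesgue_measure]_(s in _) 0 = 0)%E; last exact: integral0.
rewrite (_ : (fun n => \int[lebesgue_measure]_(s in _) (f_ n s)%:E)%E =
  (fun a => \int[lebesgue_measure]_(s in `[0%R, grid m l])
     (frobenius_norm (sigma s - step_eval (grid_step (m + a) (l * 2 ^ a)) s)%R ^+ 2)%:E)%E); last first.
  apply/funext => a; rewrite integral_itv_obnd_cbnd.
    by apply: eq_integral => s; rewrite inE/= in_itv/= => /andP[s0 _]; rewrite /f_ sgE.
  by apply/measurable_EFinP; exact: measurable_funTS (mf a).
apply.
- move=> s /andP[s0 sl].
  have -> : (0 : R) = \sum_(i < d) \sum_(j < r) (sigma s i j - sigma s i j) ^+ 2.
    by rewrite big1// => i _; rewrite big1// => j _; rewrite subrr expr0n.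
  rewrite /f_; under eq_fun do rewrite frobenius_sqE.
  apply: cvg_sumr => i _; apply: cvg_sumr => j _; apply: cvg_sqr.
  under eq_fun do rewrite !mxE.
  apply: cvgB; first by rewrite sgE ?ltW//; exact: cvg_cst.
  exact: grid_step_cvg.
- move=> a s /andP[s0 sl]; rewrite ger0_norm ?sqr_ge0// /f_ sgE ?(ltW s0)//.
  have [|h1 h2] := hK a s; first by rewrite s0.
  apply: le_trans (frobenius_sqB_le _ _ 0) _.
  rewrite !sub0r !frobenius_sqN; lra.
Qed.

(** The variance of the i-th row of the grid sum is the integral over the same
    interval of the squared i-th row of the step function, and dominated
    convergence applies. *)
Lemma grid_var_cvg m p q i : (p <= q)%N ->
  ((wiener_var (grid (m + a)) (fun k => row i (sigma (grid (m + a) k)))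
     (p * 2 ^ a) (q * 2 ^ a))%:E @[a --> \oo] -->
   \int[lebesgue_measure]_(s in `]grid m p, grid m q]) (sqnorm (row i (sigma s)))%:E)%E.
Proof.
move=> pq.
have [K hK] := grid_step_bound m q.
pose f_ a s := sqnorm (row i (step_eval (grid_step (m + a) (q * 2 ^ a)) s)).
have mf a : measurable_fun setT (f_ a).
  rewrite /f_ /sqnorm; apply: measurable_sum => j; apply: measurable_funX.
  by under eq_fun do rewrite mxE; exact: measurable_step_eval.
have msq : measurable_fun setT (fun s => sqnorm (row i (sg s))).
  rewrite /sqnorm; apply: measurable_sum => j; apply: measurable_funX.
  by under eq_fun do rewrite mxE; exact: msg.
have pos s : grid m p < s -> 0 < s by apply: le_lt_trans; exact: grid_ge0.
have := @bounded_dominated_cvg R f_ _ (grid m p) (grid m q) K mf msq _ _.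
rewrite (_ : \int[lebesgue_measure]_(s in _) (sqnorm (row i (sg s)))%:E =
  \int[lebesgue_measure]_(s in `]grid m p, grid m q]) (sqnorm (row i (sigma s)))%:E)%E; last first.
  apply: eq_integral => s; rewrite inE/= in_itv/= => /andP[/pos/ltW s0 _].
  by rewrite sgE.
rewrite (_ : (fun n => \int[lebesgue_measure]_(s in _) (f_ n s)%:E)%E =
  (fun a => (wiener_var (grid (m + a)) (fun k => row i (sigma (grid (m + a) k)))
     (p * 2 ^ a) (q * 2 ^ a))%:E)); last first.
  apply/funext => a.
  have ev k s : (k < q * 2 ^ a)%N -> grid (m + a) k < s -> s <= grid (m + a) k.+1 ->
      f_ a s = sqnorm (row i (sigma (grid (m + a) k))).
    by move=> kq ks sk; rewrite /f_ (grid_step_eval kq)// ks.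
  rewrite -(grid_refine m a p) -(grid_refine m a q).
  rewrite (integral_piecewise (@grid_nd (m + a)) (g := f_ a))//.
  - congr EFin; rewrite /wiener_var; apply: eq_big_nat => k /andP[_ kq].
    by rewrite (ev k)// grid_lt.
  - by rewrite leq_mul2r pq orbT.
  - by move=> s; exact: sqnorm_ge0.
  - by move=> k s /andP[_ kq] ks sk; rewrite (ev k)// (ev k)// grid_lt.
apply.
- move=> s /andP[ps sq]; have s0 := pos _ ps; rewrite /f_ /sqnorm.
  apply: cvg_sumr => j _; apply: cvg_sqr; rewrite mxE; under eq_fun do rewrite mxE.
  rewrite sgE; last exact: ltW.
  exact: grid_step_cvg.
- move=> a s /andP[ps sq]; rewrite ger0_norm ?sqnorm_ge0//.
  apply: le_trans (sqnorm_row_le _ _) _.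
  by have [|] := hK a s; first by rewrite (pos _ ps).
Qed.

End dyadic_grid.

Lemma cvge0_le (R : realType) (u : nat -> \bar R) (e : R) :
  (u n @[n --> \oo] --> 0)%E -> 0 < e ->
  exists N, forall n, (N <= n)%N -> (u n <= e%:E)%E.
Proof.
move=> /fine_cvgP[[N1 _ fu] /cvgr_lt/(_ _)] u0 e0.
have [N2 _ HN] := u0 e e0.
exists (maxn N1 N2) => n; rewrite geq_max => /andP[n1 n2].
rewrite -(fineK (fu n n1)) lee_fin ltW//; exact: HN.
Qed.

(** * The Ito integral as a limit in probability of grid sums *)
Section ito_approximation.
Context disp (T : measurableType disp) (R : realType) (P : probability T R).
Variables (F : R -> set (set T)) (d r : nat) (B : R -> T -> 'cV[R]_r).
Hypotheses (hF : filtration F) (hB : brownian_motion P F B).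
Variables (sigma : R -> 'M[R]_(d, r)).
Hypothesis hsigma : {within `[0, +oo[, continuous sigma}.
Variables (h : R) (h0 : 0 < h).

Definition grid_sum j i p q :=
  wiener_sum B (grid h j) (fun k => row i (sigma (grid h j k))) p q.

Lemma step_integral_grid j L i w :
  step_integral B (grid_step h sigma j L) w i 0 = grid_sum j i 0 L w.
Proof.
rewrite summxE /grid_sum /wiener_sum big_mkord; apply: eq_bigr => l _ /=.
by rewrite -row_mul [RHS]mxE.
Qed.

Lemma grid_step_nodes j L : nodes_in (grid h j L) (grid_step h sigma j L).
Proof.
split => //=; first by rewrite grid0.
by move=> k _; apply: grid_nd.
Qed.

Lemma markov_frobenius (X Y : T -> 'cV[R]_d) i (e : R) : 0 < e ->
  (forall i, measurable_fun setT (fun w => X w i 0)) ->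
  (forall i, measurable_fun setT (fun w => Y w i 0)) ->
  (P [set w | e < `|X w i ord0 - Y w i ord0|]%R <=
   (e ^+ 2)^-1%:E * 'E_P[(fun w => frobenius_norm (X w - Y w) ^+ 2)%R])%E.
Proof.
move=> e0 mX mY.
have mD : measurable_fun setT (fun w => frobenius_norm (X w - Y w) ^+ 2).
  apply: measurable_frobenius_sq => a b; rewrite (ord1 b); under eq_fun do rewrite !mxE.
  by apply: measurable_funB; [exact: mX|exact: mY].
have mA : measurable [set w | e < `|X w i ord0 - Y w i ord0|].
  apply: measurable_gt; apply: measurableT_comp => //.
  by apply: measurable_funB; [exact: mX|exact: mY].
rewrite unlock -ge0_integralZl//; last 3 first.
- exact/measurable_EFinP.
- by move=> w _; rewrite lee_fin sqr_ge0.
- by rewrite lee_fin invr_ge0 sqr_ge0.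
rewrite -[leLHS]mul1e -integral_cst_indic//; apply: ge0_le_integral => //.
- by apply/measurable_EFinP; apply: measurable_funM => //; exact: measurable_indic.
- by apply/measurable_EFinP; exact: measurable_funM.
move=> w _; rewrite -EFinM lee_fin mul1r indicE.
case: (boolP (w \in _)) => [|_]; last by rewrite mulr_ge0 ?invr_ge0 ?sqr_ge0.
rewrite inE/= => ew; rewrite mulrC ler_pdivlMr ?exprn_gt0// mul1r.
have := entry_sq_le (X w - Y w) i 0; rewrite !mxE; apply: le_trans.
by rewrite -[leRHS]real_normK ?num_real// ler_pXn2r ?nnegrE ?(ltW e0)// ltW.
Qed.

(** The definition of the Ito integral provides some approximating step
    functions.  They and the step functions of the grid approach the same
    integrand in L^2, so their integrals are close in probability by
    [step_integral_tail]; Markov's inequality compares X with the former. *)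
Lemma ito_grid_in_probability m l i (X : T -> 'cV[R]_d) (e eta : R) :
  is_ito_integral P B sigma (grid h m l) X -> 0 < e -> 0 < eta ->
  exists A, forall a, (A <= a)%N ->
    (P [set w | e < `|X w i ord0 - grid_sum (m + a) i 0 (l * 2 ^ a) w|]%R <= eta%:E)%E.
Proof.
move=> [mX [phi [nphi Lphi Ephi]]] e0 eta0.
pose e2 := e / 2; have e20 : 0 < e2 by rewrite divr_gt0.
(* lam makes 2 exp (- lam e2 + 2) at most eta / 2, and kap = 1 / lam^2 turns the
   variance term lam^2 (4 kap) / 2 into 2. *)
pose lam := `|2 - ln (eta / 4)| / e2 + 1.
have lam0 : 0 < lam by rewrite ltr_wpDl// divr_ge0 ?(ltW e20).
have lamP : 2 * expR (- (lam * e2) + 2) <= eta / 2.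
  rewrite -ler_pdivlMl// (_ : 2^-1 * (eta / 2) = eta / 4); last by field.
  rewrite -ler_ln ?posrE ?expR_gt0 ?divr_gt0// expRK.
  have : `|2 - ln (eta / 4)| <= lam * e2.
    by rewrite /lam mulrDl mul1r divfK ?gt_eqF// lerDl ltW.
  have := ler_norm (2 - ln (eta / 4)); lra.
pose kap := (lam ^+ 2)^-1; have kap0 : 0 < kap by rewrite invr_gt0 exprn_gt0.
have q0 : 0 < e2 ^+ 2 * (eta / 2) by rewrite mulr_gt0 ?exprn_gt0// divr_gt0.
have [N1 hN1] := cvge0_le Lphi kap0.
have [N2 hN2] := cvge0_le Ephi q0.
have [A hA] := cvge0_le (grid_step_L2 h0 hsigma m l) kap0.
pose n := maxn N1 N2; have {}hN1 := hN1 n (leq_maxl _ _).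
have {}hN2 := hN2 n (leq_maxr _ _).
exists A => a /hA {}hA; pose psi := grid_step h sigma (m + a) (l * 2 ^ a).
have npsi : nodes_in (grid h m l) psi.
  by rewrite -(grid_refine h m a l); exact: grid_step_nodes.
have mphi i' := step_integral_measurable hF hB i' (nphi n).
have mpsi i' := step_integral_measurable hF hB i' npsi.
pose S1 := [set w | e2 < `|X w i ord0 - step_integral B (phi n) w i ord0|].
pose S2 := [set w | e2 < `|step_integral B (phi n) w i ord0 - step_integral B psi w i ord0|].
have mS1 : measurable S1.
  by apply: measurable_gt; apply: measurableT_comp => //; apply: measurable_funB; [exact: mX|exact: mphi].
have mS2 : measurable S2.
  by apply: measurable_gt; apply: measurableT_comp => //; apply: measurable_funB; [exact: mphi|exact: mpsi].
apply: (@le_trans _ _ (P (S1 `|` S2))).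
  apply: le_measure; rewrite ?inE.
  - apply: measurable_gt; apply: measurableT_comp => //.
    apply: measurable_funB; first exact: mX.
    rewrite (_ : grid_sum _ _ _ _ = fun w => step_integral B psi w i 0); first exact: mpsi.
    by apply/funext => w; rewrite step_integral_grid.
  - exact: measurableU.
  - move=> w /= ew; rewrite /S1 /S2 /=; apply/orP; rewrite -[_ || _]negbK negb_or -!leNgt.
    apply/negP => /andP[h1 h2]; move: ew; rewrite ltNge => /negP; apply.
    rewrite -step_integral_grid -/psi.
    rewrite -(subrKA (step_integral B (phi n) w i 0)).
    by apply: le_trans (ler_normD _ _) _; rewrite (splitr e) lerD.
apply: le_trans (measureU2 _ mS1 mS2) _.
rewrite (splitr eta) EFinD leeD//.
  apply: le_trans (markov_frobenius i e20 mX mphi) _.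
  rewrite -lee_pdivlMl ?invr_gt0 ?exprn_gt0// invrK.
  exact: hN2.
have dbl (a1 a2 : \bar R) : (a1 <= kap%:E -> a2 <= kap%:E ->
    2%:E * a1 + 2%:E * a2 <= (4 * kap)%:E)%E.
  move=> ha1 ha2; rewrite (_ : 4 * kap = 2 * kap + 2 * kap); last by ring.
  by rewrite [leRHS]EFinD [(2 * kap)%:E]EFinM; apply: leeD; rewrite lee_pmul2l ?lte_fin.
have VP : (\int[lebesgue_measure]_(s in `[0%R, grid h m l])
    (frobenius_norm (step_eval (phi n) s - step_eval psi s)%R ^+ 2)%:E <= (4 * kap)%:E)%E.
  have msub (p : step_function R d r) : measurable_fun `[0, grid h m l]
      (fun s => frobenius_norm (sigma s - step_eval p s) ^+ 2).
    apply: measurable_frobenius_sq => a' b'.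
    apply: (eq_measurable_fun (fun s => sigma s a' b' - step_eval p s a' b')).
      by move=> s _; rewrite !mxE.
    apply: measurable_funB; last by apply: measurable_funTS; exact: measurable_step_eval.
    apply: measurable_funS (measurable_halfline hsigma a' b') => //.
    by move=> s /=; rewrite !in_itv/= => /andP[->].
  apply: (@le_trans _ _ (\int[lebesgue_measure]_(s in `[0%R, grid h m l])
    ((2 * frobenius_norm (sigma s - step_eval (phi n) s) ^+ 2)%:E +
     (2 * frobenius_norm (sigma s - step_eval psi s) ^+ 2)%:E))%E).
    apply: ge0_le_integral => //.
    - by move=> s _; rewrite lee_fin sqr_ge0.
    - apply/measurable_EFinP; apply: measurable_frobenius_sq => a' b' /=.
      apply: measurable_funTS; under eq_fun do rewrite !mxE.
      by apply: measurable_funB; exact: measurable_step_eval.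
    - by apply: emeasurable_funD; apply/measurable_EFinP; exact: measurable_funM (measurable_cst _) (msub _).
    - by move=> s _; rewrite -EFinD lee_fin; exact: frobenius_sqB_le.
  rewrite ge0_integralD//; last 4 first.
  - by move=> s _; rewrite lee_fin mulr_ge0 ?sqr_ge0.
  - by apply/measurable_EFinP; exact: measurable_funM (measurable_cst _) (msub _).
  - by move=> s _; rewrite lee_fin mulr_ge0 ?sqr_ge0.
  - by apply/measurable_EFinP; exact: measurable_funM (measurable_cst _) (msub _).
  under eq_integral do rewrite EFinM.
  under [X in (_ + X)%E]eq_integral do rewrite EFinM.
  rewrite !ge0_integralZl//; try by move=> s _; rewrite lee_fin sqr_ge0.
  - exact: dbl hN1 hA.
  - by apply/measurable_EFinP; exact: msub.
  - by apply/measurable_EFinP; exact: msub.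
apply: le_trans (step_integral_tail hF hB i (nphi n) npsi (ltW lam0) (ltW e20) VP) _.
rewrite lee_fin (_ : lam ^+ 2 * (4 * kap) / 2 = 2)//.
by rewrite /kap; field; rewrite gt_eqF.
Qed.

End ito_approximation.

(** * Oscillation of the Ito integral within a block *)
Section finite_union.
Context disp (T : measurableType disp) (R : realType) (P : probability T R).
Variables (I : finType) (A : I -> set T).
Hypothesis mA : forall i, measurable (A i).

Lemma measurable_fin_exists : measurable [set w | exists i, A i w].
Proof.
rewrite (_ : [set w | _] = \bigcup_(i in [set: I]) A i).
  by apply: fin_bigcup_measurable => //; exact: finite_finset.
by apply/seteqP; split => w; [move=> [i Ai]; exists i|move=> [i _ Ai]; exists i].
Qed.

Lemma fin_union_bound (e : R) : (forall i, (P (A i) <= e%:E)%E) ->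
  (P [set w | exists i, A i w] <= (#|I|%:R * e)%:E)%E.
Proof.
move=> Ae; rewrite (_ : [set w | _] = \big[setU/set0]_(i <- enum I) A i); last first.
  rewrite -bigcup_seq; apply/seteqP; split => w.
    by move=> [i Ai]; exists i => //=; rewrite mem_enum.
  by move=> [i _ Ai]; exists i.
have : forall s : seq I,
    (P (\big[setU/set0]_(i <- s) A i) <= ((size s)%:R * e)%:E)%E.
  elim => [|i s IH]; first by rewrite big_nil measure0 mul0r.
  rewrite big_cons /= -natr1 mulrDl mul1r addrC EFinD.
  apply: le_trans (measureU2 _ _ _) _ => //.
    by apply: bigsetU_measurable => j _.
  by apply: leeD; [exact: Ae|exact: IH].
by move=> /(_ (enum I)); rewrite -cardE.
Qed.

End finite_union.

Section ito_increments.
Context disp (T : measurableType disp) (R : realType) (P : probability T R).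
Variables (F : R -> set (set T)) (d r : nat) (B : R -> T -> 'cV[R]_r).
Hypotheses (hF : filtration F) (hB : brownian_motion P F B).
Variables (sigma : R -> 'M[R]_(d, r)).
Hypothesis hsigma : {within `[0, +oo[, continuous sigma}.
Variables (h : R) (h0 : 0 < h).
Variable ito : R -> T -> 'cV[R]_d.
Hypothesis hito : forall t, 0 <= t -> is_ito_integral P B sigma t (ito t).

Local Notation S := (grid_sum B sigma h).

Lemma measurable_ito t i : 0 <= t -> measurable_fun setT (fun w => ito t w i 0).
Proof. by move=> /hito[+ _]; exact. Qed.

Lemma measurable_grid_sum j i p q : (p <= q)%N -> measurable_fun setT (S j i p q).
Proof.
move=> pq; apply: (measurable_wiener_sum hF hB) => //; first by rewrite grid0.
exact: grid_nd.
Qed.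

Lemma grid_sumB j i p q w : (p <= q)%N -> S j i 0 q w - S j i 0 p w = S j i p q w.
Proof.
by move=> pq; apply/eqP; rewrite subr_eq addrC; apply/eqP; exact: big_cat_nat.
Qed.

(** All coordinates and all dyadic times of level m up to a horizon are taken
    together, so that a single finer level m + a serves them at once. *)
Definition discretization_error m N (e : R) a : set T :=
  [set w | exists ki : 'I_N * 'I_d,
    e < `|ito (grid h m ki.1) w ki.2 ord0 - S (m + a) ki.2 0 (ki.1 * 2 ^ a) w|].

Let measurable_discretization_error1 m N (e : R) a (ki : 'I_N * 'I_d) : measurable
  [set w | e < `|ito (grid h m ki.1) w ki.2 ord0 - S (m + a) ki.2 0 (ki.1 * 2 ^ a) w|].
Proof.
apply: measurable_gt; apply: measurableT_comp => //; apply: measurable_funB.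
  by apply: measurable_ito; exact: grid_ge0.
exact: measurable_grid_sum.
Qed.

Lemma measurable_discretization_error m N e a : measurable (discretization_error m N e a).
Proof. by apply: measurable_fin_exists => ki; exact: measurable_discretization_error1. Qed.

Lemma discretization_error_small m N (e eta : R) : 0 < e -> 0 < eta ->
  exists A, forall a, (A <= a)%N -> (P (discretization_error m N e a) <= eta%:E)%E.
Proof.
move=> e0 eta0; pose c := #|{: 'I_N * 'I_d}|.
have ec0 : 0 < eta / c.+1%:R by rewrite divr_gt0.
have /choice[A hA] : forall ki : 'I_N * 'I_d, exists A, forall a, (A <= a)%N ->
    (P [set w | e < `|ito (grid h m ki.1) w ki.2 ord0 -
       S (m + a) ki.2 0 (ki.1 * 2 ^ a) w|]%R <= (eta / c.+1%:R)%:E)%E.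
  move=> ki; apply: (ito_grid_in_probability hF hB hsigma h0) => //.
  by apply: hito; exact: grid_ge0.
exists (\max_ki A ki) => a Aa.
apply: (@le_trans _ _ (c%:R * (eta / c.+1%:R))%:E).
  apply: fin_union_bound => ki; first exact: measurable_discretization_error1.
  by apply: hA; apply: leq_trans Aa; exact: (leq_bigmax ki).
rewrite lee_fin mulrCA ger_pMr// ler_pdivrMr// mul1r ler_nat; exact: leqnSn.
Qed.

Lemma grid_block n m : grid h m (n * 2 ^ m) = n%:R * h.
Proof. by have := grid_refine h 0 m n; rewrite add0n => ->; rewrite /grid expr0 divr1. Qed.

Lemma block_intensityE n :
  (\int[lebesgue_measure]_(s in `](n%:R * h)%R, (n.+1%:R * h)%R])
     (frobenius_norm (sigma s) ^+ 2)%:E = (block_intensity sigma h n)%:E)%E.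
Proof.
have nh0 : 0 <= n%:R * h by rewrite mulr_ge0// ltW.
have sub : `[n%:R * h, n.+1%:R * h]%classic `<=` `[0, +oo[%classic.
  by move=> s /=; rewrite !in_itv/= andbT => /andP[/(le_trans nh0)].
have mf : measurable_fun `[n%:R * h, n.+1%:R * h]%classic
    (fun s => frobenius_norm (sigma s) ^+ 2).
  apply: measurable_frobenius_sq => i j.
  exact: measurable_funS (measurable_halfline hsigma i j).
rewrite integral_itv_obnd_cbnd; last first.
  apply/measurable_EFinP; apply: measurable_funS mf => //.
  by move=> s /=; rewrite !in_itv/= => /andP[/ltW -> ->].
rewrite /block_intensity /Rintegral fineK//.
pose f (s : R) := frobenius_norm (sigma (Num.max s 0)) ^+ 2.
have -> : (\int[lebesgue_measure]_(x in `[(n%:R * h)%R, (n.+1%:R * h)%R])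
    (frobenius_norm (sigma x) ^+ 2)%:E =
  \int[lebesgue_measure]_(x in `[(n%:R * h)%R, (n.+1%:R * h)%R])
    (EFin \o f) x)%E.
  apply: eq_integral => s; rewrite inE/= => /sub; rewrite /= in_itv/= andbT => s0.
  by rewrite /f/= max_l.
apply: integrable_fin_num => //.
apply: continuous_compact_integrable; first exact: segment_compact.
by apply: continuous_subspaceT; exact: frobenius_halfline_continuous.
Qed.

Local Notation row_intensity n i := (\int[lebesgue_measure]_(s in
  `](n%:R * h)%R, (n.+1%:R * h)%R]) (sqnorm (row i (sigma s)))%:E)%E.

Local Notation block_var m a n i := (wiener_var (grid h (m + a))
  (fun k => row i (sigma (grid h (m + a) k)))
  (n * 2 ^ m * 2 ^ a) (n.+1 * 2 ^ m * 2 ^ a)).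

Lemma block_var_cvg m n i :
  ((block_var m a n i)%:E @[a --> \oo] --> row_intensity n i)%E.
Proof.
rewrite -(grid_block n m) -(grid_block n.+1 m).
by apply: grid_var_cvg => //; rewrite leq_mul2r leqnSn orbT.
Qed.

Let mblock n i j : measurable_fun `](n%:R * h), (n.+1%:R * h)]
  (fun s => sigma s i j).
Proof.
apply: measurable_funS (measurable_halfline hsigma i j) => //.
move=> s /=; rewrite !in_itv/= andbT => /andP[ns _].
by apply: le_trans (ltW ns); rewrite mulr_ge0// ltW.
Qed.

Lemma row_intensity_sum n :
  (\sum_(i < d) row_intensity n i = (block_intensity sigma h n)%:E)%E.
Proof.
rewrite -ge0_integral_sum//.
- rewrite -block_intensityE; apply: eq_integral => s _.
  rewrite sumEFin frobenius_sqE; congr EFin; apply: eq_bigr => i _.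
  by apply: eq_bigr => j _; rewrite mxE.
- move=> i; apply/measurable_EFinP; rewrite /sqnorm.
  apply: measurable_sum => j; apply: measurable_funX.
  apply: (eq_measurable_fun (fun s => sigma s i j)); last exact: mblock.
  by move=> s _; rewrite mxE.
- by move=> i s _; rewrite lee_fin sqnorm_ge0.
Qed.

Lemma row_intensity_ge0 n i : (0 <= row_intensity n i)%E.
Proof. by apply: integral_ge0 => s _; rewrite lee_fin sqnorm_ge0. Qed.

Lemma row_intensity_le n i : (row_intensity n i <= (block_intensity sigma h n)%:E)%E.
Proof.
rewrite -row_intensity_sum (bigD1 i)//= leeDl// sume_ge0// => j _.
exact: row_intensity_ge0.
Qed.

Lemma row_intensityK n i : (fine (row_intensity n i))%:E = row_intensity n i.
Proof.
rewrite fineK// ge0_fin_numE ?row_intensity_ge0//.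
by apply: le_lt_trans (row_intensity_le n i) _; rewrite ltry.
Qed.

Lemma block_var_le m n i (kap : R) : 0 < kap -> exists A, forall a, (A <= a)%N ->
  block_var m a n i <= block_intensity sigma h n + kap.
Proof.
move=> kap0; have := @block_var_cvg m n i; rewrite -row_intensityK.
move=> /fine_cvgP[_ /cvgr_lt/(_ (block_intensity sigma h n + kap)) H].
have [|A _ hA] := H.
  have := row_intensity_le n i; rewrite -row_intensityK lee_fin => /le_lt_trans; apply.
  by rewrite ltrDl.
by exists A => a /hA /ltW.
Qed.

(** Some row carries at least a fraction 1 / d of the intensity; the factor 2
    leaves room for the convergence of the variances. *)
Lemma block_var_ge m n : 0 < block_intensity sigma h n ->
  exists i, exists A, forall a, (A <= a)%N ->
  block_intensity sigma h n / (2 * d%:R) <= block_var m a n i.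
Proof.
set b := block_intensity sigma h n => b0.
have d0 : (0 < d)%N.
  rewrite lt0n; apply/negP => /eqP d0.
  have := row_intensity_sum n; rewrite big1 => [[] /eqP|i _]; first by rewrite lt_eqF.
  by move: (ltn_ord i); rewrite {2}d0 ltn0.
have dR : 0 < d%:R :> R by rewrite ltr0n.
have [i hi] : exists i, b / d%:R <= fine (row_intensity n i).
  apply/not_existsP => H.
  have : \sum_(i < d) fine (row_intensity n i) < \sum_(i < d) b / d%:R.
    apply: ltr_sum; first by apply/hasP; exists (Ordinal d0) => //; rewrite mem_index_enum.
    by move=> i _; rewrite ltNge; apply/negP; exact: H.
  rewrite sumr_const card_ord -[X in _ < X]mulr_natr divfK ?gt_eqF//.
  apply/negP; rewrite -leNgt -lee_fin -row_intensity_sum -sumEFin.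
  by apply: lee_sum => i _; rewrite row_intensityK.
exists i; have := @block_var_cvg m n i; rewrite -row_intensityK.
move=> /fine_cvgP[_ /cvgr_gt/(_ (b / (2 * d%:R))) H].
have [|A _ hA] := H; last by exists A => a /hA /ltW.
apply: lt_le_trans hi; rewrite ltr_pM2l// ltf_pV2 ?posrE ?mulr_gt0//.
by rewrite ltr_pMl// ltr1n.
Qed.

End ito_increments.

Section ito_block_maximal.
Context disp (T : measurableType disp) (R : realType) (P : probability T R).
Variables (F : R -> set (set T)) (d r : nat) (B : R -> T -> 'cV[R]_r).
Hypotheses (hF : filtration F) (hB : brownian_motion P F B).
Variables (sigma : R -> 'M[R]_(d, r)).
Hypothesis hsigma : {within `[0, +oo[, continuous sigma}.
Variables (h : R) (h0 : 0 < h).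
Variable ito : R -> T -> 'cV[R]_d.
Hypothesis hito : forall t, 0 <= t -> is_ito_integral P B sigma t (ito t).

Local Notation S := (grid_sum B sigma h).

Definition dyadic_excursion n i (e : R) m : set T :=
  [set w | exists2 k, (n * 2 ^ m <= k <= n.+1 * 2 ^ m)%N &
    e < `|ito (grid h m k) w i ord0 - ito (grid h m (n * 2 ^ m)) w i ord0|].

Lemma measurable_dyadic_excursion n i e m : measurable (dyadic_excursion n i e m).
Proof.
rewrite (_ : dyadic_excursion n i e m = \bigcup_(k in [set k | (n * 2 ^ m <= k <= n.+1 * 2 ^ m)%N])
  [set w | e < `|ito (grid h m k) w i ord0 - ito (grid h m (n * 2 ^ m)) w i ord0|]).
  apply: bigcup_measurable => k _; apply: measurable_gt; apply: measurableT_comp => //.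
  by apply: measurable_funB; apply: (measurable_ito hito); exact: grid_ge0.
by apply/seteqP; split=> w [k]; exists k.
Qed.

(** An excursion of the Ito integral comes either from a discretization error
    above e / 4 or from an excursion above e / 2 of the grid sum.  On a fine
    grid the former is less likely than the bound itself, whence the summand 1,
    and the variance of the latter can exceed the intensity only by so little
    that this costs at most the factor exp 1. *)
Lemma dyadic_excursion_le n i (e lam : R) m : 0 < e -> 0 <= lam ->
  (P (dyadic_excursion n i e m) <= ((2 * expR 1 + 1) *
    expR (- (lam * (e / 2)) + lam ^+ 2 * block_intensity sigma h n / 2))%:E)%E.
Proof.
move=> e0 lam0; set b := block_intensity sigma h n.
pose eta := expR (- (lam * (e / 2)) + lam ^+ 2 * b / 2); rewrite -/eta.
have eta0 : 0 < eta by exact: expR_gt0.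
have l1 : 0 < lam ^+ 2 + 1 by rewrite ltr_wpDl// sqr_ge0.
pose kap := 2 / (lam ^+ 2 + 1); have kap0 : 0 < kap by rewrite divr_gt0.
have lk : lam ^+ 2 * kap / 2 <= 1.
  by rewrite /kap mulrA mulrAC mulfK// ler_pdivrMr// mul1r lerDl.
pose p := (n * 2 ^ m)%N; pose q := (n.+1 * 2 ^ m)%N.
have e40 : 0 < e / 4 by rewrite divr_gt0.
have [A1 hA1] := discretization_error_small hF hB hsigma h0 hito m q.+1 e40 eta0.
have [A2 hA2] := block_var_le hsigma h0 m n i kap0.
pose a := maxn A1 A2.
have {}hA1 := hA1 a (leq_maxl _ _); have {}hA2 := hA2 a (leq_maxr _ _).
pose M := [set w | exists2 l, (p * 2 ^ a <= l <= q * 2 ^ a)%N &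
   e / 2 < `|S (m + a) i (p * 2 ^ a) l w|].
have pq : (p <= q)%N by rewrite leq_mul2r leqnSn orbT.
have pqa : (p * 2 ^ a <= q * 2 ^ a)%N by rewrite leq_mul2r pq orbT.
have mM : measurable M.
  rewrite (_ : M = \bigcup_(l in [set l | (p * 2 ^ a <= l <= q * 2 ^ a)%N])
      [set w | e / 2 < `|S (m + a) i (p * 2 ^ a) l w|]).
    apply: bigcup_measurable => l /= /andP[pl _]; apply: measurable_gt.
    by apply: measurableT_comp => //; exact: (measurable_grid_sum hF hB).
  by apply/seteqP; split=> w [k]; exists k.
have mD := measurable_discretization_error hF hB h0 hito m q.+1 (e / 4) a.
apply: (@le_trans _ _ (P (discretization_error B sigma h ito m q.+1 (e / 4) a `|` M))).
  apply: le_measure; rewrite ?inE.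
  - exact: measurable_dyadic_excursion.
  - exact: measurableU.
  move=> w [k /andP[pk kq] ek]; apply: contrapT => /not_orP[nD nM].
  have hk (k' : nat) : (k' <= q)%N ->
      `|ito (grid h m k') w i ord0 - S (m + a) i 0 (k' * 2 ^ a) w| <= e / 4.
    move=> k'q; rewrite leNgt; apply/negP => H; apply: nD.
    by exists (Ordinal (k'q : (k' < q.+1)%N), i).
  have hM : `|S (m + a) i (p * 2 ^ a) (k * 2 ^ a) w| <= e / 2.
    rewrite leNgt; apply/negP => H; apply: nM; exists (k * 2 ^ a)%N => //.
    by rewrite !leq_mul2r pk kq !orbT.
  move: ek; rewrite ltNge => /negP; apply.
  have h1 := hk _ kq; have h2 := hk _ pq.
  have pka : (p * 2 ^ a <= k * 2 ^ a)%N by rewrite leq_mul2r pk orbT.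
  rewrite -(grid_sumB B sigma h (m + a) i w pka) in hM.
  move: h1 h2 hM; rewrite -/p !ler_norml; lra.
apply: le_trans (measureU2 _ mD mM) _.
rewrite mulrDl mul1r addrC EFinD leeD//.
have e20 : 0 <= e / 2 by rewrite divr_ge0// ltW.
apply: le_trans (wiener_sum_max_abs hF hB _ _ _ pqa lam0 e20) _.
- by rewrite grid0.
- exact: grid_nd.
rewrite lee_fin -[leRHS]mulrA ler_pM2l// /eta -expRD ler_expR.
have : lam ^+ 2 * wiener_var (grid h (m + a)) (fun k => row i (sigma (grid h (m + a) k)))
    (p * 2 ^ a) (q * 2 ^ a) <= lam ^+ 2 * (b + kap).
  by rewrite ler_wpM2l ?sqr_ge0.
rewrite mulrDr; set u := lam ^+ 2 * b; set u' := _ * wiener_var _ _ _ _.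
move: lk; set u'' := _ * kap; lra.
Qed.

Lemma dyadic_excursion_nd n i e : nondecreasing_seq (dyadic_excursion n i e).
Proof.
apply/nondecreasing_seqP => m; apply/subsetPset => w [k /andP[pk kq] ek].
have g2 k' : grid h m.+1 (k' * 2) = grid h m k'.
  by rewrite -addn1 -{1}(expn1 2) grid_refine.
exists (k * 2)%N; first by rewrite expnSr !mulnA !leq_mul2r pk kq !orbT.
by rewrite expnSr mulnA !g2.
Qed.

(** The events increase with the level m of the dyadic points, and the bound does
    not depend on m. *)
Lemma excursion_le n i (e lam : R) : 0 < e -> 0 <= lam ->
  (P (\bigcup_m dyadic_excursion n i e m) <= ((2 * expR 1 + 1) *
    expR (- (lam * (e / 2)) + lam ^+ 2 * block_intensity sigma h n / 2))%:E)%E.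
Proof.
move=> e0 lam0.
have cv := @nondecreasing_cvg_mu _ _ _ P (dyadic_excursion n i e)
  (fun m => measurable_dyadic_excursion n i e m)
  (bigcup_measurable (fun m _ => measurable_dyadic_excursion n i e m))
  (@dyadic_excursion_nd n i e).
rewrite -(cvg_lim _ cv)//; apply: lime_le; first by apply/cvg_ex; eexists; exact: cv.
by apply: nearW => m; exact: dyadic_excursion_le.
Qed.

End ito_block_maximal.

(** Comparison with 1 / ((k + 1) (k + 2)) = 1 / (k + 1) - 1 / (k + 2), whose
    partial sums are explicit. *)
Lemma nneseries_telescope_lty (R : realType) (u : nat -> \bar R) (C : R) :
  (forall k, (0 <= u k)%E) -> 0 <= C ->
  (forall k, (u k <= (C / (k.+1%:R * k.+2%:R))%:E)%E) ->
  (\sum_(k <oo) u k < +oo)%E.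
Proof.
move=> u0 C0 uC; apply: (@le_lt_trans _ _ C%:E); last by rewrite ltry.
apply: lime_le; first exact: is_cvg_nneseries.
apply: nearW => n; apply: (@le_trans _ _ (C * (1 - n.+1%:R^-1))%:E); last first.
  by rewrite lee_fin ler_piMr// gerBl.
elim: n => [|n IH]; first by rewrite big_geq// invr1 subrr mulr0.
rewrite big_nat_recr//=; apply: le_trans (leeD IH (uC n)) _.
rewrite -EFinD lee_fin -mulrDr ler_wpM2l// le_eqVlt; apply/orP; left; apply/eqP.
have -> : n.+2%:R = n.+1%:R + 1 :> R by rewrite natr1.
have : 0 < n.+1%:R :> R by rewrite ltr0n.
by set y : R := n.+1%:R => y0; field; rewrite !gt_eqF//; lra.
Qed.

Section excursions_vanish.
Context disp (T : measurableType disp) (R : realType) (P : probability T R).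
Variables (F : R -> set (set T)) (d r : nat) (B : R -> T -> 'cV[R]_r).
Hypotheses (hF : filtration F) (hB : brownian_motion P F B).
Variables (sigma : R -> 'M[R]_(d, r)).
Hypothesis hsigma : {within `[0, +oo[, continuous sigma}.
Variables (h : R) (h0 : 0 < h).
Variable ito : R -> T -> 'cV[R]_d.
Hypothesis hito : forall t, 0 <= t -> is_ito_integral P B sigma t (ito t).

(** Borel-Cantelli with lam = (8 / e) ln n: the first exponent is - 4 ln n, and
    a_n ln n -> 0 keeps the second one below 2 ln n. *)
Lemma excursions_vanish i (e : R) : 0 < e ->
  block_intensity sigma h n * ln n%:R @[n --> \oo] --> 0 ->
  P (lim_sup_set (fun n => \bigcup_m dyadic_excursion h ito n i e m)) = 0%E.
Proof.
move=> e0 hA.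
pose E n := \bigcup_m dyadic_excursion h ito n i e m.
have mE n : measurable (E n).
  by apply: bigcup_measurable => m _; exact: (measurable_dyadic_excursion h0 hito).
pose K := 8 / e; have K0 : 0 < K by rewrite divr_gt0.
have H : forall y, 0 < y -> \forall n \near \oo, block_intensity sigma h n * ln n%:R < y.
  by move=> y y0; move: (hA) => /cvgr_lt/(_ y y0).
have [|N _ hN] := H (4 / K ^+ 2).
  by rewrite divr_gt0// exprn_gt0.
pose C := 2 * expR 1 + 1 : R.
have C0 : 0 < C by rewrite addr_gt0// mulr_gt0// expR_gt0.
have EC n : (N <= n)%N -> (0 < n)%N -> (P (E n) <= (C / n%:R ^+ 2)%:E)%E.
  move=> Nn n0; set b := block_intensity sigma h n.
  have L0 : 0 <= ln n%:R :> R by rewrite ln_ge0// ler1n.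
  have := excursion_le hF hB hsigma h0 hito n i e0 (mulr_ge0 (ltW K0) L0).
  move=> /le_trans; apply; rewrite lee_fin ler_pM2l//.
  have -> : (n%:R ^+ 2)^-1 = expR (- (2 * ln n%:R)) :> R.
    by rewrite expRN expRM_natl lnK// posrE ltr0n.
  rewrite ler_expR.
  have -> : K * ln n%:R * (e / 2) = 4 * ln n%:R by rewrite /K; field; rewrite gt_eqF.
  have : (K * ln n%:R) ^+ 2 * b / 2 <= 2 * ln n%:R.
    have -> : (K * ln n%:R) ^+ 2 * b / 2 = (K ^+ 2 / 2 * (b * ln n%:R)) * ln n%:R.
      by ring.
    rewrite ler_wpM2r// -ler_pdivlMl ?divr_gt0 ?exprn_gt0//.
    apply: le_trans (ltW (hN n Nn)) _.
    by rewrite le_eqVlt; apply/orP; left; apply/eqP; field; rewrite gt_eqF.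
  rewrite -/b; lra.
(* Shifting by N.+2 makes n^-2 at most 1 / ((k + 1) (k + 2)) for n = k + N.+2. *)
pose G k := E (k + N.+2)%N.
apply/eqP; rewrite eq_le measure_ge0 andbT.
have -> : 0%E = P (lim_sup_set G).
  apply/esym/lim_sup_set_cvg0; first by move=> k; exact: mE.
  apply: (@nneseries_telescope_lty _ _ C); first by move=> k; exact: measure_ge0.
    exact: ltW.
  move=> k; have kN : (0 < k + N.+2)%N by rewrite addnS.
  have Nk : (N <= k + N.+2)%N by rewrite -addn2 addnCA leq_addr.
  apply: le_trans (EC _ Nk kN) _.
  rewrite lee_fin ler_pM2l// lef_pV2 ?posrE ?exprn_gt0 ?mulr_gt0 ?ltr0n//.
  rewrite expr2 -!natrM ler_nat leq_mul// !addnS !ltnS ?leqW// leq_addr//.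
apply: le_measure; rewrite ?inE; first 2 last.
- move=> w Ew n _; have [k nk Ek] := Ew (n + N.+2)%N Logic.I.
  exists (k - N.+2)%N => /=.
    by rewrite leq_subRL ?(leq_trans _ nk) ?leq_addl// addnC.
  by rewrite /G subnK//; apply: leq_trans nk; exact: leq_addl.
- by apply: bigcap_measurable => // n _; apply: bigcup_measurable => k _; exact: mE.
- by apply: bigcap_measurable => // n _; apply: bigcup_measurable => k _; exact: mE.
Qed.

End excursions_vanish.

(** * Increments of the Ito integral over successive blocks *)
Section small_increments.
Context disp (T : measurableType disp) (R : realType) (P : probability T R).
Variables (F : R -> set (set T)) (d r : nat) (B : R -> T -> 'cV[R]_r).
Hypotheses (hF : filtration F) (hB : brownian_motion P F B).
Variables (sigma : R -> 'M[R]_(d, r)).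
Hypothesis hsigma : {within `[0, +oo[, continuous sigma}.
Variables (h : R) (h0 : 0 < h).
Variable ito : R -> T -> 'cV[R]_d.
Hypothesis hito : forall t, 0 <= t -> is_ito_integral P B sigma t (ito t).

Local Notation S := (grid_sum B sigma h).
Local Notation intensity := (block_intensity sigma h).

Lemma filtrationI t A D : 0 <= t -> F t A -> F t D -> F t (A `&` D).
Proof.
move=> t0 FA FD; have sF : sigma_algebra setT (F t) by case: hF => + _ _; apply.
have GE : @measurable _ (g_sigma_algebraType (F t)) = F t.
  by rewrite -[RHS](sigma_algebra_id sF).
by rewrite -GE; apply: measurableI; rewrite GE.
Qed.

Lemma filtrationT t : 0 <= t -> F t setT.
Proof.
move=> t0; have [sF0 sFC _] : sigma_algebra setT (F t) by case: hF => + _ _; apply.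
by rewrite -(setD0 setT); exact: sFC.
Qed.

Definition small_increments N n (x : R) : set T :=
  [set w | forall k, (N <= k < n)%N -> forall i,
    `|ito (grid h 0 k.+1) w i ord0 - ito (grid h 0 k) w i ord0| <= x].

Lemma measurable_small_increments N n x : measurable (small_increments N n x).
Proof.
rewrite (_ : small_increments N n x = \bigcap_(k in [set k | (N <= k < n)%N])
   \bigcap_(i in [set: 'I_d])
   ~` [set w | x < `|ito (grid h 0 k.+1) w i ord0 - ito (grid h 0 k) w i ord0|]).
  apply: bigcap_measurableType => k _; apply: fin_bigcap_measurable => // i _.
  apply: measurableC; apply: measurable_gt; apply: measurableT_comp => //.
  by apply: measurable_funB; apply: (measurable_ito hito); exact: grid_ge0.
apply/seteqP; split=> w H k /= kNn i => [_|]; first by apply/negP; rewrite -leNgt; exact: H.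
by rewrite leNgt; apply/negP; exact: (H k kNn i Logic.I).
Qed.

(** Block k is examined along a row [i k] that carries enough variance.  Given
    the past, its grid sum reaches 3 x with probability at least q, so the
    probability that no block has done so is multiplied by at most 1 - q at each
    block.  If all increments of the Ito integral are at most x and all
    discretization errors at most x / 2, then the grid sums stay below 3 x; the
    error event has probability at most delta, which is arbitrary. *)
Lemma small_increments_le N n x q : (N <= n)%N -> 0 < x -> 0 <= q -> q <= 1 ->
  (forall k, (k < n)%N -> 0 < intensity k) ->
  (forall k, (k < n)%N -> q <= 16^-1 *
     expR (- (32 + 32 * ((3 * x) ^+ 2 / (intensity k / (2 * d%:R)))))) ->
  (P (small_increments N n x) <= ((1 - q) ^+ (n - N))%:E)%E.
Proof.
move=> Nn x0 q0 q1 a0 qa; apply/lee_addgt0Pr => delta delta0.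
have /choice[i hi] : forall k : 'I_n, exists i, exists A, forall a, (A <= a)%N ->
    intensity k / (2 * d%:R) <= wiener_var (grid h (0 + a))
      (fun l => row i (sigma (grid h (0 + a) l))) (k * 2 ^ a) (k.+1 * 2 ^ a).
  move=> k; have [i [A hA]] := block_var_ge hsigma h0 0 (a0 k (ltn_ord k)).
  by exists i, A => a /hA; rewrite expn0 !muln1.
have /choice[A hA] := hi.
have x20 : 0 < x / 2 by rewrite divr_gt0.
have [A' hA'] := discretization_error_small hF hB hsigma h0 hito 0 n.+1 x20 delta0.
pose a := maxn A' (\max_k A k).
have {hA} hv (k : 'I_n) : intensity k / (2 * d%:R) <= wiener_var (grid h (0 + a))
      (fun l => row (i k) (sigma (grid h (0 + a) l))) (k * 2 ^ a) (k.+1 * 2 ^ a).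
  by apply: hA; rewrite leq_max (leq_bigmax k) orbT.
have {hA'} hD := hA' a (leq_maxl _ _).
have mD := measurable_discretization_error hF hB h0 hito 0 n.+1 (x / 2) a.
(* Rows are chosen for k < n only; G is the whole space beyond. *)
pose G k := if insub k is Some k' then
  [set w | S a (i k') (k * 2 ^ a) (k.+1 * 2 ^ a) w < 3 * x] else setT.
pose Q m := [set w | forall k, (N <= k < m)%N -> G k w].
have kk k : (k * 2 ^ a <= k.+1 * 2 ^ a)%N by rewrite leq_mul2r leqnSn orbT.
have g00 : 0 <= grid h a 0 by rewrite grid0.
have FG k : F (grid h a (k.+1 * 2 ^ a)) (G k).
  rewrite /G; case: insubP => [k' _ _|_]; last exact: filtrationT (grid_ge0 h0 _ _).
  have fm := sub_measurable_wiener_sum hF hB (fun l => row (i k') (sigma (grid h a l)))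
    g00 (@grid_nd R h h0 a) (kk k).
  rewrite (_ : [set w | _] = S a (i k') (k * 2 ^ a) (k.+1 * 2 ^ a) @^-1` `]-oo, 3 * x[).
    by apply: fm; exact: measurable_itv.
  by apply/seteqP; split=> w /=; rewrite in_itv.
have FQ m : F (grid h a (m * 2 ^ a)) (Q m).
  elim: m => [|m IH].
    rewrite (_ : Q 0%N = setT); first exact: filtrationT (grid_ge0 h0 _ _).
    by apply/seteqP; split => // w _ k /andP[_]; rewrite ltn0.
  have [Nm|mN] := leqP N m.
    rewrite (_ : Q m.+1 = Q m `&` G m).
      apply: filtrationI; [exact: grid_ge0| |exact: FG].
      have st : grid h a (m * 2 ^ a) <= grid h a (m.+1 * 2 ^ a) by exact: grid_nd.
      by case: hF => _ _ /(_ _ _ (grid_ge0 h0 _ _) st); apply; exact: IH.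
    apply/seteqP; split=> w.
      move=> Qw; split; last by apply: Qw; rewrite Nm leqnn.
      by move=> k /andP[Nk km]; apply: Qw; rewrite Nk (leqW km).
    move=> [Qw Gw] k /andP[Nk]; rewrite ltnS leq_eqVlt => /predU1P[-> //|km].
    by apply: Qw; rewrite Nk.
  rewrite (_ : Q m.+1 = setT); first exact: filtrationT (grid_ge0 h0 _ _).
  apply/seteqP; split => // w _ k /andP[Nk km].
  by have := leq_ltn_trans Nk km; rewrite ltnNge mN.
have mQ m : measurable (Q m) by apply: (filtration_measurable hF _ (FQ m)); exact: grid_ge0.
have PQ m : (N <= m)%N -> (m <= n)%N -> (P (Q m) <= ((1 - q) ^+ (m - N))%:E)%E.
  elim: m => [|m IH]; first by rewrite leqn0 => /eqP -> _; rewrite subnn expr0 probability_le1.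
  rewrite leq_eqVlt => /predU1P[<- _|]; first by rewrite subnn expr0 probability_le1.
  rewrite ltnS => Nm mn; rewrite subSn// exprSr.
  pose k' := Ordinal mn; pose H := [set w | 3 * x <= S a (i k') (m * 2 ^ a) (m.+1 * 2 ^ a) w].
  have mH : measurable H.
    rewrite (_ : H = ~` [set w | - (3 * x) < - S a (i k') (m * 2 ^ a) (m.+1 * 2 ^ a) w]).
      apply: measurableC; apply: measurable_gt; apply: measurableT_comp => //.
      exact: (measurable_grid_sum hF hB).
    by apply/seteqP; split=> w /=; rewrite ltrN2; [move=> ?; apply/negP; rewrite -leNgt|move=> /negP; rewrite -leNgt].
  have -> : Q m.+1 = Q m `\` H.
    apply/seteqP; split=> w.
      move=> Qw; split; first by move=> k /andP[Nk km]; apply: Qw; rewrite Nk (leqW km).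
      have : G m w by apply: Qw; rewrite Nm leqnn.
      rewrite /G insubT /= => Sw; apply/negP; rewrite -ltNge.
      by rewrite (_ : k' = Sub m mn)//; apply: val_inj.
    move=> [Qw Hw] k /andP[Nk]; rewrite ltnS leq_eqVlt => /predU1P[->|km].
      rewrite /G insubT /=; move/negP : Hw; rewrite -ltNge.
      by rewrite (_ : k' = Sub m mn)//; apply: val_inj.
    by apply: Qw; rewrite Nk.
  have QH : (P (Q m `&` H) >= P (Q m) * q%:E)%E.
    have dk0 : 0 < intensity m / (2 * d%:R).
      rewrite divr_gt0 ?a0// mulr_gt0// ltr0n.
      by case: (d) (i k') => // -[].
    have hV : intensity m / (2 * d%:R) <= wiener_var (grid h a)
      (fun l => row (i k') (sigma (grid h a l))) (m * 2 ^ a) (m.+1 * 2 ^ a) := hv k'.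
    have x30 : 0 <= 3 * x by rewrite mulr_ge0// ltW.
    have := wiener_sum_lower_tail hF hB g00 (@grid_nd R h h0 a) (kk m) (FQ m)
      (lt_le_trans dk0 hV) x30.
    apply: le_trans; apply: lee_wpmul2l; first exact: measure_ge0.
    rewrite lee_fin; apply: le_trans (qa m mn) _.
    move: hV; move: (wiener_var _ _ _ _) => V hV.
    rewrite ler_wpM2l ?invr_ge0// ler_expR lerN2 lerD2l ler_wpM2l//.
    rewrite ler_wpM2l ?sqr_ge0// lef_pV2 ?posrE//.
    exact: lt_le_trans hV.
  have mQH : measurable (Q m `&` H) by exact: measurableI.
  rewrite measureD//; last by rewrite ltey_eq fin_num_measure.
  have -> : (P (Q m) - P (Q m `&` H) =
      (fine (P (Q m)) - fine (P (Q m `&` H)))%:E)%E.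
    by rewrite EFinB !fineK// fin_num_measure.
  move: QH (IH Nm (ltnW mn)).
  rewrite -[P (Q m)]fineK ?fin_num_measure// -[P (_ `&` _)]fineK ?fin_num_measure//.
  rewrite -EFinM !lee_fin => h1 h2.
  have q1' : 0 <= 1 - q by rewrite subr_ge0.
  have := ler_wpM2r q1' h2; rewrite mulrBr mulr1; lra.
have mSI := measurable_small_increments N n x.
apply: (@le_trans _ _ (P (Q n `|` discretization_error B sigma h ito 0 n.+1 (x / 2) a))).
  apply: le_measure; rewrite ?inE//; first exact: measurableU.
  move=> w Sw; apply: contrapT => /not_orP[nQ nD]; apply: nQ => k kNn.
  have /andP[Nk kn] := kNn.
  have hk (k' : nat) j : (k' < n.+1)%N ->
      `|ito (grid h 0 k') w j ord0 - S a j 0 (k' * 2 ^ a) w| <= x / 2.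
    move=> k'n; rewrite leNgt; apply/negP => H; apply: nD.
    by exists (Ordinal k'n, j).
  rewrite /G insubT /= -(grid_sumB _ _ _ _ _ _ (kk k)).
  set j := i _.
  have h1 := hk k.+1 j kn; have h2 := hk k j (leqW kn).
  have h3 := Sw k kNn j.
  move: h1 h2 h3; rewrite !ler_norml; lra.
apply: le_trans (measureU2 _ (mQ n) mD) _.
by apply: leeD => //; exact: PQ.
Qed.

End small_increments.

Section not_small_increments.
Context disp (T : measurableType disp) (R : realType) (P : probability T R).
Variables (F : R -> set (set T)) (d r : nat) (B : R -> T -> 'cV[R]_r).
Hypotheses (hF : filtration F) (hB : brownian_motion P F B) (hd : (0 < d)%N).
Variables (sigma : R -> 'M[R]_(d, r)).
Hypothesis hsigma : {within `[0, +oo[, continuous sigma}.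
Variables (h : R) (h0 : 0 < h).
Variable ito : R -> T -> 'cV[R]_d.
Hypothesis hito : forall t, 0 <= t -> is_ito_integral P B sigma t (ito t).
Hypothesis hmon : nonincreasing_seq (block_intensity sigma h).

Local Notation intensity := (block_intensity sigma h).

Lemma block_intensity_ge0 n : 0 <= intensity n.
Proof.
rewrite -lee_fin -(block_intensityE hsigma h0); apply: integral_ge0 => s _.
by rewrite lee_fin sqr_ge0.
Qed.

(** Monotonicity spreads the lower bound a_n ln n >= eta, known for infinitely
    many n only, to a_k >= eta / ln n for all k < n.  Each of these blocks then
    has conditional probability at least q n = kap n^(-1/2) of a large
    increment, and (1 - q n)^(n - N) tends to 0 along these n. *)
Lemma small_increments_null : ~ (intensity n * ln n%:R @[n --> \oo] --> 0) ->
  exists2 x, 0 < x & forall N,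
    P (\bigcap_n small_increments h ito N n x) = 0%E.
Proof.
move=> nA.
have [eta eta0 heta] : exists2 eta, 0 < eta &
    forall N, exists2 n, (N <= n)%N & eta <= intensity n * ln n%:R.
  apply: contrapT => H; apply: nA; apply/cvgr0Pnorm_lt => eta eta0.
  have [N hN] : exists N, forall n, (N <= n)%N -> intensity n * ln n%:R < eta.
    apply: contrapT => H'; apply: H; exists eta => // N.
    apply: contrapT => H''; apply: H'; exists N => n Nn.
    by rewrite ltNge; apply/negP => hn; apply: H''; exists n.
  exists (maxn N 1) => // n /=; rewrite geq_max => /andP[Nn n1].
  rewrite ger0_norm; first exact: hN.
  by rewrite mulr_ge0 ?block_intensity_ge0// ln_ge0// ler1n.
have dR : 0 < d%:R :> R by rewrite ltr0n.
have a0 n : 0 < intensity n.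
  have [n' nn' hn'] := heta (maxn n 1).
  move: nn'; rewrite geq_max => /andP[nn' n1].
  apply: lt_le_trans (hmon nn'); rewrite lt_neqAle block_intensity_ge0 andbT eq_sym.
  by apply/negP => /eqP a0; move: hn'; rewrite a0 mul0r leNgt eta0.
have ed0 : 0 < eta / (8 * d%:R) by rewrite divr_gt0// mulr_gt0.
(* This x solves 32 (3 x)^2 (2 d) = eta / 2, so that the exponent in the lower
   tail is eta / (2 a_k), at most (ln n) / 2. *)
pose x := Num.sqrt (eta / (8 * d%:R)) / 12.
have x2 : (3 * x) ^+ 2 = eta / (8 * d%:R) / 16.
  by rewrite -[X in _ = X / _](sqr_sqrtr (ltW ed0)) /x; field.
have x0 : 0 < x by rewrite divr_gt0// sqrtr_gt0.
exists x => // N.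
pose kap : R := 16^-1 * expR (- 32).
have kap0 : 0 < kap by rewrite mulr_gt0 ?invr_gt0// expR_gt0.
pose q n := kap * expR (- (ln n%:R / 2)) : R.
have q0 n : 0 < q n by rewrite mulr_gt0// expR_gt0.
have q1 n : (0 < n)%N -> q n <= 1.
  move=> n0; rewrite /q /kap -mulrA -expRD mulr_ile1 ?invr_ge0 ?expR_ge0//.
    by rewrite invf_le1// ler1n.
  rewrite -[leRHS]expR0 ler_expR.
  have : 0 <= ln n%:R :> R by rewrite ln_ge0// ler1n.
  lra.
have bound n : (0 < n)%N -> (N <= n)%N -> eta <= intensity n * ln n%:R ->
    (P (small_increments h ito N n x) <= ((1 - q n) ^+ (n - N))%:E)%E.
  move=> n0 Nn hn; apply: (small_increments_le hF hB hsigma h0 hito) => //.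
  - exact: ltW.
  - exact: q1.
  move=> k kn; rewrite /q /kap -mulrA -expRD ler_wpM2l ?invr_ge0// ler_expR.
  rewrite -opprD lerN2 lerD2l.
  have an : eta <= intensity k * ln n%:R.
    apply: le_trans hn _; rewrite ler_wpM2r//; last exact/hmon/ltnW.
    by rewrite ln_ge0// ler1n.
  have -> : 32 * ((3 * x) ^+ 2 / (intensity k / (2 * d%:R))) = eta / intensity k / 2.
    by rewrite x2; field; rewrite !gt_eqF.
  by rewrite ler_pM2r ?invr_gt0// ler_pdivrMr// mulrC.
have mSI n : measurable (small_increments h ito N n x).
  exact: (measurable_small_increments h0 hito).
have small (dl : R) : 0 < dl -> (P (\bigcap_n small_increments h ito N n x) <= dl%:E)%E.
  move=> dl0.
  pose big := 4 / (kap * dl); have big0 : 0 < big by rewrite divr_gt0// mulr_gt0.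
  pose N' := (maxn (maxn 1 N.*2) (Num.truncn (expR big)).+1).
  have [n N'n hn] := heta N'.
  move: N'n; rewrite !geq_max => /andP[/andP[n1 Nn] bn].
  have NnN : (N <= n)%N by apply: leq_trans Nn; rewrite -addnn leq_addr.
  apply: (@le_trans _ _ (P (small_increments h ito N n x))).
    by apply: le_measure; rewrite ?inE//; [exact: bigcapT_measurable|move=> w; apply].
  apply: le_trans (bound n n1 NnN hn) _; rewrite lee_fin.
  have lnbig : big <= ln n%:R.
    rewrite -[big]expRK ler_ln ?posrE ?expR_gt0 ?ltr0n//.
    apply: le_trans (ltW (truncnS_gt _)) _.
    by rewrite ler_nat.
  have nR0 : 0 < n%:R :> R by rewrite ltr0n.
  have h1 : (1 - q n) ^+ (n - N) <= expR (- (q n * (n - N)%:R)).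
    have -> : - (q n * (n - N)%:R) = (n - N)%:R * - q n by rewrite mulrN mulrC.
    rewrite expRM_natl; apply: lerXn2r; rewrite ?nnegrE ?expR_ge0 ?subr_ge0 ?q1//.
    exact: expR_ge1Dx.
  apply: le_trans h1 _.
  have nN : n%:R / 2 <= (n - N)%:R :> R.
    rewrite natrB// ler_pdivrMr//.
    have : (N.*2)%:R <= n%:R :> R by rewrite ler_nat.
    rewrite -muln2 natrM; lra.
  have h2 : kap * ln n%:R / 4 <= q n * (n - N)%:R.
    apply: (@le_trans _ _ (q n * (n%:R / 2))); last by rewrite ler_pM2l.
    pose L : R := ln n%:R; have nE : n%:R = expR L by rewrite lnK// posrE.
    have -> : q n * (n%:R / 2) = kap * (expR (L / 2) / 2).
      have e1 : expR (- (L / 2)) * expR (L / 2) = 1 by rewrite -expRD addNr expR0.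
      have e2 : expR L = expR (L / 2) * expR (L / 2) by rewrite -expRD -splitr.
      rewrite /q -/L nE e2.
      transitivity (kap * (expR (- (L / 2)) * expR (L / 2)) * (expR (L / 2) / 2)).
        by ring.
      by rewrite e1 mulr1.
    rewrite -/L -mulrA ler_pM2l//; have := expR_ge1Dx (L / 2); lra.
  have z0 : 0 < q n * (n - N)%:R.
    by apply: lt_le_trans h2; rewrite divr_gt0// mulr_gt0// (lt_le_trans big0).
  have h3 : dl^-1 <= q n * (n - N)%:R.
    apply: le_trans h2.
    have -> : dl^-1 = kap * big / 4 by rewrite /big; field; rewrite !gt_eqF.
    by rewrite ler_pM2r ?invr_gt0// ler_pM2l.
  rewrite expRN -[leRHS]invrK lef_pV2 ?posrE ?expR_gt0 ?invr_gt0//.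
  apply: le_trans h3 _.
  have := expR_ge1Dx (q n * (n - N)%:R); lra.
apply/eqP; rewrite eq_le measure_ge0 andbT.
apply/lee_addgt0Pr => dl dl0; rewrite add0e; exact: small.
Qed.

End not_small_increments.

(** * Decay of stable linear differential equations *)
Section linear_decay.
Context (R : realType).
Implicit Types (f u : R -> R).

Lemma vanishP f : f t @[t --> +oo%R] --> (0 : R) <->
  forall e, 0 < e -> exists T, forall t : R, T <= t -> `|f t| <= e.
Proof.
split=> [f0 e e0|H].
  have [T [_ hT]] : \forall t \near +oo%R, `|f t| < e by move/cvgr0_norm_lt : f0; exact.
  exists (T + 1) => t Tt; apply/ltW/hT; apply: lt_le_trans Tt.
  by rewrite ltrDl.
apply/cvgr0Pnorm_le => e e0; have [T hT] := H e e0.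
by exists T; split; [exact: num_real|move=> t /ltW; exact: hT].
Qed.

Lemma primitive_derive f (b t : R) : continuous f -> b < t ->
  is_derive t 1 (fun t : R => \int[lebesgue_measure]_(s in `[b, t]) f s) (f t).
Proof.
move=> cf bt; have tt1 : t < t + 1 by rewrite ltrDl.
have intf : lebesgue_measure.-integrable `[b, t + 1] (EFin \o f).
  apply: continuous_compact_integrable; first exact: segment_compact.
  exact: continuous_subspaceT.
have [df <-] := continuous_FTC1_closed tt1 intf bt (cf t).
by rewrite derive1E; exact: DeriveDef.
Qed.

(** Gronwall: exp (a t) (f t - e) does not increase. *)
Lemma decay_comparison f (df : R -> R) (a e T S : R) : T <= S ->
  (forall t : R, T <= t <= S -> is_derive t 1 f (df t)) ->
  (forall t : R, T <= t <= S -> df t <= - a * (f t - e)) ->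
  f S <= e + expR (- (a * (S - T))) * (f T - e).
Proof.
move=> TS dfP dfle.
pose Phi t := expR (a * t) * (f t - e).
have dPhi (t : R) : T <= t <= S ->
    is_derive t 1 Phi (expR (a * t) * df t + (f t - e) * (a * expR (a * t))).
  move=> tTS; have hf := dfP t tTS.
  have hE : is_derive t 1 (fun t => expR (a * t)) (a * expR (a * t)).
    have hl : is_derive t 1 (fun t : R => a * t) a.
      by apply: is_derive_eq; rewrite /GRing.scale/= mulr1.
    rewrite mulrC.
    exact: (@is_derive1_comp R expR (fun t => a * t) t _ _ (is_derive_expR _) hl).
  have hfe : is_derive t 1 (fun t => f t - e) (df t).
    by apply: is_derive_eq; rewrite subr0.
  exact: is_deriveM.
have : Phi S <= Phi T.
  apply: (@ler0_derive1_le_cc R Phi T S) => //.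
  - by move=> t /= tTS; have [] := dPhi t (subset_itv_oo_cc tTS).
  - move=> t /= tTS; have tTS' := subset_itv_oo_cc tTS; rewrite derive1E.
    have -> := @derive_val _ _ _ _ _ _ _ (dPhi t tTS').
    have := dfle t tTS'; have := expR_gt0 (a * t).
    by set E := expR _; move=> E0 /(ler_wpM2l (ltW E0)); nra.
  - apply: derivable_within_continuous => t; rewrite in_itv/= => tTS.
    by have [] := dPhi t tTS.
  - by rewrite in_itv/= lexx TS.
  - by rewrite in_itv/= lexx TS.
rewrite /Phi -ler_pdivlMl ?expR_gt0// -expRN mulrA -expRD => h.
have -> : - (a * (S - T)) = - (a * S) + a * T by ring.
by rewrite -lerBlDl.
Qed.

Lemma expR_decay (a c T eps : R) : 0 < a -> 0 < eps -> exists T', T <= T' /\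
  forall t : R, T' <= t -> expR (- (a * (t - T))) * c <= eps.
Proof.
move=> a0 eps0; exists (T + `|c| / (eps * a)).
split; first by rewrite lerDl divr_ge0// mulr_ge0// ltW.
move=> t Tt.
have h : `|c| / eps <= a * (t - T).
  have -> : `|c| / eps = a * (`|c| / (eps * a)) by field; rewrite !gt_eqF.
  by rewrite ler_pM2l// lerBrDl.
apply: le_trans (ler_wpM2l (expR_ge0 _) (ler_norm c)) _.
rewrite expRN mulrC ler_pdivrMr ?expR_gt0// mulrC -ler_pdivrMr//.
apply: le_trans h _; apply: le_trans (expR_ge1Dx _).
by rewrite lerDr.
Qed.

(** The equation u' = (al + i be) u + f for u = p + i q, split into real and
    imaginary parts.  In the derivative of the energy |u|^2 the rotation be
    cancels, and the forcing is absorbed by half of the damping 2 al |u|^2. *)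
Lemma complex_linear_vanish (p q f1 f2 : R -> R) (al be T0 : R) :
  0 < T0 -> al < 0 ->
  (forall t : R, T0 <= t -> is_derive t 1 p (al * p t - be * q t + f1 t)) ->
  (forall t : R, T0 <= t -> is_derive t 1 q (be * p t + al * q t + f2 t)) ->
  f1 t @[t --> +oo%R] --> (0 : R) -> f2 t @[t --> +oo%R] --> (0 : R) ->
  p t @[t --> +oo%R] --> (0 : R) /\ q t @[t --> +oo%R] --> (0 : R).
Proof.
move=> T00 al0 dp dq /vanishP f10 /vanishP f20.
pose a := - al; have a0 : 0 < a by rewrite oppr_gt0.
pose E t := p t ^+ 2 + q t ^+ 2.
have hE eps : 0 < eps -> exists T, forall t : R, T <= t -> E t <= eps.
  move=> eps0.
  have ae0 : 0 < a * Num.sqrt (eps / 4).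
    by rewrite mulr_gt0// sqrtr_gt0 divr_gt0.
  have [T1 h1] := f10 _ ae0; have [T2 h2] := f20 _ ae0.
  pose T := Num.max T0 (Num.max T1 T2).
  have TP t : T <= t -> [/\ T0 <= t, T1 <= t & T2 <= t].
    by rewrite /T !ge_max => /andP[-> /andP[-> ->]].
  have sq f t : `|f t| <= a * Num.sqrt (eps / 4) -> f t ^+ 2 <= a ^+ 2 * (eps / 4).
    move=> h; rewrite -real_normK ?num_real// -[eps / 4]sqr_sqrtr; last first.
      by rewrite divr_ge0// ltW.
    by rewrite -exprMn ler_pXn2r ?nnegrE// ltW.
  pose dE t := 2 * p t * (al * p t - be * q t + f1 t) +
               2 * q t * (be * p t + al * q t + f2 t).
  have dEP (t : R) : T <= t -> is_derive t 1 E (dE t).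
    move=> /TP[T0t _ _]; have h := dp t T0t; have h' := dq t T0t.
    have -> : E = (fun t => p t * p t + q t * q t).
      by apply/funext => s; rewrite /E !expr2.
    apply: is_derive_eq; rewrite /dE /GRing.scale/=; ring.
  have dEle (t : R) : T <= t -> dE t <= - a * (E t - eps / 2).
    move=> /TP[_ /h1/sq s1 /h2/sq s2].
    have k1 : 2 * p t * f1 t <= a * p t ^+ 2 + f1 t ^+ 2 / a.
      rewrite -subr_ge0 (_ : _ - _ = (a * p t - f1 t) ^+ 2 / a).
        by rewrite divr_ge0 ?sqr_ge0// ltW.
      by field; rewrite gt_eqF.
    have k2 : 2 * q t * f2 t <= a * q t ^+ 2 + f2 t ^+ 2 / a.
      rewrite -subr_ge0 (_ : _ - _ = (a * q t - f2 t) ^+ 2 / a).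
        by rewrite divr_ge0 ?sqr_ge0// ltW.
      by field; rewrite gt_eqF.
    have div z : z <= a ^+ 2 * (eps / 4) -> z / a <= a * (eps / 4).
      by move=> hz; rewrite ler_pdivrMr// mulrAC -expr2.
    have {}s1 := div _ s1; have {}s2 := div _ s2.
    have -> : dE t = - (2 * a) * (p t ^+ 2 + q t ^+ 2) + 2 * p t * f1 t + 2 * q t * f2 t.
      by rewrite /dE /a; ring.
    rewrite /E; lra.
  have e20 : 0 < eps / 2 by rewrite divr_gt0.
  have [T' [TT' hT']] := expR_decay (E T - eps / 2) T a0 e20.
  exists T' => t T't; have Tt := le_trans TT' T't.
  have := @decay_comparison E dE a (eps / 2) T t Tt.
  move=> /(_ (fun s h => dEP s (andP h).1) (fun s h => dEle s (andP h).1)).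
  have := hT' t T't; lra.
have toE (g : R -> R) : (forall t : R, g t ^+ 2 <= E t) -> g t @[t --> +oo%R] --> (0 : R).
  move=> gE; apply/vanishP => e e0.
  have [T hT] := hE (e ^+ 2) (exprn_gt0 _ e0).
  exists T => t /hT h; rewrite -ler_sqr ?nnegrE// ?(ltW e0)//.
  by rewrite real_normK ?num_real//; exact: le_trans (gE t) h.
by split; apply: toE => t; rewrite /E ?lerDl ?lerDr sqr_ge0.
Qed.

End linear_decay.

Section complex_parts.
Context (R : realType).
Local Notation C := (complex R).
Local Notation Re := (@complex.Re R).
Local Notation Im := (@complex.Im R).
Local Notation inC := (complex.real_complex R).

Lemma ReD (a b : C) : Re (a + b) = Re a + Re b.
Proof. by case: a; case: b. Qed.

Lemma ImD (a b : C) : Im (a + b) = Im a + Im b.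
Proof. by case: a; case: b. Qed.

Lemma ReM (a b : C) : Re (a * b) = Re a * Re b - Im a * Im b.
Proof. by case: a; case: b. Qed.

Lemma ImM (a b : C) : Im (a * b) = Im a * Re b + Re a * Im b.
Proof. by case: a => x y; case: b => u v /=; rewrite addrC. Qed.

Lemma Re_sum I (s : seq I) (f : I -> C) : Re (\sum_(i <- s) f i) = \sum_(i <- s) Re (f i).
Proof. exact: (big_morph _ ReD). Qed.

Lemma Im_sum I (s : seq I) (f : I -> C) : Im (\sum_(i <- s) f i) = \sum_(i <- s) Im (f i).
Proof. exact: (big_morph _ ImD). Qed.

Lemma Re_mulr (a : C) (x : R) : Re (a * inC x) = Re a * x.
Proof. by rewrite ReM /= mulr0 subr0. Qed.

Lemma Im_mulr (a : C) (x : R) : Im (a * inC x) = Im a * x.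
Proof. by rewrite ImM /= mulr0 addr0. Qed.

End complex_parts.

Section hurwitz.
Context (R : realType) (d' : nat).
Local Notation d := d'.+1.
Local Notation C := (complex R).
Local Notation inC := (complex.real_complex R).
Variables (A : 'M[R]_d) (y g : 'I_d -> R -> R) (T0 : R).
Hypothesis T00 : 0 < T0.
Hypothesis dy : forall i (t : R), T0 <= t ->
  is_derive t 1 (y i) (\sum_j A i j * y j t + g i t).
Hypothesis g0 : forall i, g i t @[t --> +oo%R] --> (0 : R).

Let AC : 'M[C]_d := map_mx inC A.
Let Y (t : R) : 'cV[C]_d := \col_j inC (y j t).
Let G (t : R) : 'cV[C]_d := \col_j inC (g j t).

Let Re_comb (M : 'M[C]_d) (u : 'I_d -> R) i :
  complex.Re ((M *m (\col_j inC (u j))) i 0) = \sum_j complex.Re (M i j) * u j.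
Proof. by rewrite mxE Re_sum; apply: eq_bigr => j _; rewrite mxE Re_mulr. Qed.

Let Im_comb (M : 'M[C]_d) (u : 'I_d -> R) i :
  complex.Im ((M *m (\col_j inC (u j))) i 0) = \sum_j complex.Im (M i j) * u j.
Proof. by rewrite mxE Im_sum; apply: eq_bigr => j _; rewrite mxE Im_mulr. Qed.

Let comb_vanish (c : 'I_d -> R) : (\sum_j c j * g j t) @[t --> +oo%R] --> (0 : R).
Proof.
have e : \sum_(j < d) c j * 0 = 0 by rewrite big1// => j _; rewrite mulr0.
rewrite -[X in _ --> X]e.
by apply: cvg_sumr => j _; apply: cvgM; [exact: cvg_cst|exact: g0].
Qed.

Let comb_derive (c : 'I_d -> R) (t : R) : T0 <= t ->
  is_derive t 1 (fun t => \sum_j c j * y j t)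
    (\sum_j c j * (\sum_k A j k * y k t + g j t)).
Proof.
move=> T0t; have -> : (fun t => \sum_j c j * y j t) = \sum_j (fun t => c j * y j t).
  by apply/funext => s; rewrite fct_sumE.
apply: is_derive_sum => j; have h := dy j T0t.
apply: is_derive_eq; rewrite /GRing.scale/=; ring.
Qed.

(** Induction on the list s of eigenvalues.  As M commutes with A, the vector
    u = M Y solves u' = z u + (A - z) M Y + M G, where (A - z) M Y vanishes at
    infinity by induction; each coordinate is then a scalar equation with
    damping Re z.  Only polynomials in A occur, so that neither the Jordan form
    nor the exponential of A enters. *)
Lemma krylov_vanish (s : seq C) (M : 'M[C]_d) :
  all (fun z => complex.Re z < 0) s -> M * AC = AC * M ->
  (\prod_(z <- s) (AC - z%:M)) * M = 0 ->
  forall i, complex.Re ((M *m Y t) i 0) @[t --> +oo%R] --> (0 : R) /\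
            complex.Im ((M *m Y t) i 0) @[t --> +oo%R] --> (0 : R).
Proof.
elim: s M => [|z s IH] M /=.
  rewrite big_nil mul1r => _ _ -> i.
  by split; under eq_fun do rewrite mul0mx mxE /=; exact: cvg_cst.
move=> /andP[z0 s0] MA; rewrite big_cons => PM i.
pose M' := (AC - z%:M) * M.
have cM (a : C) (N : 'M[C]_d) : GRing.comm (a%:M : 'M[C]_d) N by exact: esym (scalar_mxC a N).
have zM := cM z.
have M'A : M' * AC = AC * M'.
  by rewrite /M' -mulrA MA !mulrA mulrBl mulrBr zM.
have PM' : (\prod_(z <- s) (AC - z%:M)) * M' = 0.
  rewrite /M' mulrA -[RHS]PM; congr (_ * _).
  have : GRing.comm (AC - z%:M) (\prod_(z <- s) (AC - z%:M)).
    apply: commr_prod => z' _; apply: commrB; apply: commr_sym; last exact: cM.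
    by apply: commrB => //; apply: commr_sym; exact: cM.
  by move=> ->.
have [IHr IHi] := IH M' s0 M'A PM' i.
have alg t : M *m (AC *m Y t + G t) = z *: (M *m Y t) + (M' *m Y t + M *m G t).
  rewrite mulmxDr mulmxA addrA; congr (_ + _).
  rewrite -[M *m AC]/(M * AC) MA -[AC * M](subrK (z%:M * M)) -mulrBl -/M'.
  rewrite mulmxDl addrC; congr (_ + _).
  by rewrite -mul_scalar_mx mulmxA.
pose u t := (M *m Y t) i 0.
pose f t := ((M' *m Y t) i 0 + (M *m G t) i 0).
have dYE t : \col_j inC (\sum_k A j k * y k t + g j t) = AC *m Y t + G t.
  apply/colP => j; rewrite !mxE rmorphD rmorph_sum; congr (_ + _).
  by apply: eq_bigr => k _; rewrite !mxE rmorphM.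
have uE t : (M *m (AC *m Y t + G t)) i 0 = z * u t + f t.
  by rewrite alg mxE [X in X + _]mxE [X in _ + X]mxE.
apply: (@complex_linear_vanish R (fun t => complex.Re (u t)) (fun t => complex.Im (u t))
  (fun t => complex.Re (f t)) (fun t => complex.Im (f t)) (complex.Re z) (complex.Im z) T0) => //.
- move=> t T0t; have := comb_derive (fun j => complex.Re (M i j)) T0t.
  rewrite -Re_comb dYE uE ReD ReM; congr is_derive.
  by apply/funext => s'; rewrite -Re_comb.
- move=> t T0t; have := comb_derive (fun j => complex.Im (M i j)) T0t.
  rewrite -Im_comb dYE uE ImD ImM; congr is_derive.
  by apply/funext => s'; rewrite -Im_comb.
- have := cvgD IHr (comb_vanish (fun j => complex.Re (M i j))); rewrite addr0.
  rewrite (_ : _ + _ = fun t => complex.Re (f t)); first by apply.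
  by apply/funext => t; rewrite /f ReD [X in _ = _ + X]Re_comb.
- have := cvgD IHi (comb_vanish (fun j => complex.Im (M i j))); rewrite addr0.
  rewrite (_ : _ + _ = fun t => complex.Im (f t)); first by apply.
  by apply/funext => t; rewrite /f ImD [X in _ = _ + X]Im_comb.
Qed.

(** By Cayley-Hamilton the product over all eigenvalues annihilates M = 1. *)
Lemma hurwitz_vanish :
  (forall z : C, complex_eigenvalue A z -> complex.Re z < 0) ->
  forall i, y i t @[t --> +oo%R] --> (0 : R).
Proof.
move=> hA i.
have [s sE] := closed_field_poly_normal (char_poly AC).
have s0 : all (fun z => complex.Re z < 0) s.
  apply/allP => z zs; apply: hA; rewrite /complex_eigenvalue eigenvalue_root_char sE.
  rewrite rootZ ?lead_coef_eq0 ?monic_neq0 ?char_poly_monic//.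
  by rewrite root_prod_XsubC.
have PM : (\prod_(z <- s) (AC - z%:M)) * 1 = 0.
  rewrite mulr1 -[RHS](Cayley_Hamilton AC) sE (monicP (char_poly_monic _)) scale1r.
  rewrite rmorph_prod; apply: eq_bigr => z _.
  by rewrite rmorphB /= horner_mx_X horner_mx_C.
have comm1 : 1 * AC = AC * 1 by rewrite mul1r mulr1.
have [h _] := krylov_vanish s0 comm1 PM i.
by move: h; under eq_fun do rewrite mul1mx mxE.
Qed.

End hurwitz.

(** * From the oscillation of the noise to the decay of one path *)
Lemma block_locate (R : realType) (h t : R) M : 0 < h -> 0 <= t -> M%:R * h <= t ->
  exists2 n, (M <= n)%N & n%:R * h <= t <= n.+1%:R * h.
Proof.
move=> h0 t0 Mt; have th0 : 0 <= t / h by rewrite divr_ge0// ltW.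
exists (Num.truncn (t / h)).
  by rewrite truncn_ge_nat// ler_pdivlMr.
apply/andP; split; first by rewrite -ler_pdivlMr// truncn_le.
by rewrite -ler_pdivrMr// ltW// truncnS_gt.
Qed.

Section smoothing.
Context (R : realType) (h : R) (h0 : 0 < h).

Definition block_oscillation_vanish (J : R -> R) := forall e, 0 < e ->
  exists N, forall n t, (N <= n)%N -> n%:R * h <= t <= n.+1%:R * h ->
    `|J t - J (n%:R * h)| <= e.

(** K is the exponential average int_0^t exp (s - t) J s ds.  Within block n the
    function J stays within e of J(n h), so K - J(n h) contracts exponentially up
    to an error e.  Hence the gap rr n = |K - J| at n h satisfies
    rr n.+1 <= 2 e + rho rr n with rho = exp (- h) < 1 and gets close to the
    fixed point c = 2 e / (1 - rho), which is small with e. *)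
Lemma ornstein_uhlenbeck_smoothing (J : R -> R) :
  continuous J -> block_oscillation_vanish J ->
  exists K : R -> R, (forall t : R, 0 < t -> is_derive t 1 K (J t - K t)) /\
    (J t - K t @[t --> +oo%R] --> (0 : R)).
Proof.
move=> cJ osc.
pose f s := expR s * J s.
have cf : continuous f.
  by move=> s; apply: cvgM; [exact: continuous_expR|exact: cJ].
pose I t := \int[lebesgue_measure]_(s in `[0, t]) f s.
pose K t := expR (- t) * I t.
have dK (t : R) : 0 < t -> is_derive t 1 K (J t - K t).
  move=> t0; have dI := primitive_derive cf t0.
  have dE : is_derive t 1 (fun t : R => expR (- t)) (- expR (- t)).
    have hl : is_derive t 1 (fun t : R => - t) (-1) by exact: is_deriveNid.
    rewrite -mulrN1.
    exact: (@is_derive1_comp R expR (fun t => - t) t _ _ (is_derive_expR _) hl).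
  apply: is_derive_eq; rewrite /GRing.scale/= /f mulrA -expRD addNr expR0 mul1r.
  by rewrite /K mulrN mulrC.
exists K; split => //.
pose rho := expR (- h).
have rho1 : 0 < 1 - rho by rewrite subr_gt0 expR_lt1 oppr_lt0.
apply/vanishP => eps eps0.
(* The final error is 3 e + c = e (3 + 2 / (1 - rho)). *)
pose C := 3 + 2 / (1 - rho); have C0 : 0 < C by rewrite addr_gt0// divr_gt0.
pose e := eps / C; have e0 : 0 < e by rewrite divr_gt0.
have eC : e * C = eps by rewrite /e divfK// gt_eqF.
have [N0 hN0] := osc e e0.
pose N := maxn N0 1.
pose rr n := `|K (n%:R * h) - J (n%:R * h)|.
have blockK n t : (N <= n)%N -> n%:R * h <= t <= n.+1%:R * h ->
    `|K t - J (n%:R * h)| <= e + expR (- (t - n%:R * h)) * rr n.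
  rewrite geq_max => /andP[N0n n1] /andP[nt tn].
  have nh0 : 0 < n%:R * h by rewrite mulr_gt0// ltr0n.
  (* Applied to both signs, as decay_comparison is one-sided. *)
  have cmp (sg : R) : `|sg| <= 1 -> sg * (K t - J (n%:R * h)) <=
      e + expR (- (t - n%:R * h)) * rr n.
    move=> sg1.
    have sgle z : sg * z <= `|z|.
      apply: le_trans (ler_norm _) _; rewrite normrM ler_piMl//.
    pose u s := sg * (K s - J (n%:R * h)).
    have du (s : R) : n%:R * h <= s <= t -> is_derive s 1 u (sg * (J s - K s)).
      move=> /andP[ns st]; have hK := dK s (lt_le_trans nh0 ns).
      by apply: is_derive_eq; rewrite /GRing.scale/= subr0.
    have := @decay_comparison R u (fun s => sg * (J s - K s)) 1 e _ _ nt du.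
    rewrite mul1r => /(_ _)/le_trans; apply.
      move=> s /andP[ns st]; rewrite /u.
      have : sg * (J s - J (n%:R * h)) <= e.
        apply: le_trans (sgle _) _; apply: hN0 => //.
        by rewrite ns (le_trans st).
      rewrite !mulrBr; lra.
    rewrite lerD2l ler_wpM2l ?expR_ge0// /u.
    by apply: le_trans (sgle (K (n%:R * h) - J (n%:R * h))); rewrite gerBl ltW.
  rewrite ler_norml; apply/andP; split.
    by have := cmp (-1); rewrite normrN1 lexx mulN1r => /(_ isT); rewrite lerNl.
  by have := cmp 1; rewrite normr1 lexx mul1r => /(_ isT).
pose c := 2 * e / (1 - rho).
have rec n : (N <= n)%N -> rr n.+1 - c <= rho * (rr n - c).
  move=> Nn; have nn : n%:R * h <= n.+1%:R * h <= n.+1%:R * h.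
    by rewrite lexx andbT ler_pM2r// ler_nat.
  have h1 := blockK n _ Nn nn.
  have h2 : `|J (n.+1%:R * h) - J (n%:R * h)| <= e.
    by apply: hN0 => //; apply: leq_trans Nn; exact: leq_maxl.
  have rhoE : expR (- (n.+1%:R * h - n%:R * h)) = rho.
    by rewrite /rho -natr1; congr expR; ring.
  rewrite rhoE in h1.
  have h3 : rr n.+1 <= 2 * e + rho * rr n.
    rewrite {1}/rr.
    have -> : K (n.+1%:R * h) - J (n.+1%:R * h) = (K (n.+1%:R * h) - J (n%:R * h)) -
      (J (n.+1%:R * h) - J (n%:R * h)) by ring.
    by apply: le_trans (ler_normB _ _) _; move: h1 h2; lra.
  have cE : c = 2 * e + rho * c by rewrite /c; field; rewrite gt_eqF.
  rewrite mulrBr; lra.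
have iter_rec k : rr (N + k)%N - c <= rho ^+ k * rr N.
  elim: k => [|k IH].
    rewrite addn0 expr0 mul1r gerBl /c divr_ge0 ?(ltW rho1)// mulr_ge0// ltW//.
  rewrite addnS; apply: le_trans (rec _ (leq_addr _ _)) _.
  by rewrite exprS -mulrA ler_wpM2l ?expR_ge0.
have [T [_ hT]] := expR_decay (rr N) 0 h0 e0.
pose k0 := (Num.truncn `|T|).+1.
have rsmall n : (N + k0 <= n)%N -> rr n <= e + c.
  move=> Nn; have Nn' : (N <= n)%N by apply: leq_trans Nn; exact: leq_addr.
  rewrite -(subnKC Nn') -lerBlDr; apply: le_trans (iter_rec _) _.
  have -> : rho ^+ (n - N) = expR (- (h * (n - N)%:R)).
    by rewrite /rho -expRM_natl mulrN mulrC.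
  have := hT (n - N)%:R; rewrite subr0; apply.
  apply: le_trans (ler_norm _) _; apply: le_trans (ltW (truncnS_gt _)) _.
  by rewrite ler_nat leq_subRL.
exists ((N + k0)%:R * h) => t Nt.
have t0 : 0 <= t by apply: le_trans Nt; rewrite mulr_ge0// ltW.
have [n Nn tn] := block_locate h0 t0 Nt.
have Nn' : (N <= n)%N by apply: leq_trans Nn; exact: leq_addr.
have h1 := blockK n t Nn' tn.
have h2 : `|J t - J (n%:R * h)| <= e.
  by apply: hN0 => //; apply: leq_trans Nn'; exact: leq_maxl.
have h3 : expR (- (t - n%:R * h)) * rr n <= e + c.
  apply: le_trans (rsmall n Nn); apply: ler_piMl; first exact: normr_ge0.
  rewrite expR_le1 oppr_le0 subr_ge0.
  by case/andP: tn.
have cC : 3 * e + c = eps by rewrite -eC /C /c; ring.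
have -> : J t - K t = (J t - J (n%:R * h)) - (K t - J (n%:R * h)) by ring.
by apply: le_trans (ler_normB _ _) _; lra.
Qed.

End smoothing.

Section pathwise.
Context (R : realType) (h : R) (h0 : 0 < h) (d' : nat).
Local Notation d := d'.+1.
Variables (A : 'M[R]_d) (x : R -> 'cV[R]_d).
Hypothesis hx : {within `[0, +oo[, continuous x}.

(** Along the paths of a solution this is a version of the Ito integral that is
    continuous in time. *)
Definition noise (t : R) (i : 'I_d) : R :=
  x t i 0 - x 0 i 0 - \int[lebesgue_measure]_(s in `[0, t]) (A *m x s) i 0.

Let xt (s : R) := x (Num.max s 0).

Let cx i : continuous (fun s : R => xt s i 0).
Proof.
move=> s; apply: (@continuous_comp R _ R xt (fun M => M i 0)).
  exact: (halfline_extension_continuous hx).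
exact: coord_continuous.
Qed.

Let f i (s : R) := (A *m xt s) i 0.

Let fE i (s : R) : f i s = \sum_j A i j * xt s j 0. Proof. by rewrite /f mxE. Qed.

Let cf i : continuous (f i).
Proof.
have -> : f i = fun s => \sum_j A i j * xt s j 0 by apply/funext => s; rewrite fE.
by move=> s; apply: cvg_sumr => j _; apply: cvgM; [exact: cvg_cst|exact: cx].
Qed.

Let Phi i (t : R) := \int[lebesgue_measure]_(s in `[-1, t]) f i s.

Let dPhi i (t : R) : 0 <= t -> is_derive t 1 (Phi i) (f i t).
Proof. by move=> t0; apply: primitive_derive => //; apply: lt_le_trans t0; rewrite ltrN10. Qed.

Let J i (t : R) := xt t i 0 - x 0 i 0 - (Phi i (Num.max t 0) - Phi i 0).

Let max_cont : continuous (fun t : R => Num.max t 0).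
Proof.
move=> s; exact: (@continuous_max R R idfun (fun=> 0) s (@cvg_id _ _) (@cvg_cst _ _ _ _ _)).
Qed.

Let cJ i : continuous (J i).
Proof.
move=> t; apply: cvgB; first by apply: cvgB; [exact: cx|exact: cvg_cst].
apply: cvgB; last exact: cvg_cst.
apply: (@continuous_comp R R R (fun t => Num.max t 0) (Phi i)); first exact: max_cont.
have m0 : 0 <= Num.max t 0 by rewrite le_max lexx orbT.
have [dP _] := dPhi i m0.
by apply: differentiable_continuous; apply/derivable1_diffP.
Qed.

Let JE i (t : R) : 0 <= t -> J i t = noise t i.
Proof.
move=> t0; rewrite /J /noise /xt !max_l//; congr (_ - _).
have intf : lebesgue_measure.-integrable `[-1, t] (EFin \o f i).
  apply: continuous_compact_integrable; first exact: segment_compact.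
  exact: continuous_subspaceT.
rewrite /Phi (@Rintegral_itvB R (f i) (BLeft (-1)) (BRight t) 0)//.
- rewrite Rintegral_itv_obnd_cbnd.
    apply: eq_Rintegral => s; rewrite inE/= in_itv/= => /andP[s0 _].
    by rewrite /f /xt max_l.
  apply: integrableS intf => //.
  by apply: subset_itvr; rewrite bnd_simp; lra.
- by rewrite bnd_simp; lra.
Qed.

(** The drift over a block is h times an intermediate value of A x, by the mean
    value theorem. *)
Lemma noise_increment_vanish : x t @[t --> +oo%R] --> (0 : 'cV[R]_d) ->
  forall e, 0 < e -> exists N, forall k, (N <= k)%N -> forall i,
    `|noise (grid h 0 k.+1) i - noise (grid h 0 k) i| <= e.
Proof.
move=> x0 e e0.
have xi0 j : x t j 0 @[t --> +oo%R] --> (0 : R).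
  have e1 : (0 : 'cV[R]_d) j 0 = 0 by rewrite mxE.
  rewrite -[X in _ --> X]e1.
  exact: (cvg_comp x (fun M : 'cV[R]_d => M j 0) x0 (@coord_continuous R _ _ j 0 0)).
have f0 i : (\sum_j A i j * x t j 0) @[t --> +oo%R] --> (0 : R).
  have e1 : \sum_j A i j * 0 = 0 :> R by rewrite big1// => k _; rewrite mulr0.
  rewrite -[X in _ --> X]e1.
  by apply: cvg_sumr => k _; apply: cvgM; [exact: cvg_cst|exact: xi0].
pose e1 := e / (2 + h).
have e10 : 0 < e1 by rewrite divr_gt0// ltr_wpDr// ltW.
have H : \forall t \near +oo%R, forall i,
    `|x t i 0| <= e1 /\ `|\sum_j A i j * x t j 0| <= e1.
  apply: filter_forall => i; apply: filterI.
    by have /cvgr0Pnorm_le := xi0 i; exact.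
  by have /cvgr0Pnorm_le := f0 i; exact.
have [M [_ hM]] := H.
pose N := Num.truncn (Num.max M 0 / h).
have hN k : (N < k)%N -> M < grid h 0 k.
  move=> Nk; apply: (@le_lt_trans _ _ (Num.max M 0)); first by rewrite le_max lexx.
  rewrite /grid expr0 divr1 -ltr_pdivrMr//.
  apply: lt_le_trans (truncnS_gt _) _.
  by rewrite ler_nat.
exists N.+1 => k Nk i.
have ab := grid_le h0 0 k k.+1; rewrite leqnSn in ab.
have ga := grid_ge0 h0 0 k.
rewrite -!JE ?grid_ge0// /J !max_l ?grid_ge0//.
have [c + cE] : exists2 c, c \in `[grid h 0 k, grid h 0 k.+1] &
    Phi i (grid h 0 k.+1) - Phi i (grid h 0 k) = f i c * (grid h 0 k.+1 - grid h 0 k).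
  apply: MVT_segment => //.
    by move=> t; rewrite in_itv/= => /andP[t0 _]; apply: dPhi; apply: ltW; apply: le_lt_trans t0.
  apply: derivable_within_continuous => t; rewrite in_itv/= => /andP[t0 _].
  by have [] := dPhi i (le_trans ga t0).
rewrite in_itv/= => /andP[c0 _].
have [h1 _] := hM _ (hN k Nk) i.
have [h2 _] := hM _ (hN k.+1 (leqW Nk)) i.
have [_ h3] := hM _ (lt_le_trans (hN k Nk) c0) i.
have fc : `|f i c| <= e1.
  rewrite fE (_ : \sum_j _ = \sum_j A i j * x c j 0)//.
  by apply: eq_bigr => j _; rewrite /xt max_l// (le_trans ga).
have -> : xt (grid h 0 k.+1) i 0 - x 0 i 0 - (Phi i (grid h 0 k.+1) - Phi i 0) -
    (xt (grid h 0 k) i 0 - x 0 i 0 - (Phi i (grid h 0 k) - Phi i 0)) =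
    x (grid h 0 k.+1) i 0 - x (grid h 0 k) i 0 - f i c * h.
  move: cE; rewrite gridS expr0 divr1 addrAC subrr add0r => cE.
  by rewrite -cE /xt !max_l ?addr_ge0// ?ltW//; ring.
have eE : e = e1 + e1 + e1 * h by rewrite /e1; field; rewrite gt_eqF// ltr_wpDr// ltW.
rewrite eE; apply: le_trans (ler_normB _ _) _; apply: lerD.
  by apply: le_trans (ler_normB _ _) _; exact: lerD.
by rewrite normrM (ger0_norm (ltW h0)) ler_wpM2r// ltW.
Qed.

Hypothesis hA : forall z : complex R, complex_eigenvalue A z -> complex.Re z < 0.
Hypothesis hosc : forall i e, 0 < e -> exists N, forall n, (N <= n)%N ->
  forall m k, (n * 2 ^ m <= k <= n.+1 * 2 ^ m)%N ->
  `|noise (grid h m k) i - noise (grid h m (n * 2 ^ m)) i| <= e.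

Let oscJ i : block_oscillation_vanish h (J i).
Proof.
move=> e e0; have e20 : 0 < e / 2 by rewrite divr_gt0.
have [N hN] := hosc i e20; exists N => n t Nn /andP[nt tn].
have nh0 : 0 <= n%:R * h by rewrite mulr_ge0// ltW.
have t0 := le_trans nh0 nt.
move: (nt); rewrite le_eqVlt => /predU1P[<-|ltnt]; first by rewrite subrr normr0 ltW.
have /cvgrPdist_lt /(_ _ e20) [dl /= dl0 hdl] : J i s @[s --> t] --> J i t by exact: cJ.
have [m _ hm] : \forall m \near \oo, h / 2 ^+ (0 + m) < dl.
  by have /cvgr_lt/(_ _ dl0) := mesh_cvg0 h 0.
have {}hm := hm m (leqnn m).
have [k kL /andP[kt tk]] : exists2 k, (k < n.+1 * 2 ^ m)%N & grid h m k < t <= grid h m k.+1.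
  by apply: grid_locate; rewrite ?grid_block// (le_lt_trans nh0).
have nk : (n * 2 ^ m <= k.+1)%N.
  by rewrite -(grid_le h0 m) grid_block; exact: le_trans nt tk.
have := hN n Nn m k.+1; rewrite nk kL => /(_ isT).
rewrite -!JE ?grid_ge0// grid_block => h1.
have h2 : `|J i t - J i (grid h m k.+1)| < e / 2.
  apply: hdl; rewrite /= distrC ger0_norm ?subr_ge0//.
  apply: le_lt_trans hm; rewrite add0n lerBlDr addrC -lerBlDr gridS addrK.
  exact: ltW.
have -> : J i t - J i (n%:R * h) = (J i t - J i (grid h m k.+1)) +
  (J i (grid h m k.+1) - J i (n%:R * h)) by ring.
by apply: le_trans (ler_normD _ _) _; lra.
Qed.

(** With z = J - K the smoothing error, y = x - z is differentiable although x
    need not be, and y' = A x + z = A y + (A z + z), whose forcing term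
    tends to 0. *)
Lemma pathwise_vanish : x t @[t --> +oo%R] --> (0 : 'cV[R]_d).
Proof.
have /choice[K hK] := fun i => ornstein_uhlenbeck_smoothing h0 (@cJ i) (@oscJ i).
pose z i t := J i t - K i t.
have z0 i : z i t @[t --> +oo%R] --> (0 : R) by case: (hK i).
pose y i t := x 0 i 0 - Phi i 0 + Phi i t + K i t.
have xE i (t : R) : 0 <= t -> xt t i 0 = y i t + z i t.
  by move=> t0; rewrite /y /z /J max_l//; ring.
pose g i t := \sum_j A i j * z j t + z i t.
have y0 i : y i t @[t --> +oo%R] --> (0 : R).
  apply: (@hurwitz_vanish R d' A y g 1) => //.
    move=> j t t1; have t0 : 0 < t by apply: lt_le_trans t1.
    have h1 := dPhi j (ltW t0); have [h2 _] := hK j; have {}h2 := h2 t t0.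
    have -> : \sum_k A j k * y k t + g j t = f j t + z j t.
      rewrite fE /g addrA -big_split/=; congr (_ + _).
      by apply: eq_bigr => k _; rewrite -mulrDr xE// ltW.
    have -> : y j = cst (x 0 j 0 - Phi j 0) + Phi j + K j by apply/funext.
    have -> : f j t + z j t = 0 + f j t + (J j t - K j t) by rewrite add0r.
    by apply: is_deriveD.
  move=> j; have e : \sum_k A j k * 0 + 0 = 0 :> R.
    by rewrite addr0 big1// => k _; rewrite mulr0.
  rewrite -[X in _ --> X]e; apply: cvgD => //.
  by apply: cvg_sumr => k _; apply: cvgM; [exact: cvg_cst|exact: z0].
apply/cvgr0Pnorm_le => e e0.
have H i : \forall t \near +oo%R, `|x t i 0| <= e.
  have : (y i t + z i t) @[t --> +oo%R] --> (0 : R).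
    by rewrite -[X in _ --> X](addr0 (0 : R)); apply: cvgD.
  move=> /vanishP/(_ e e0)[T hT].
  exists (Num.max T 0); split; first exact: num_real.
  move=> t; rewrite /= gt_max => /andP[/ltW/hT hTt /ltW t0].
  by rewrite -[x t](_ : xt t = _) ?xE// /xt max_l.
have : \forall t \near +oo%R, forall i, `|x t i 0| <= e by exact: filter_forall.
apply: filterS => t Ht.
rewrite [`|_|]mx_normrE; apply: bigmax_le; first exact: ltW.
by move=> [i j] _ /=; rewrite (ord1 j).
Qed.

End pathwise.

(** * The event that a solution vanishes at infinity *)
Lemma grid_dense (R : realType) (h t dl : R) : 0 < h -> 0 < t -> 0 < dl ->
  exists m k, t <= grid h m k < t + dl.
Proof.
move=> h0 t0 dl0.
have [m _ hm] : \forall m \near \oo, h / 2 ^+ (0 + m) < dl.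
  by have /cvgr_lt/(_ _ dl0) := mesh_cvg0 h 0.
have {}hm := hm m (leqnn m); rewrite add0n in hm.
have [k _ /andP[kt tk]] : exists2 k,
    (k < (Num.truncn (t / h)).+1 * 2 ^ m)%N & grid h m k < t <= grid h m k.+1.
  by apply: grid_locate => //; rewrite grid_block -ler_pdivrMr// ltW// truncnS_gt.
exists m, k.+1; rewrite tk/= gridS.
by apply: ltrD.
Qed.

Section solution.
Context disp (T : measurableType disp) (R : realType) (P : probability T R).
Variables (F : R -> set (set T)) (d' r : nat) (B : R -> T -> 'cV[R]_r).
Local Notation d := d'.+1.
Hypotheses (hF : filtration F) (hB : brownian_motion P F B).
Variables (sigma : R -> 'M[R]_(d, r)).
Hypothesis hsigma : {within `[0, +oo[, continuous sigma}.
Variables (h : R) (h0 : 0 < h).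
Variables (A : 'M[R]_d) (xi : 'cV[R]_d) (x : R -> T -> 'cV[R]_d).
Hypothesis hx : is_solution P F B A sigma xi x.

Let vanish : set T := [set w | x t w @[t --> +oo%R] --> (0 : 'cV[R]_d)].

Lemma measurable_solution t i : 0 <= t -> measurable_fun setT (fun w => x t w i 0).
Proof.
move=> t0 _ C mC; rewrite setTI; case: hx => adx _ _ _.
by case: hF => _ + _; apply; [exact: t0|exact: adx].
Qed.

(** Paths are continuous, so it is enough to watch them at dyadic times. *)
Lemma measurable_vanish : measurable vanish.
Proof.
have -> : vanish = \bigcap_i \bigcap_q \bigcup_N
    \bigcap_m \bigcap_(k in [set k | N%:R <= grid h m k])
    ~` [set w | q.+1%:R^-1 < `|x (grid h m k) w i 0|].
  apply/seteqP; split=> [w x0 i _ q _|w H].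
    have q0 : 0 < q.+1%:R^-1 :> R by rewrite invr_gt0.
    have /cvgr0Pnorm_le/(_ _ q0)[M [_ hM]] := x0.
    exists (Num.truncn (Num.max M 0)).+1 => // m _ k /= Nmk.
    apply/negP; rewrite -leNgt; apply: le_trans (hM _ _); last first.
      apply: lt_le_trans Nmk; apply: le_lt_trans (truncnS_gt _).
      by rewrite le_max lexx.
    rewrite [leRHS]mx_normrE.
    exact: (le_bigmax _ (fun ij : 'I_d * 'I_1 => `|x (grid h m k) w ij.1 ij.2|) (i, 0)).
  apply/cvgr0Pnorm_le => e e0.
  have [q qe] : exists q : nat, q.+1%:R^-1 < e.
    exists (Num.truncn e^-1); rewrite invf_plt ?posrE//; exact: truncnS_gt.
  have K i : \forall t \near +oo%R, `|x t w i 0| <= e.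
    have [N _ hN] := H i Logic.I q Logic.I.
    exists (Num.max N%:R 0); split; first exact: num_real.
    move=> t; rewrite gt_max => /andP[Nt t0].
    case: hx => _ /(_ w) cx _ _.
    have ct : (fun s : R => x (Num.max s 0) w i 0) s @[s --> t] --> x t w i 0.
      have c1 := halfline_extension_continuous cx.
      have := cvg_comp _ (fun M : 'cV[R]_d => M i 0) (c1 t) (@coord_continuous R _ _ i 0 _).
      by rewrite /= max_l// ltW.
    rewrite leNgt; apply/negP => ex.
    have dl0 : 0 < `|x t w i 0| - e by rewrite subr_gt0.
    have /cvgrPdist_lt/(_ _ dl0)[dl /= dl1 hdl] := ct.
    have [m [k /andP[tk kt]]] := grid_dense h0 t0 dl1.
    have := hN m Logic.I k (le_trans (ltW Nt) tk) => /= /negP; rewrite -leNgt => h1.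
    have /hdl : ball t dl (grid h m k).
      by rewrite /ball/= distrC ger0_norm ?subr_ge0// ltrBlDl.
    rewrite max_l ?grid_ge0// => h2.
    have := le_lt_trans h1 qe; rewrite ltNge => /negP; apply; apply: ltW.
    have h4 := lerB_dist (x t w i 0) (x (grid h m k) w i 0).
    by have := le_lt_trans h4 h2; rewrite ltrD2l ltrN2.
  have : \forall t \near +oo%R, forall i, `|x t w i 0| <= e by exact: filter_forall.
  apply: filterS => t Ht.
  rewrite [`|_|]mx_normrE; apply: bigmax_le; first exact: ltW.
  by move=> [i j] _ /=; rewrite (ord1 j).
apply: fin_bigcap_measurable => // i _; apply: bigcap_measurableType => q _.
apply: bigcup_measurable => N _; apply: bigcap_measurableType => m _.
apply: bigcap_measurableType => k _ /=.
apply: measurableC; apply: measurable_gt; apply: measurableT_comp => //.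
by apply: measurable_solution; exact: grid_ge0.
Qed.

(** There are countably many dyadic times, so one null set serves them all. *)
Lemma noise_ito : exists2 ito : R -> T -> 'cV[R]_d,
  (forall t, 0 <= t -> is_ito_integral P B sigma t (ito t)) &
  {ae P, forall w, forall m k i,
    noise A (x^~ w) (grid h m k) i = ito (grid h m k) w i 0}.
Proof.
case: hx => _ _ _ hI.
have /choice[ito hito] : forall t : R, exists I, 0 <= t -> is_ito_integral P B sigma t I /\
    {ae P, forall w, x t w = x 0 w +
      \col_i \int[lebesgue_measure]_(s in `[0, t]) (A *m x s w) i 0 + I w}.
  move=> t; have [/hI[I h1 h2]|_] := boolP (0 <= t); first by exists I.
  by exists (fun=> 0).
exists ito => [t /hito[]//|].
apply/ae_foralln => m; apply/ae_foralln => k.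
have [_] := hito _ (grid_ge0 h0 m k).
apply: filterS => w e i; rewrite /noise [in LHS]e !mxE; ring.
Qed.

Hypothesis hA : forall z : complex R, complex_eigenvalue A z -> complex.Re z < 0.

Lemma solution_vanishes : block_intensity sigma h n * ln n%:R @[n --> \oo] --> 0 ->
  {ae P, forall w, vanish w}.
Proof.
move=> a0; have [ito hito hnoise] := noise_ito.
have hosc : {ae P, forall w, forall i (q : nat), ~ lim_sup_set (fun n =>
    \bigcup_m dyadic_excursion h ito n i q.+1%:R^-1 m) w}.
  have H i q : {ae P, forall w, ~ lim_sup_set (fun n =>
      \bigcup_m dyadic_excursion h ito n i q.+1%:R^-1 m) w}.
    have q0 : 0 < q.+1%:R^-1 :> R by rewrite invr_gt0.
    exists (lim_sup_set (fun n => \bigcup_m dyadic_excursion h ito n i q.+1%:R^-1 m)).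
    split; last by move=> w /= /contrapT.
      apply: bigcap_measurableType => n _; apply: bigcup_measurable => k _.
      apply: bigcup_measurable => m _; exact: (measurable_dyadic_excursion h0 hito).
    exact: (excursions_vanish hF hB hsigma h0 hito).
  apply: filter_forall => i; exact/ae_foralln.
case: hx => _ cx _ _.
apply: filterS2 hnoise hosc => w hn ho.
apply: (pathwise_vanish h0 (cx w) hA) => i e e0.
have [q qe] : exists q : nat, q.+1%:R^-1 < e.
  exists (Num.truncn e^-1); rewrite invf_plt ?posrE//; exact: truncnS_gt.
apply: contrapT => hN; apply: (ho i q) => N _; apply: contrapT => hN'.
apply: hN; exists N => n Nn m k nk; rewrite !hn leNgt; apply/negP => he.
apply: hN'; exists n => //; exists m => //; exists k => //.
exact: lt_trans he.
Qed.

(** Otherwise some threshold y is exceeded, almost surely, by increments of the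
    Ito integral over infinitely many blocks, while along a vanishing path the
    increments of the noise tend to 0. *)
Lemma intensity_decay : nonincreasing_seq (block_intensity sigma h) ->
  (0 < P vanish)%E -> block_intensity sigma h n * ln n%:R @[n --> \oo] --> 0.
Proof.
move=> hmon Pv; apply: contrapT => na; have [ito hito hnoise] := noise_ito.
have [y y0 hy] := small_increments_null hF hB (ltn0Sn d') hsigma h0 hito hmon na.
case: hnoise => Z [mZ Z0 hZ].
pose U := \bigcup_N \bigcap_n small_increments h ito N n y.
have mU N : measurable (\bigcap_n small_increments h ito N n y).
  by apply: bigcap_measurableType => n _; exact: (measurable_small_increments h0 hito).
have U0 : P U = 0%E.
  apply: measure_negligible; first exact: bigcup_measurable.
  apply: negligible_bigcup => N.
  by exists (\bigcap_n small_increments h ito N n y); split; [exact: mU|exact: hy|].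
have : (P vanish <= P (Z `|` U))%E.
  apply: le_measure; rewrite ?inE.
  - exact: measurable_vanish.
  - by apply: measurableU => //; apply: bigcup_measurable.
  move=> w vw; have [|nZ] := pselect (Z w); first by left.
  right; have hn : forall m k i, noise A (x^~ w) (grid h m k) i = ito (grid h m k) w i 0.
    by apply: contrapT => nh; apply: nZ; exact: hZ.
  case: hx => _ cx _ _.
  have [N hN] := noise_increment_vanish h0 A (cx w) vw y0.
  exists N => // n _ k /andP[Nk _] i; rewrite -!hn; exact: hN.
have mU' : measurable U by exact: bigcup_measurable.
have ZU0 : P (Z `|` U) = 0%E by rewrite (@measureU0 _ _ _ P).
by rewrite ZU0 => /(lt_le_trans Pv); rewrite ltxx.
Qed.

End solution.

Theorem theorem11 (R : realType) (d r : nat) (hd : (0 < d)%N) (hr : (0 < r)%N)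
    (disp : measure_display) (T : measurableType disp) (P : probability T R)
    (F : R -> set (set T)) (hF : filtration F)
    (B : R -> T -> 'cV[R]_r) (hB : brownian_motion P F B)
    (sigma : R -> 'M[R]_(d, r)) (hsigma : {within `[0, +oo[, continuous sigma})
    (A : 'M[R]_d)
    (hA : forall z : complex R, complex_eigenvalue A z -> complex.Re z < 0)
    (X : 'cV[R]_d -> R -> T -> 'cV[R]_d)
    (hX : forall xi, is_solution P F B A sigma xi (X xi))
    (h : R) (hh : 0 < h)
    (hmon : nonincreasing_seq (block_intensity sigma h)) :
  let cond_A := block_intensity sigma h n * ln n%:R @[n --> \oo] --> 0 in
  let cond_B := forall xi : 'cV[R]_d,
    {ae P, forall w, X xi t w @[t --> +oo%R] --> (0 : 'cV[R]_d)} in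
  let cond_C :=
    exists xi : 'cV[R]_d,
      (0 < P [set w | (X xi t w @[t --> +oo%R] --> (0 : 'cV[R]_d))%R])%E in
  (cond_A <-> cond_B) /\ (cond_B <-> cond_C).
Proof.
move=> cond_A cond_B cond_C.
case: d => [//|d'] in hd sigma hsigma A hA X hX hmon cond_A cond_B cond_C *.
have AB : cond_A -> cond_B.
  by move=> a xi; exact: (solution_vanishes hF hB hsigma hh (hX xi) hA a).
have CA : cond_C -> cond_A.
  by move=> [xi Pxi]; exact: (intensity_decay hF hB hsigma hh (hX xi) hmon Pxi).
have BC : cond_B -> cond_C.
  move=> b; exists 0; have [N [mN N0 hN]] := b 0.
  set V := [set _ | _].
  have mV : measurable V by exact: (measurable_vanish hF hh (hX 0)).
  have VN : setT `<=` V `|` N.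
    by move=> w _; have [|/hN] := pselect (V w); [left|right].
  rewrite lt0e measure_ge0 andbT; apply/eqP => V0.
  have : (P setT <= P (V `|` N))%E by apply: le_measure; rewrite ?inE//; exact: measurableU.
  have -> : P (V `|` N) = 0%E by rewrite (@measureU0 _ _ _ P).
  by rewrite probability_setT lee_fin ler10.
by split; split; [exact: AB|move=> /BC/CA|exact: BC|move=> /CA/AB].
Qed.
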